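(* The multiplicative extension $\Phi_{\mathrm{fer}}:(U(\mathrm{PSL}(A)),\star,\Delta_{\sqcup\!\sqcup},\mathbf 1,\varepsilon)\to(U(\mathfrak g(A)),\star,\Delta_{\sqcup\!\sqcup},\mathbf 1,\varepsilon)$ of the planar fertility map to universal enveloping algebras is a Hopf algebra morphism, and by graded linear duality it induces (as its transpose) a Hopf algebra isomorphism $$J:\mathcal H_{\mathrm{PLOT}}^{A}\longrightarrow\mathcal H_{\mathrm{MKW}}^{A}.$$
   Context: $\mathbf{k}$ is a field of characteristic zero and $A$ is a finite set. Post-Lie algebras and the Guin–Oudom construction. A post-Lie algebra $(\mathbf g,\blacktriangleright,[-,-])$ is a Lie algebra with a bilinear product $\blacktriangleright$ such that $x\blacktriangleright[y,z]=[x\blacktriangleright y,z]+[y,x\blacktriangleright z]$ and $[x,y]\blacktriangleright z=a_\blacktriangleright(x,y,z)-a_\blacktriangleright(y,x,z)$, with $a_\blacktriangleright(x,y,z)=x\blacktriangleright(y\blacktriangleright z)-(x\blacktriangleright y)\blacktriangleright z$. The product extends uniquely to the enveloping algebra $U(\mathbf g)$ by $\mathbf 1\blacktriangleright X=X$, $(xX)\blacktriangleright y=x\blacktriangleright(X\blacktriangleright y)-(x\blacktriangleright X)\blacktriangleright y$, $X\blacktriangleright(YZ)=\sum_{(X)}(X_{(1)}\blacktriangleright Y)(X_{(2)}\blacktriangleright Z)$ ($x,y\in\mathbf g$, $X,Y,Z\in U(\mathbf g)$), where $\Delta_{\sqcup\!\sqcup}(X)=\sum X_{(1)}\otimes X_{(2)}$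 is the usual cocommutative coproduct of $U(\mathbf g)$ (elements of $\mathbf g$ primitive). The Grossman–Larson product is $X\star Y=\sum_{(X)}X_{(1)}(X_{(2)}\blacktriangleright Y)$, and $(U(\mathbf g),\star,\Delta_{\sqcup\!\sqcup},\mathbf 1,\varepsilon)$ is a Hopf algebra. Word side. $\mathcal Z_A=\{z_i^a \mid a\in A,\ i\in\mathbb Z_{\ge -1}\}$, $\overline{\mathrm{PN}}(A)=\mathbf{k}\langle \mathcal Z_A\rangle$, $\mathrm{wt}(z_i^a)=i$ (additive on words), $\overline{\mathrm{PN}}(A)_{\le 0}$ is the span of monomials of weight $\le0$, $[x,y]_{\cdot}=xy-yx$, $\partial(z_i^a)=z_{i+1}^a$ on letters. $V(A)$ is the span of the monomials $z_{i_1}^{a_1}\cdots z_{i_p}^{a_p}$ with $\sum_{r=1}^p i_r=-1$ and $\sum_{r=1}^q i_r\ge 0$ for $1\le q<p$. $\mathfrak g(A)$ is the Lie subalgebra of $\overline{\mathrm{PN}}(A)_{\le 0}$ generated by $V(A)$; it is a post-Lie algebra for the product given on monomials $\mathbf x$, $\mathbf y=y_1\cdots y_q$ by $\mathbf x\blacktriangleright_w\mathbf y=\sum_{j} y_1\cdots y_{j-1}\,\partial^{-\mathrm{wt}(\mathbf x)}(y_j)\,\mathbf x\,y_{j+1}\cdots y_q$. It is graded by word length with finite-dimensional components. $\mathcal H_{\mathrm{PLOT}}^{A}$ is the graded dual Hopf algebra of $(U(\mathfrak g(A)),\star,\Delta_{\sqcup\!\sqcup},\mathbf 1,\varepsilon)$.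 Tree side. $\mathcal{OT}^A$ is the set of $A$-decorated planar rooted trees, $\mathcal{OF}^A$ the set of ordered forests (finite sequences of such trees, including the empty forest $\mathbf 1$). $\mathrm{PSL}(A)=\mathrm{Lie}(\mathbf{k}\,\mathcal{OT}^A)$ is the free Lie algebra on $\mathcal{OT}^A$ inside $\mathbf{k}\,\mathcal{OF}^A$ (with concatenation and commutator bracket), and $U(\mathrm{PSL}(A))=\mathbf{k}\,\mathcal{OF}^A$. For trees $s,t$, the left grafting $s\curvearrowright_l t$ is the sum over vertices $v$ of $t$ of the tree obtained by attaching the root of $s$ to $v$ as its leftmost child; extended by the post-Lie axioms it makes $\mathrm{PSL}(A)$ the free post-Lie algebra on $A$. The Munthe-Kaas–Wright Hopf algebra $\mathcal H_{\mathrm{MKW}}^A$ is $\mathbf{k}\,\mathcal{OF}^A$ with product the shuffle of forests (viewed as words in trees) and coproduct given on a tree by $\Delta_{\mathrm{MKW}}(t)=\sum_{c}P^c(t)\otimes R^c(t)$ over left-admissible cuts $c$, where: a left-admissible cut is a set of edges of $t$ such that each path from the root to a leaf contains at most one cut edge, and such that if an edge from a vertex $v$ to one of its children is cut then so are all edges from $v$ to children further left (the empty cut is allowed, contributing $\mathbf 1\otimes t$, and a total cut is added, contributing $t\otimes\mathbf 1$); $R^c(t)$ is the remaining component containing the root, and $P^c(t)$ is the shuffle product, over the vertices $v$, of the forests formed by concatenating in planar order the subtrees cut off from $v$. On forests, $\Delta_{\mathrm{MKW}}(f)=(\mathrm{id}\otimes B^-)(\Delta_{\mathrm{MKW}}(B_a^+(f))-B_a^+(f)\otimes\mathbf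 1)$ for any $a\in A$, where $B_a^+$ grafts all trees of a forest on a new root decorated by $a$ and $B^-$ removes the root. It is graded by number of vertices. It is known that $\mathcal H_{\mathrm{MKW}}^A$ is the graded dual of $(U(\mathrm{PSL}(A)),\star,\Delta_{\sqcup\!\sqcup},\mathbf 1,\varepsilon)$, with $\mathcal{OF}^A$ being the basis dual to the forest basis of $U(\mathrm{PSL}(A))$. Fertility map. The root-subtree order of the vertices of a planar rooted tree lists the root first, then the vertices of the subtrees attached to the root from left to right, each ordered recursively. With $d(v)$ the decoration and $f(v)$ the number of children of $v$, and $v_1<\dots<v_p$ the vertices of $t$ in this order, $\Phi_{\mathrm{fer}}^{\mathcal T}(t)=z_{f(v_1)-1}^{d(v_1)}\cdots z_{f(v_p)-1}^{d(v_p)}$; the planar fertility map $\Phi_{\mathrm{fer}}:\mathrm{PSL}(A)\to\mathfrak g(A)$ is the Lie algebra morphism extending $\Phi_{\mathrm{fer}}^{\mathcal T}$ from $\mathcal{OT}^A$. *)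

(* Defs.v *)
From HB Require Import structures.
From mathcomp Require Import all_boot all_algebra finmap.
From mathcomp Require Import boolp functions.
From mathcomp.multinomials Require Import monalg.

Set Implicit Arguments.
Unset Strict Implicit.
Unset Printing Implicit Defensive.

Import GRing.Theory.
Local Open Scope ring_scope.
Local Open Scope quotient_scope.

(* The element specified by P; x0 only serves when P has no solution.  Below it
   is applied to specifications that have exactly one solution. *)
Definition the (T : Type) (x0 : T) (P : T -> Prop) : T :=
  if pselect (exists x, P x) is left e then sval (cid e) else x0.

(* ** Tensor product of vector spaces
   A formal sum of pure tensors is a list of pairs; two of them are identified
   when every bilinear map gives them the same value, so that the universal
   property of the tensor product holds by construction. *)

Section Tensor.
Variables (k : fieldType) (U V : lmodType k).

Definition bilin (W : lmodType k) (B : U -> V -> W) : Prop :=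
  (forall v, linear (B^~ v)) /\ (forall u, linear (B u)).

Definition tens_sum (W : lmodType k) (B : U -> V -> W) (s : seq (U * V)) : W :=
  \sum_(p <- s) B p.1 p.2.

Definition tens_rel (s s' : seq (U * V)) : bool :=
  `[< forall (W : lmodType k) (B : U -> V -> W),
        bilin B -> tens_sum B s = tens_sum B s' >].

Lemma tens_rel_refl : reflexive tens_rel.
Proof. by move=> s; apply/asboolP. Qed.

Lemma tens_rel_sym : symmetric tens_rel.
Proof.
by move=> s t; apply/asboolP/asboolP => h W B hB; rewrite h.
Qed.

Lemma tens_rel_trans : transitive tens_rel.
Proof.
move=> t s u /asboolP h /asboolP h'; apply/asboolP => W B hB.
by rewrite h ?h'.
Qed.

Canonical tens_equiv :=
  EquivRel tens_rel tens_rel_refl tens_rel_sym tens_rel_trans.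

Definition tens := {eq_quot tens_equiv}.
HB.instance Definition _ := Choice.on tens.
HB.instance Definition _ := EqQuotient.on tens.

Definition pure (u : U) (v : V) : tens := \pi_tens [:: (u, v)].

(* The linear map induced by a bilinear map. *)
Definition tens_lift (W : lmodType k) (B : U -> V -> W) (t : tens) : W :=
  tens_sum B (repr t).

Lemma tens_liftE (W : lmodType k) (B : U -> V -> W) s :
  bilin B -> tens_lift B (\pi_tens s) = tens_sum B s.
Proof.
move=> hB; rewrite /tens_lift.
have /eqmodP/asboolP h : \pi_tens (repr (\pi_tens s)) = \pi_tens s.
  by rewrite reprK.
exact: h.
Qed.

Lemma tens_ext (t t' : tens) :
  (forall (W : lmodType k) (B : U -> V -> W),
     bilin B -> tens_lift B t = tens_lift B t') -> t = t'.
Proof.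
move=> h; rewrite -[t]reprK -[t']reprK; apply/eqmodP/asboolP => W B hB.
exact: h.
Qed.

Definition tens0 : tens := \pi_tens [::].
Definition tens_add (t t' : tens) : tens := \pi_tens (repr t ++ repr t').
Definition tens_scale (a : k) (t : tens) : tens :=
  \pi_tens [seq (a *: p.1, p.2) | p <- repr t].
Definition tens_opp : tens -> tens := tens_scale (-1).

Section LiftOps.
Variables (W : lmodType k) (B : U -> V -> W) (hB : bilin B).

Lemma tens_lift0 : tens_lift B tens0 = 0.
Proof. by rewrite tens_liftE // /tens_sum big_nil. Qed.

Lemma tens_lift_add t t' :
  tens_lift B (tens_add t t') = tens_lift B t + tens_lift B t'.
Proof. by rewrite tens_liftE // /tens_sum big_cat. Qed.

Lemma tens_lift_scale a t :
  tens_lift B (tens_scale a t) = a *: tens_lift B t.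
Proof.
rewrite tens_liftE // /tens_lift /tens_sum big_map scaler_sumr.
apply: eq_bigr => p _ /=; have lB := hB.1 p.2.
have B0 : B 0 p.2 = 0.
  by have /= := lB (-1) 0 0; rewrite scaler0 addr0 scaleN1r addNr.
by have := lB a p.1 0; rewrite B0 !addr0.
Qed.

Lemma tens_lift_opp t : tens_lift B (tens_opp t) = - tens_lift B t.
Proof. by rewrite tens_lift_scale scaleN1r. Qed.
End LiftOps.

Let liftE := (tens_lift_add, tens_lift_opp, tens_lift0, tens_lift_scale).

Lemma tens_addA : associative tens_add.
Proof. by move=> x y z; apply: tens_ext => W B h; rewrite !liftE // addrA. Qed.
Lemma tens_addC : commutative tens_add.
Proof. by move=> x y; apply: tens_ext => W B h; rewrite !liftE // addrC. Qed.
Lemma tens_add0 : left_id tens0 tens_add.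
Proof. by move=> x; apply: tens_ext => W B h; rewrite !liftE // add0r. Qed.
Lemma tens_addN : left_inverse tens0 tens_opp tens_add.
Proof. by move=> x; apply: tens_ext => W B h; rewrite !liftE // addNr. Qed.

HB.instance Definition _ :=
  GRing.isZmodule.Build tens tens_addA tens_addC tens_add0 tens_addN.

Lemma tens_scaleA a b t :
  tens_scale a (tens_scale b t) = tens_scale (a * b) t.
Proof. by apply: tens_ext => W B h; rewrite !liftE // scalerA. Qed.
Lemma tens_scale1 : left_id 1 tens_scale.
Proof. by move=> t; apply: tens_ext => W B h; rewrite !liftE // scale1r. Qed.
Lemma tens_scaleDr : right_distributive tens_scale +%R.
Proof.
by move=> a x y; apply: tens_ext => W B h; rewrite !liftE // scalerDr.
Qed.
Lemma tens_scaleDl t : {morph tens_scale^~ t : a b / a + b}.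
Proof.
by move=> a b; apply: tens_ext => W B h; rewrite !liftE // scalerDl.
Qed.

HB.instance Definition _ := GRing.Zmodule_isLmodule.Build k tens
  tens_scaleA tens_scale1 tens_scaleDr tens_scaleDl.

End Tensor.

Definition tens_map (k : fieldType) (U V U' V' : lmodType k)
    (f : U -> U') (g : V -> V') : tens U V -> tens U' V' :=
  tens_lift (fun u v => pure (f u) (g v)).

Definition tens_mul (k : fieldType) (U : algType k) (s t : tens U U) :
    tens U U :=
  tens_lift (fun a b => tens_lift (fun c d => pure (a * c) (b * d)) t) s.

(* ** Hopf algebra data and morphisms
   The antipode of a Hopf algebra is determined by the operations below and is
   preserved by every morphism of the underlying bialgebras. *)

Record hopfData (k : fieldType) := HopfData {
  carrier :> lmodType k;
  hmul : carrier -> carrier -> carrier;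
  hone : carrier;
  hcomul : carrier -> tens carrier carrier;
  hcounit : carrier -> k }.

Record hopf_morphism (k : fieldType) (H H' : hopfData k) (f : H -> H') : Prop :=
  HopfMorphism {
    hopf_linear : linear f;
    hopf_mul : forall x y, f (hmul x y) = hmul (f x) (f y);
    hopf_one : f (hone H) = hone H';
    hopf_comul : forall x, hcomul (f x) = tens_map f f (hcomul x);
    hopf_counit : forall x, hcounit (f x) = hcounit x }.

Definition hopf_isomorphism (k : fieldType) (H H' : hopfData k)
    (f : H -> H') : Prop :=
  hopf_morphism f /\ bijective f.

(* ** Lie algebras and enveloping algebras *)

HB.mixin Record isLieAlgebra (k : fieldType) L of GRing.Lmodule k L := {
  lie : L -> L -> L;
  lie_bilin : bilin lie;
  liexx : forall x, lie x x = 0;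
  lie_jacobi : forall x y z,
    lie x (lie y z) + lie y (lie z x) + lie z (lie x y) = 0 }.

#[short(type="lieAlgType")]
HB.structure Definition LieAlgebra (k : fieldType) :=
  { L of GRing.Lmodule k L & isLieAlgebra k L }.

(* Morphisms to an associative algebra with its commutator bracket. *)
Definition lie_to_assoc (k : fieldType) (L : lieAlgType k) (B : algType k)
    (f : L -> B) : Prop :=
  linear f /\ forall x y, f (lie x y) = f x * f y - f y * f x.

Definition lie_morphism (k : fieldType) (L L' : lieAlgType k)
    (f : L -> L') : Prop :=
  linear f /\ forall x y, f (lie x y) = lie (f x) (f y).

(* A noncommutative polynomial in the elements of L is a list of coefficients
   and words; two of them are identified when every Lie morphism from L to an
   associative algebra gives them the same value, so that the universal property
   of the enveloping algebra holds by construction. *)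
Section Enveloping.
Variables (k : fieldType) (L : lieAlgType k).

Definition env_sum (B : algType k) (f : L -> B) (s : seq (k * seq L)) : B :=
  \sum_(p <- s) p.1 *: \prod_(x <- p.2) f x.

Definition env_rel (s s' : seq (k * seq L)) : bool :=
  `[< forall (B : algType k) (f : L -> B),
        lie_to_assoc f -> env_sum f s = env_sum f s' >].

Lemma env_rel_refl : reflexive env_rel.
Proof. by move=> s; apply/asboolP. Qed.

Lemma env_rel_sym : symmetric env_rel.
Proof.
by move=> s t; apply/asboolP/asboolP => h B f hf; rewrite h.
Qed.

Lemma env_rel_trans : transitive env_rel.
Proof.
move=> t s u /asboolP h /asboolP h'; apply/asboolP => B f hf.
by rewrite h ?h'.
Qed.

Canonical env_equiv :=
  EquivRel env_rel env_rel_refl env_rel_sym env_rel_trans.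

Definition env := {eq_quot env_equiv}.
HB.instance Definition _ := Choice.on env.
HB.instance Definition _ := EqQuotient.on env.

Definition env_inj (x : L) : env := \pi_env [:: (1, [:: x])].

Definition env_lift (B : algType k) (f : L -> B) (t : env) : B :=
  env_sum f (repr t).

Lemma env_liftE (B : algType k) (f : L -> B) s :
  lie_to_assoc f -> env_lift f (\pi_env s) = env_sum f s.
Proof.
move=> hf; rewrite /env_lift.
have /eqmodP/asboolP h : \pi_env (repr (\pi_env s)) = \pi_env s.
  by rewrite reprK.
exact: h.
Qed.

Lemma env_ext (t t' : env) :
  (forall (B : algType k) (f : L -> B),
     lie_to_assoc f -> env_lift f t = env_lift f t') -> t = t'.
Proof.
move=> h; rewrite -[t]reprK -[t']reprK; apply/eqmodP/asboolP => B f hf.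
exact: h.
Qed.

Definition env0 : env := \pi_env [::].
Definition env1 : env := \pi_env [:: (1, [::])].
Definition env_add (t t' : env) : env := \pi_env (repr t ++ repr t').
Definition env_scale (a : k) (t : env) : env :=
  \pi_env [seq (a * p.1, p.2) | p <- repr t].
Definition env_opp : env -> env := env_scale (-1).
Definition env_mul (t t' : env) : env :=
  \pi_env [seq (p.1 * q.1, p.2 ++ q.2) | p <- repr t, q <- repr t'].

Section LiftOps.
Variables (B : algType k) (f : L -> B) (hf : lie_to_assoc f).

Lemma env_lift0 : env_lift f env0 = 0.
Proof. by rewrite env_liftE // /env_sum big_nil. Qed.

Lemma env_lift1 : env_lift f env1 = 1.
Proof. by rewrite env_liftE // /env_sum big_seq1 big_nil scale1r. Qed.

Lemma env_lift_add t t' :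
  env_lift f (env_add t t') = env_lift f t + env_lift f t'.
Proof. by rewrite env_liftE // /env_sum big_cat. Qed.

Lemma env_lift_scale a t : env_lift f (env_scale a t) = a *: env_lift f t.
Proof.
rewrite env_liftE // /env_lift /env_sum big_map scaler_sumr.
by apply: eq_bigr => p _; rewrite scalerA.
Qed.

Lemma env_lift_opp t : env_lift f (env_opp t) = - env_lift f t.
Proof. by rewrite env_lift_scale scaleN1r. Qed.

Lemma env_lift_mul t t' :
  env_lift f (env_mul t t') = env_lift f t * env_lift f t'.
Proof.
rewrite env_liftE // /env_lift /env_sum big_allpairs_dep mulr_suml.
apply: eq_bigr => p _; rewrite mulr_sumr; apply: eq_bigr => q _ /=.
by rewrite big_cat /= -scalerAl -scalerAr scalerA.
Qed.
End LiftOps.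

Let liftE := (env_lift_add, env_lift_opp, env_lift0, env_lift_scale,
              env_lift1, env_lift_mul).

Lemma env_addA : associative env_add.
Proof. by move=> x y z; apply: env_ext => B f h; rewrite !liftE // addrA. Qed.
Lemma env_addC : commutative env_add.
Proof. by move=> x y; apply: env_ext => B f h; rewrite !liftE // addrC. Qed.
Lemma env_add0 : left_id env0 env_add.
Proof. by move=> x; apply: env_ext => B f h; rewrite !liftE // add0r. Qed.
Lemma env_addN : left_inverse env0 env_opp env_add.
Proof. by move=> x; apply: env_ext => B f h; rewrite !liftE // addNr. Qed.

HB.instance Definition _ :=
  GRing.isZmodule.Build env env_addA env_addC env_add0 env_addN.

Lemma env_mulA : associative env_mul.
Proof. by move=> x y z; apply: env_ext => B f h; rewrite !liftE // mulrA. Qed.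
Lemma env_mul1 : left_id env1 env_mul.
Proof. by move=> x; apply: env_ext => B f h; rewrite !liftE // mul1r. Qed.
Lemma env_1mul : right_id env1 env_mul.
Proof. by move=> x; apply: env_ext => B f h; rewrite !liftE // mulr1. Qed.
Lemma env_mulDl : left_distributive env_mul +%R.
Proof.
by move=> x y z; apply: env_ext => B f h; rewrite !liftE // mulrDl.
Qed.
Lemma env_mulDr : right_distributive env_mul +%R.
Proof.
by move=> x y z; apply: env_ext => B f h; rewrite !liftE // mulrDr.
Qed.
Lemma env_1neq0 : env1 != 0.
Proof.
apply/eqP => h.
have hf : lie_to_assoc (fun _ : L => 0 : k^o).
  by split=> [a x y|x y]; rewrite ?mulr0 ?subr0 // scaler0 addr0.
have := congr1 (env_lift (fun _ : L => 0 : k^o)) h.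
by rewrite env_lift1 // env_lift0 // => /eqP; rewrite oner_eq0.
Qed.

HB.instance Definition _ := GRing.Zmodule_isNzRing.Build env
  env_mulA env_mul1 env_1mul env_mulDl env_mulDr env_1neq0.

Lemma env_scaleA a b t : env_scale a (env_scale b t) = env_scale (a * b) t.
Proof. by apply: env_ext => B f h; rewrite !liftE // scalerA. Qed.
Lemma env_scale1 : left_id 1 env_scale.
Proof. by move=> t; apply: env_ext => B f h; rewrite !liftE // scale1r. Qed.
Lemma env_scaleDr : right_distributive env_scale +%R.
Proof.
by move=> a x y; apply: env_ext => B f h; rewrite !liftE // scalerDr.
Qed.
Lemma env_scaleDl t : {morph env_scale^~ t : a b / a + b}.
Proof.
by move=> a b; apply: env_ext => B f h; rewrite !liftE // scalerDl.
Qed.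

HB.instance Definition _ := GRing.Zmodule_isLmodule.Build k env
  env_scaleA env_scale1 env_scaleDr env_scaleDl.

Lemma env_scaleAl a (x y : env) : a *: (x * y) = (a *: x) * y.
Proof. by apply: env_ext => B f h; rewrite !liftE // scalerAl. Qed.
Lemma env_scaleAr a (x y : env) : a *: (x * y) = x * (a *: y).
Proof. by apply: env_ext => B f h; rewrite !liftE // scalerAr. Qed.

HB.instance Definition _ := GRing.Lmodule_isLalgebra.Build k env env_scaleAl.
HB.instance Definition _ := GRing.Lalgebra_isAlgebra.Build k env env_scaleAr.

End Enveloping.

(* ** The Lie subalgebra of an associative algebra generated by a set *)

Section LieGenerated.
Variables (k : fieldType) (B : algType k) (S : B -> Prop).

Definition lie_hull : {pred B} := fun x => `[< forall P : B -> Prop,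
  (forall y, S y -> P y) -> P 0 ->
  (forall a y z, P y -> P z -> P (a *: y + z)) ->
  (forall y z, P y -> P z -> P (y * z - z * y)) -> P x >].

Record lieGen := LieGen { lieGen_val : B; _ : lieGen_val \in lie_hull }.
HB.instance Definition _ := [isSub for lieGen_val].
HB.instance Definition _ := [Choice of lieGen by <:].

Lemma lie_hull_gen x : S x -> x \in lie_hull.
Proof. by move=> Sx; apply/asboolP => P hS *; apply: hS. Qed.

Lemma lie_hull_submod : submod_closed lie_hull.
Proof.
split=> [|a x y /asboolP hx /asboolP hy]; apply/asboolP => P hS h0 hD hL //.
exact: hD (hx P hS h0 hD hL) (hy P hS h0 hD hL).
Qed.

Lemma lie_hull_comm x y :
  x \in lie_hull -> y \in lie_hull -> x * y - y * x \in lie_hull.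
Proof.
move=> /asboolP hx /asboolP hy; apply/asboolP => P hS h0 hD hL.
exact: hL (hx P hS h0 hD hL) (hy P hS h0 hD hL).
Qed.

HB.instance Definition _ :=
  GRing.isSubmodClosed.Build k B lie_hull lie_hull_submod.
HB.instance Definition _ := [SubChoice_isSubLmodule of lieGen by <:].

Definition lieGen_lie (x y : lieGen) : lieGen :=
  LieGen (lie_hull_comm (valP x) (valP y)).

Lemma lieGen_bilin : bilin lieGen_lie.
Proof.
split=> u a x y; apply: val_inj; rewrite /= mulrDl mulrDr.
  by rewrite -scalerAl -scalerAr scalerBr opprD addrACA.
by rewrite -scalerAl -scalerAr scalerBr opprD addrACA.
Qed.

Lemma lieGen_liexx x : lieGen_lie x x = 0.
Proof. by apply: val_inj; rewrite /= subrr. Qed.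

Lemma lieGen_jacobi x y z :
  lieGen_lie x (lieGen_lie y z) + lieGen_lie y (lieGen_lie z x)
  + lieGen_lie z (lieGen_lie x y) = 0.
Proof.
have E (p q r s : B) : p - q - (r - s) = (p + s) - (q + r).
  by rewrite opprB addrACA opprD.
apply: val_inj; rewrite /= !mulrBl !mulrBr !mulrA !E.
move: (lieGen_val x) (lieGen_val y) (lieGen_val z) => a b c.
rewrite [b * c * a + _]addrC [c * a * b + _]addrC [c * b * a + _]addrC.
by rewrite !subrKA subrr.
Qed.

HB.instance Definition _ := isLieAlgebra.Build k lieGen
  lieGen_bilin lieGen_liexx lieGen_jacobi.

Definition lieGen_of x (Sx : S x) : lieGen := LieGen (lie_hull_gen Sx).

End LieGenerated.

(* ** Post-Lie algebras and the Guin-Oudom construction *)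

Definition post_lie (k : fieldType) (L : lieAlgType k) (tri : L -> L -> L) :
    Prop :=
  let assoc x y z := tri x (tri y z) - tri (tri x y) z in
  [/\ bilin tri,
      forall x y z, tri x (lie y z) = lie (tri x y) z + lie y (tri x z) &
      forall x y z, tri (lie x y) z = assoc x y z - assoc y x z].

Section GuinOudom.
Variables (k : fieldType) (L : lieAlgType k) (tri : L -> L -> L).
(* U is an enveloping algebra of L, with canonical map i. *)
Variables (U : algType k) (i : L -> U).

Definition env_comul_spec (D : U -> tens U U) : Prop :=
  [/\ linear D, D 1 = pure 1 1, forall X Y, D (X * Y) = tens_mul (D X) (D Y) &
      forall x, D (i x) = pure (i x) 1 + pure 1 (i x)].
Definition env_comul : U -> tens U U := the (fun=> 0) env_comul_spec.

Definition env_counit_spec (e : U -> k^o) : Prop :=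
  [/\ linear e, e 1 = 1, forall X Y, e (X * Y) = e X * e Y &
      forall x, e (i x) = 0].
Definition env_counit : U -> k^o := the (fun=> 0) env_counit_spec.

Definition env_tri_spec (T : U -> U -> U) : Prop :=
  [/\ bilin T,
      forall x y, T (i x) (i y) = i (tri x y),
      forall X, T 1 X = X,
      forall x X y, T (i x * X) (i y) =
                    T (i x) (T X (i y)) - T (T (i x) X) (i y) &
      forall X Y Z, T X (Y * Z) =
                    tens_lift (fun X1 X2 => T X1 Y * T X2 Z) (env_comul X)].
Definition env_tri : U -> U -> U := the (fun _ _ => 0) env_tri_spec.

Definition grossman_larson (X Y : U) : U :=
  tens_lift (fun X1 X2 => X1 * env_tri X2 Y) (env_comul X).

Definition GL_hopf : hopfData k :=
  HopfData grossman_larson 1 env_comul env_counit.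

(* The grading of U induced by a grading of L. *)
Inductive env_homog (homog : nat -> L -> Prop) : nat -> U -> Prop :=
| EnvHomog1 : env_homog homog 0 1
| EnvHomogM n m x X : homog n x -> env_homog homog m X ->
    env_homog homog (n + m) (i x * X)
| EnvHomog0 n : env_homog homog n 0
| EnvHomogD n a X Y : env_homog homog n X -> env_homog homog n Y ->
    env_homog homog n (a *: X + Y).

End GuinOudom.

(* ** Graded duals
   The graded dual of H = \bigoplus_n H_n with finite-dimensional components
   consists of the linear forms vanishing on all but finitely many H_n. *)

Section GradedDual.
Variables (k : fieldType) (H : hopfData k) (homog : nat -> H -> Prop).

Definition gdual_pred : {pred H -> k^o} := fun phi => `[<
  linear phi /\
  exists N : nat, forall n X, (N <= n)%N -> homog n X -> phi X = 0 >].

Record gdual := Gdual { gdual_val : H -> k^o; _ : gdual_val \in gdual_pred }.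
HB.instance Definition _ := [isSub for gdual_val].
HB.instance Definition _ := [Choice of gdual by <:].

Lemma gdual_submod : submod_closed gdual_pred.
Proof.
split=> [|a f g /asboolP[lf [N hN]] /asboolP[lg [M hM]]]; apply/asboolP.
  split=> [b x y|]; first by rewrite scaler0 addr0.
  by exists 0%N.
split=> [b x y|].
  by rewrite /= !fctE lf lg /= !scalerDr !scalerA [a * b]mulrC addrACA.
exists (maxn N M) => n X; rewrite geq_max => /andP[Nn Mn] hX.
by rewrite !fctE (hN n) // (hM n) // scaler0 addr0.
Qed.

HB.instance Definition _ :=
  GRing.isSubmodClosed.Build k (H -> k^o) gdual_pred gdual_submod.
HB.instance Definition _ := [SubChoice_isSubLmodule of gdual by <:].

Definition gdual_eval (phi : gdual) : H -> k := val phi.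

(* For a graded Hopf algebra the two forms below do lie in the graded dual. *)
Definition gdual_mul (phi psi : gdual) : gdual :=
  insubd 0 (fun X => tens_lift
    (fun X1 X2 => gdual_eval phi X1 * gdual_eval psi X2 : k^o) (hcomul X)).
Definition gdual_one : gdual := insubd 0 (@hcounit k H : H -> k^o).

Definition gdual_comul_spec (phi : gdual) (t : tens gdual gdual) : Prop :=
  forall X Y : H,
    tens_lift (fun p q => gdual_eval p X * gdual_eval q Y : k^o) t =
    gdual_eval phi (hmul X Y).
Definition gdual_comul (phi : gdual) : tens gdual gdual :=
  the 0 (gdual_comul_spec phi).

Definition gdual_hopf : hopfData k :=
  HopfData gdual_mul gdual_one gdual_comul (fun phi => gdual_eval phi (hone H)).

End GradedDual.

(* ** Free associative algebras *)

Section FreeAlgebra.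
Variables (k : fieldType) (I : choiceType).

Definition freeAlg := {malg k[{fmonom I}]}.
HB.instance Definition _ := GRing.Lalgebra.on freeAlg.

Definition word (w : seq I) : freeAlg := << FMonom w >>.

Definition free_ext (V : lmodType k) (f : seq I -> V) (x : freeAlg) : V :=
  \sum_(w <- msupp x) x@_w *: f w.

Definition free_bilin_ext (V : lmodType k) (f : seq I -> seq I -> V)
    (x y : freeAlg) : V :=
  free_ext (fun u => free_ext (f u) y) x.

Lemma freeAlg_scaleAr a (x y : freeAlg) : a *: (x * y) = x * (a *: y).
Proof.
apply/malgP => w.
rewrite mcoeffZ (mcoeffMlw w (fsubset_refl _) (msuppZ_le a y)) mcoeffMl.
rewrite mulr_sumr; apply: eq_bigr => u _; rewrite mulr_sumr.
by apply: eq_bigr => v _; rewrite mcoeffZ mulrnAr mulrCA.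
Qed.
HB.instance Definition _ :=
  GRing.Lalgebra_isAlgebra.Build k freeAlg freeAlg_scaleAr.

End FreeAlgebra.

(* ** Words and the algebra H_PLOT *)

Section Words.
Variables (k : fieldType) (A : finType).

(* The pair (a, n) stands for the letter z_{n-1}^a. *)
Definition letter : choiceType := (A * nat)%type.

Definition wt (w : seq letter) : int := \sum_(z <- w) (z.2%:Z - 1).

(* The m-th power of the derivation, on letters. *)
Definition shift (m : nat) (z : letter) : letter := (z.1, (z.2 + m)%N).

Definition in_V (w : seq letter) : bool :=
  (wt w == - 1) &&
  all (fun q => 0 <= wt (take q w)) (iota 1 (size w).-1).

Definition V_span (x : freeAlg k letter) : Prop :=
  {in msupp x, forall w : {fmonom letter}, in_V w}.

(* The elements of V_span have weight at most 0 and so does the Lie algebra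
   which they generate. *)
Definition gPLOT := lieGen V_span.

Definition tri_word (x y : seq letter) : freeAlg k letter :=
  \sum_(j < size y)
    word k (take j y ++ shift `|wt x| (tnth (in_tuple y) j) :: x
            ++ drop j.+1 y).

(* gPLOT is stable under the product of words. *)
Definition gPLOT_tri (x y : gPLOT) : gPLOT :=
  insubd 0 (free_bilin_ext tri_word (val x) (val y)).

Definition gPLOT_homog (n : nat) (x : gPLOT) : Prop :=
  {in msupp (val x), forall w : {fmonom letter}, size w = n}.

Definition UgPLOT : hopfData k := GL_hopf gPLOT_tri (@env_inj k gPLOT).

Definition H_PLOT : hopfData k :=
  @gdual_hopf k UgPLOT (env_homog (@env_inj k gPLOT) gPLOT_homog).

End Words.

(* ** Planar rooted trees *)

Inductive tree (A : Type) := Node of A & seq (tree A).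

Section TreeChoice.
Variable A : Type.

Fixpoint tree_encode (t : tree A) : GenTree.tree A :=
  let: Node a ts := t in
  GenTree.Node 0 (GenTree.Leaf a :: map tree_encode ts).

Fixpoint tree_decode (t : GenTree.tree A) : option (tree A) :=
  if t is GenTree.Node _ (GenTree.Leaf a :: us)
  then Some (Node a (pmap tree_decode us)) else None.

Lemma tree_encodeK : pcancel tree_encode tree_decode.
Proof.
rewrite /pcancel; fix IH 1 => -[a ts] /=; congr (Some (Node a _)).
by elim: ts => //= t ts IHs; rewrite IH /= IHs.
Qed.
End TreeChoice.

HB.instance Definition _ (A : choiceType) :=
  Choice.copy (tree A) (pcan_type (@tree_encodeK A)).

Section Trees.
Variable A : choiceType.
Implicit Types (t s : tree A) (f : seq (tree A)).

Definition dec t : A := let: Node a _ := t in a.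
Definition children t : seq (tree A) := let: Node _ ts := t in ts.

(* A vertex is the list of the positions of its ancestors among their siblings,
   from the root (excluded) down to the vertex itself.  They are listed in the
   root-subtree order. *)
Fixpoint vertices t : seq (seq nat) :=
  let: Node _ ts := t in
  [::] :: (fix go j ts := if ts is u :: us
           then map (cons j) (vertices u) ++ go j.+1 us else [::]) 0%N ts.

Fixpoint subtree t (v : seq nat) : tree A :=
  if v is j :: v' then subtree (nth t (children t) j) v' else t.

(* Attach the root of s to the vertex v of t as its leftmost child. *)
Fixpoint attach s t (v : seq nat) : tree A :=
  let: Node a ts := t in
  if v is j :: v'
  then Node a (set_nth s ts j (attach s (nth t ts j) v'))
  else Node a (s :: ts).

(* An edge is represented by its lower vertex. *)
Definition edges t : seq (seq nat) := behead (vertices t).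
Definition leaves t : seq (seq nat) :=
  [seq v <- vertices t | nilp (children (subtree t v))].

Definition left_admissible t (c : {fset seq nat}) : bool :=
  all (fun l => count (fun e => e \in c) [seq take n l | n <- iota 1 (size l)]
                <= 1)%N (leaves t)
  && all (fun v => all (fun j => (rcons v j \in c) ==>
                          all (fun j' => rcons v j' \in c) (iota 0 j))
                     (iota 0 (size (children (subtree t v)))))
       (vertices t).

Definition left_cuts t : seq {fset seq nat} :=
  [seq c <- fpowerset [fset e in edges t]%fset | left_admissible t c].

(* The component of the root; p is the vertex at which t sits. *)
Fixpoint trunk (c : {fset seq nat}) (p : seq nat) t : tree A :=
  let: Node a ts := t in
  Node a ((fix go j ts := if ts is u :: us then
             if rcons p j \in c then go j.+1 us
             else trunk c (rcons p j) u :: go j.+1 us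
           else [::]) 0%N ts).

Definition pruned_at t (c : {fset seq nat}) (v : seq nat) : seq (tree A) :=
  let ts := children (subtree t v) in
  [seq nth t ts j | j <- iota 0 (size ts) & rcons v j \in c].

Definition fer_word t : seq (A * nat) :=
  [seq (dec (subtree t v), size (children (subtree t v))) | v <- vertices t].

End Trees.

(* ** Forests, H_MKW and the fertility map *)

Section Forests.
Variables (k : fieldType) (A : finType).

Let OF := freeAlg k (tree A).
Let forest (f : seq (tree A)) : OF := word k f.

Definition is_tree (x : OF) : Prop := exists t, x = forest [:: t].
Definition PSL := lieGen is_tree.

Definition PSL_tree (t : tree A) : PSL :=
  lieGen_of (ex_intro _ t erefl : is_tree (forest [:: t])).

Definition graft (s t : tree A) : PSL :=
  \sum_(v <- vertices t) PSL_tree (attach s t v).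

Definition PSL_tri : PSL -> PSL -> PSL :=
  the (fun _ _ => 0) (fun tri =>
    post_lie tri /\ forall s t, tri (PSL_tree s) (PSL_tree t) = graft s t).

Definition UPSL : hopfData k := GL_hopf PSL_tri (val : PSL -> OF).

Fixpoint shuffles (T : Type) (u : seq T) : seq T -> seq (seq T) :=
  if u is x :: u' then
    fix shuffles_u v := if v is y :: v'
      then map (cons x) (shuffles u' v) ++ map (cons y) (shuffles_u v')
      else [:: u]
  else fun v => [:: v].

Definition shuffle : OF -> OF -> OF :=
  free_bilin_ext (fun f g => \sum_(h <- shuffles f g) forest h).

Definition MKW_tree (t : tree A) : tens OF OF :=
  pure (forest [:: t]) 1 +
  \sum_(c <- left_cuts t)
    pure (\big[shuffle/1]_(v <- vertices t) forest (pruned_at t c v))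
         (forest [:: trunk c [::] t]).

Definition Bminus : OF -> OF :=
  free_ext (fun f => if f is [:: Node _ ts] then forest ts else 0).

(* The formula for forests does not depend on the decoration of the added root;
   the one of the first tree is taken. *)
Definition MKW_forest (f : seq (tree A)) : tens OF OF :=
  match f with
  | [::] => pure 1 1
  | [:: t] => MKW_tree t
  | Node a _ :: _ =>
      tens_map id Bminus (MKW_tree (Node a f) - pure (forest [:: Node a f]) 1)
  end.

Definition H_MKW : hopfData k :=
  @HopfData k OF shuffle 1 (free_ext MKW_forest) (mcoeff (FMonom [::])).

(* The pairing of H_MKW with U(PSL) for which forests are dual to forests. *)
Definition forest_pairing (x : H_MKW) (y : UPSL) : k :=
  \sum_(f <- msupp (x : OF)) (x : OF)@_f * (y : OF)@_f.

(* A word of V_span, as an element of the Lie algebra. *)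
Definition fer_tree (t : tree A) : gPLOT k A :=
  insubd 0 (word k (fer_word t)).

Definition fer_lie : PSL -> gPLOT k A :=
  the (fun=> 0) (fun phi =>
    lie_morphism phi /\ forall t, phi (PSL_tree t) = fer_tree t).

Definition fer : UPSL -> UgPLOT k A :=
  the (fun=> 0) (fun Phi : OF -> env (gPLOT k A) =>
    [/\ linear Phi, Phi 1 = 1, forall X Y, Phi (X * Y) = Phi X * Phi Y &
        forall x : PSL, Phi (val x) = env_inj (fer_lie x)]).

End Forests.

(* Main.v *)
(* The map t |-> fer_word t is the Lukasiewicz code of planar trees: the words of
   V(A) are exactly the codes of trees, and they form a prefix code.  Hence the
   algebra morphism fertW from forests to words which it induces is injective, and
   it restricts to a Lie isomorphism from PSL(A) onto g(A); on enveloping algebras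
   it gives an algebra isomorphism ferU from k OF onto U(g(A)).

   On forests the Guin-Oudom product is explicit: f > t is the sum over the ways
   to distribute the trees of f over the vertices of t, which is governed by the
   recursion f > B_a(g) = B_a(f * g), where f * g = sum f_1 (f_2 > g) for the
   deshuffle coproduct.  The identity f > (g > h) = (f * g) > h follows by
   induction and shows that grafting is a post-Lie product on PSL(A).  For x in
   PSL(A) only the terms which keep the trees of a word of x together survive,
   x being primitive; on codes they are the words of x >_w y, so that the
   isomorphism respects the post-Lie products and all of the Hopf structure.

   Finally the left admissible cuts of B_a(g) are a cut of the first m children
   of the root together with independent cuts of the others.  This recursion is
   dual to the one of grafting, so that the MKW coproduct is dual to the
   Grossman-Larson product, and the shuffle product to the deshuffle coproduct. *)

(* Most structure maps are defined as [the] solution of their axioms, so statements about them have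
   content only after a solution has been exhibited and, as a rule, shown to be unique. On forests
   existence comes from explicit formulas, and uniqueness from inductions on bracket length and on
   the number of trees. On U(g(A)) nothing is built from scratch: stability of g(A) under the
   product of words, the coproduct and the extended product are carried over from forests, and a
   competing solution is carried back to be compared there. The inverse isomorphism comes from the
   universal property of [env], without a basis of U(g(A)). Multisets of forests are compared by
   summing an arbitrary function over lists; one such identity then serves for linear maps, for
   tensors and for counting coefficients. Finiteness of A enters with the graded dual: only finitely
   many forests have a given number of vertices, which is the length of their code, so a form in the
   graded dual has finitely many nonzero coordinates on forests and is given by an element of the
   forest algebra. *)
Require Import Defs.
From HB Require Import structures.
From mathcomp Require Import all_boot all_algebra finmap.
From mathcomp Require Import boolp functions.
From mathcomp Require Import zify.
From mathcomp.multinomials Require Import monalg.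

Set Implicit Arguments.
Unset Strict Implicit.
Unset Printing Implicit Defensive.

Import GRing.Theory.
Local Open Scope ring_scope.
Local Open Scope quotient_scope.

(** * Linear extensions, tensor products and enveloping algebras *)

Section LinearMaps.
Variables (k : fieldType) (U V W : lmodType k).

Lemma lin0 (f : U -> V) : linear f -> f 0 = 0.
Proof. by move=> lf; have := lf (-1) 0 0; rewrite scaler0 addr0 scaleN1r addNr. Qed.

Lemma linD (f : U -> V) : linear f -> {morph f : x y / x + y}.
Proof. by move=> lf x y; have := lf 1 x y; rewrite !scale1r. Qed.

Lemma linZ (f : U -> V) : linear f -> forall a, {morph f : x / a *: x}.
Proof. by move=> lf a x; have := lf a x 0; rewrite (lin0 lf) !addr0. Qed.

Lemma linN (f : U -> V) : linear f -> {morph f : x / - x}.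
Proof. by move=> lf x; rewrite -scaleN1r linZ // scaleN1r. Qed.

Lemma linB (f : U -> V) : linear f -> {morph f : x y / x - y}.
Proof. by move=> lf x y; rewrite linD // linN. Qed.

Lemma lin_sum (f : U -> V) : linear f ->
  forall (J : Type) (r : seq J) (P : pred J) (F : J -> U),
  f (\sum_(i <- r | P i) F i) = \sum_(i <- r | P i) f (F i).
Proof. by move=> lf J r P F; exact: (big_morph f (linD lf) (lin0 lf)). Qed.

Lemma lin_comp (g : V -> W) (f : U -> V) :
  linear g -> linear f -> linear (fun x => g (f x)).
Proof. by move=> lg lf a x y; rewrite lf lg. Qed.

Lemma sum_lin (J : Type) (r : seq J) (F : J -> U -> V) :
  (forall j, linear (F j)) -> linear (fun x => \sum_(j <- r) F j x).
Proof.
move=> lF a x y; rewrite scaler_sumr -big_split /=.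
by apply: eq_bigr => j _; rewrite lF.
Qed.

Lemma scale_lin (f : U -> k^o) (v : V) : linear f -> linear (fun x => f x *: v).
Proof. by move=> lf a x y; rewrite lf scalerDl -scalerA. Qed.

End LinearMaps.

Lemma id_lin (k : fieldType) (U : lmodType k) : linear (fun x : U => x).
Proof. by []. Qed.

Lemma mull_lin (k : fieldType) (B : algType k) (b : B) : linear (fun x => b * x).
Proof. by move=> a x y; rewrite mulrDr scalerAr. Qed.

Lemma mulr_lin (k : fieldType) (B : algType k) (b : B) : linear (fun x => x * b).
Proof. by move=> a x y; rewrite mulrDl scalerAl. Qed.

Section FreeAlgebra.
Variables (k : fieldType) (I : choiceType).
Local Notation FA := (freeAlg k I).
Implicit Types (x y : FA) (u v w : seq I).

Lemma word_nil : word k [::] = 1 :> FA.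
Proof.
apply/malgP => m; rewrite mcoeffU mcoeff1 /mone /= fmoneE /=.
by rewrite eq_sym; case: (m == _).
Qed.

Lemma word_cat u v : word k (u ++ v) = word k u * word k v :> FA.
Proof.
have -> : word k u * word k v = << 1 * 1 *g mmul (FMonom u) (FMonom v) >> :> FA.
  exact: fgmulUU.
rewrite mulr1; congr << _ *g _ >>.
by rewrite /mmul /= fmmulE.
Qed.

Lemma word_cons i w : word k (i :: w) = word k [:: i] * word k w :> FA.
Proof. by rewrite -word_cat. Qed.

Lemma coeff_word u v : (word k u : FA)@_(FMonom v) = (u == v)%:R.
Proof. by rewrite mcoeffU fmP /=; case: (u == v). Qed.

Lemma freeAlgE x : x = \sum_(w <- msupp x) x@_w *: word k w.
Proof.
rewrite {1}(monalgE x); apply: eq_bigr => -[w] _.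
by apply/malgP => m; rewrite mcoeffZ !mcoeffU /= mulrnAr mulr1.
Qed.

Lemma freeAlg_ind (P : FA -> Prop) :
  P 0 -> (forall a x y, P x -> P y -> P (a *: x + y)) ->
  (forall w, P (word k w)) -> forall x, P x.
Proof.
move=> P0 PD Pw x; rewrite (freeAlgE x).
elim: (enum_fset (msupp x)) => [|w s IH]; first by rewrite big_nil.
by rewrite big_cons; apply: PD.
Qed.

Lemma coeff_lin w : linear (fun x => x@_(FMonom w) : k^o).
Proof. by move=> a x y; rewrite mcoeffD mcoeffZ. Qed.

Lemma freeAlg_eq x y :
  (forall w, x@_(FMonom w) = y@_(FMonom w)) -> x = y.
Proof. by move=> h; apply/malgP => -[w]. Qed.

Variable V : lmodType k.
Implicit Types f g : seq I -> V.

(** A common finite support makes the extensions at several elements comparable term by term. *)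
Lemma free_extEw f (d : {fset {fmonom I}}) x : (msupp x `<=` d)%fset ->
  free_ext f x = \sum_(w <- d) x@_w *: f w.
Proof.
move=> le; rewrite /free_ext (big_fset_incl _ le) //= => w _ /mcoeff_outdom ->.
by rewrite scale0r.
Qed.

Lemma free_ext_lin f : linear (free_ext f : FA -> V).
Proof.
move=> a x y; pose d := (msupp x `|` msupp y `|` msupp (a *: x + y))%fset.
have lx : (msupp x `<=` d)%fset by rewrite /d -fsetUA fsubsetUl.
have ly : (msupp y `<=` d)%fset.
  by rewrite /d [(msupp x `|` _)%fset]fsetUC -fsetUA fsubsetUl.
have lz : (msupp (a *: x + y) `<=` d)%fset by rewrite fsubsetUr.
rewrite (free_extEw f lx) (free_extEw f ly) (free_extEw f lz) scaler_sumr.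
rewrite -big_split /=; apply: eq_bigr => w _.
by rewrite mcoeffD mcoeffZ scalerDl scalerA.
Qed.

Lemma free_ext_word f w : free_ext f (word k w) = f w.
Proof.
by rewrite /free_ext msuppU1 big_seq_fset1 /= mcoeffU eqxx scale1r.
Qed.

Lemma eq_free_ext f g : f =1 g -> free_ext f =1 free_ext g :> (FA -> V).
Proof. by move=> e x; apply: eq_bigr => w _; rewrite e. Qed.

Lemma free_lin_ext (F G : FA -> V) : linear F -> linear G ->
  (forall w, F (word k w) = G (word k w)) -> F =1 G.
Proof.
move=> lF lG e; apply: freeAlg_ind => [|a x y ex ey|//].
  by rewrite !lin0.
by rewrite lF lG ex ey.
Qed.

Lemma free_extE (F : FA -> V) x : linear F ->
  F x = free_ext (fun w => F (word k w)) x.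
Proof.
move=> lF; apply: free_lin_ext x => // [|w]; first exact: free_ext_lin.
by rewrite free_ext_word.
Qed.

Lemma free_ext_lin2 (U : lmodType k) (f : seq I -> U -> V) x :
  (forall w, linear (f w)) -> linear (fun z : U => free_ext (f^~ z) x).
Proof.
move=> lf a u v; rewrite /free_ext scaler_sumr -big_split /=.
apply: eq_bigr => w _; rewrite lf scalerDr !scalerA; congr (_ + _).
by rewrite mulrC.
Qed.

Lemma free_bilin_ext_bilin (f : seq I -> seq I -> V) :
  bilin (free_bilin_ext f : FA -> FA -> V).
Proof.
split=> [y|x]; first exact: free_ext_lin.
by apply: free_ext_lin2 => w; exact: free_ext_lin.
Qed.

Lemma free_bilin_ext_word (f : seq I -> seq I -> V) u v :
  free_bilin_ext f (word k u : FA) (word k v : FA) = f u v.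
Proof. by rewrite /free_bilin_ext !free_ext_word. Qed.

Lemma free_bilin_eq (F G : FA -> FA -> V) : bilin F -> bilin G ->
  (forall u v, F (word k u) (word k v) = G (word k u) (word k v)) ->
  forall x y, F x y = G x y.
Proof.
move=> [lF1 lF2] [lG1 lG2] e x y.
apply: (@free_lin_ext (F^~ y) (G^~ y)) => // u.
exact: (@free_lin_ext (F (word k u)) (G (word k u))).
Qed.

End FreeAlgebra.

Section AlgExtension.
Variables (k : fieldType) (I : choiceType) (B : algType k) (f : I -> B).
Local Notation FA := (freeAlg k I).

Definition alg_ext : FA -> B := free_ext (fun w => \prod_(i <- w) f i).

Lemma alg_ext_lin : linear alg_ext. Proof. exact: free_ext_lin. Qed.

Lemma alg_ext_word w : alg_ext (word k w) = \prod_(i <- w) f i.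
Proof. exact: free_ext_word. Qed.

Lemma alg_ext1 : alg_ext 1 = 1.
Proof. by rewrite -word_nil alg_ext_word big_nil. Qed.

Lemma alg_ext_letter i : alg_ext (word k [:: i]) = f i.
Proof. by rewrite alg_ext_word big_seq1. Qed.

Lemma alg_extM : {morph alg_ext : x y / x * y}.
Proof.
apply: free_bilin_eq.
- by split=> u; apply: lin_comp;
    [exact: alg_ext_lin|exact: mulr_lin|exact: alg_ext_lin|exact: mull_lin].
- split=> u.
    apply: (@lin_comp _ _ _ _ (fun z : B => z * alg_ext u));
      [exact: mulr_lin|exact: alg_ext_lin].
  by apply: lin_comp; [exact: mull_lin|exact: alg_ext_lin].
- by move=> u v; rewrite -word_cat !alg_ext_word big_cat.
Qed.

End AlgExtension.

Section TensorTheory.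
Variables (k : fieldType) (U V : lmodType k).
Implicit Types (t : tens U V) (W : lmodType k).

Section Lift.
Variables (W : lmodType k) (B : U -> V -> W) (hB : bilin B).

Lemma tens_lift_lin : linear (tens_lift B).
Proof.
move=> a s t; rewrite -[a *: s + t]/(tens_add (tens_scale a s) t).
by rewrite tens_lift_add // tens_lift_scale.
Qed.

Lemma tens_lift_pure u v : tens_lift B (pure u v) = B u v.
Proof. by rewrite /pure tens_liftE // /tens_sum big_seq1. Qed.

End Lift.

Lemma pure_bilin : bilin (@pure k U V).
Proof.
split=> [v|u] a x y; apply: tens_ext => W B hB.
  by rewrite (tens_lift_lin hB) !tens_lift_pure // hB.1.
by rewrite (tens_lift_lin hB) !tens_lift_pure // hB.2.
Qed.

Lemma pure_linl (v : V) : linear (fun u : U => pure u v).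
Proof. exact: pure_bilin.1. Qed.

Lemma pure_linr (u : U) : linear (fun v : V => pure u v).
Proof. exact: pure_bilin.2. Qed.

Lemma tens_sum_pure t : t = \sum_(p <- repr t) pure p.1 p.2.
Proof.
apply: tens_ext => W B hB; rewrite (lin_sum (tens_lift_lin hB)) /tens_lift.
by apply: eq_bigr => p _; rewrite -/(tens_lift B _) tens_lift_pure.
Qed.

Lemma tens_ind (P : tens U V -> Prop) :
  P 0 -> (forall s t, P s -> P t -> P (s + t)) ->
  (forall u v, P (pure u v)) -> forall t, P t.
Proof.
move=> P0 PD Pp t; rewrite (tens_sum_pure t).
by elim: (repr t) => [|p s IH]; rewrite ?big_nil // big_cons; apply: PD.
Qed.

Lemma tens_lin_ext W (F G : tens U V -> W) : linear F -> linear G ->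
  (forall u v, F (pure u v) = G (pure u v)) -> F =1 G.
Proof.
move=> lF lG e; apply: tens_ind => [|s t es et|//]; first by rewrite !lin0.
by rewrite !linD // es et.
Qed.

Lemma eq_tens_lift W (B B' : U -> V -> W) t :
  (forall u v, B u v = B' u v) -> tens_lift B t = tens_lift B' t.
Proof. by move=> e; rewrite /tens_lift /tens_sum; apply: eq_bigr. Qed.

Lemma lin_tens_lift W W' (g : W -> W') (B : U -> V -> W) t : linear g ->
  g (tens_lift B t) = tens_lift (fun u v => g (B u v)) t.
Proof. by move=> lg; rewrite /tens_lift /tens_sum (lin_sum lg). Qed.

Lemma tens_lift_lin2 W W' (B : U -> V -> W -> W') t :
  (forall u v, linear (B u v)) -> linear (fun w => tens_lift (fun u v => B u v w) t).
Proof. by move=> lB; rewrite /tens_lift /tens_sum; apply: sum_lin. Qed.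

End TensorTheory.

Lemma bilin_comp (k : fieldType) (U V U' V' W : lmodType k)
    (B : U' -> V' -> W) (f : U -> U') (g : V -> V') :
  bilin B -> linear f -> linear g -> bilin (fun u v => B (f u) (g v)).
Proof.
by move=> [l1 l2] lf lg; split=> z a x y; rewrite ?lf ?lg ?l1 ?l2.
Qed.

Lemma mul_bilin (k : fieldType) (B : algType k) : bilin (fun x y : B => x * y).
Proof. by split=> z; [exact: mulr_lin|exact: mull_lin]. Qed.

Lemma lin_bilin (k : fieldType) (U V W W' : lmodType k) (g : W -> W')
    (B : U -> V -> W) : linear g -> bilin B -> bilin (fun u v => g (B u v)).
Proof. by move=> lg [l1 l2]; split=> z a x y; rewrite ?l1 ?l2 lg. Qed.

Section TensorMap.
Variables (k : fieldType) (U V U' V' : lmodType k) (f : U -> U') (g : V -> V').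
Hypotheses (lf : linear f) (lg : linear g).

Lemma tens_map_bilin : bilin (fun u v => pure (f u) (g v)).
Proof. exact: bilin_comp (pure_bilin _ _) lf lg. Qed.

Lemma tens_map_lin : linear (tens_map f g).
Proof. exact: tens_lift_lin tens_map_bilin. Qed.

Lemma tens_map_pure u v : tens_map f g (pure u v) = pure (f u) (g v).
Proof. exact: tens_lift_pure tens_map_bilin _ _. Qed.

Lemma tens_lift_map (W : lmodType k) (B : U' -> V' -> W) t : bilin B ->
  tens_lift B (tens_map f g t) = tens_lift (fun u v => B (f u) (g v)) t.
Proof.
move=> hB; have hB' := bilin_comp hB lf lg.
move: t; apply: tens_lin_ext.
- exact: lin_comp (tens_lift_lin hB) tens_map_lin.
- exact: tens_lift_lin.
- by move=> u v; rewrite tens_map_pure !tens_lift_pure.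
Qed.

End TensorMap.

Section TensorMul.
Variables (k : fieldType) (U : algType k).

Let mul_in (a b : U) : bilin (fun c d => pure (a * c) (b * d)).
Proof. exact: bilin_comp (pure_bilin _ _) (mull_lin _) (mull_lin _). Qed.

Let mul_out (t : tens U U) :
  bilin (fun a b => tens_lift (fun c d => pure (a * c) (b * d)) t).
Proof.
split=> z; apply: tens_lift_lin2 => c d.
  exact: lin_comp (pure_linl _) (mulr_lin _).
exact: lin_comp (pure_linr _) (mulr_lin _).
Qed.

Lemma tens_mul_bilin : bilin (@tens_mul k U).
Proof.
split=> [t|s]; first exact: tens_lift_lin (mul_out t).
by apply: tens_lift_lin2 => a b; exact: tens_lift_lin.
Qed.

Lemma tens_mul_pure a b c d :
  tens_mul (pure a b) (pure c d : tens U U) = pure (a * c) (b * d).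
Proof. by rewrite /tens_mul (tens_lift_pure (mul_out _)) tens_lift_pure. Qed.

End TensorMul.

Section LieGenerated.
Variables (k : fieldType) (B : algType k) (S : B -> Prop).

Lemma lieGen_val_lin : linear (val : lieGen S -> B).
Proof. by []. Qed.

(** The hull quantifies over predicates on [B], while [P] lives on the subtype; the membership proof
    is therefore bound existentially in the predicate, and proof irrelevance identifies all choices
    of it. *)
Lemma lieGen_ind (P : lieGen S -> Prop) :
  (forall b (Sb : S b), P (lieGen_of Sb)) -> P 0 ->
  (forall a x y, P x -> P y -> P (a *: x + y)) ->
  (forall x y, P x -> P y -> P (lie x y)) -> forall x, P x.
Proof.
move=> PS P0 PD PL [b hb]; have /asboolP h := hb.
have [||a y z [hy Py] [hz Pz]|y z [hy Py] [hz Pz]|hb' Pb] :=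
    h (fun b => exists hb : b \in lie_hull S, P (LieGen hb)).
- by move=> y Sy; exists (lie_hull_gen Sy); exact: PS.
- by exists (valP (0 : lieGen S)); move: P0; congr P; exact: val_inj.
- exists (valP (a *: LieGen hy + LieGen hz)).
  by move: (PD a _ _ Py Pz); congr P; exact: val_inj.
- exists (valP (lie (LieGen hy) (LieGen hz))).
  by move: (PL _ _ Py Pz); congr P; exact: val_inj.
- by rewrite (bool_irrelevance hb hb').
Qed.

End LieGenerated.

Section EnvelopingTheory.
Variables (k : fieldType) (L : lieAlgType k).
Local Notation env := (env L).

Section Lift.
Variables (B : algType k) (f : L -> B) (hf : lie_to_assoc f).

Lemma env_lift_linear : linear (env_lift f).
Proof.
move=> a s t; rewrite -[a *: s + t]/(env_add (env_scale a s) t).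
by rewrite env_lift_add // env_lift_scale.
Qed.

Lemma env_lift_inj x : env_lift f (env_inj x) = f x.
Proof. by rewrite /env_inj env_liftE // /env_sum big_seq1 big_seq1 scale1r. Qed.

Lemma env_liftM : {morph env_lift f : x y / x * y}.
Proof. by move=> x y; rewrite -env_lift_mul. Qed.

Lemma env_lift_one : env_lift f 1 = 1.
Proof. exact: env_lift1. Qed.

End Lift.

Lemma env_inj_lie : lie_to_assoc (@env_inj k L).
Proof.
split=> [a x y|x y]; apply: env_ext => B f hf.
  by rewrite (env_lift_linear hf) !(env_lift_inj hf) hf.1.
rewrite (linB (env_lift_linear hf)) !(env_liftM hf) !(env_lift_inj hf).
exact: hf.2.
Qed.

(** A class is the value of its representative at the canonical map, so products of elements of L
    span the enveloping algebra; this gives the induction principle [env_elim]. *)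
Lemma env_sum_inj (t : env) : t = env_sum (@env_inj k L) (repr t).
Proof.
apply: env_ext => B f hf; rewrite /env_sum (lin_sum (env_lift_linear hf)).
rewrite {1}/env_lift; apply: eq_bigr => p _.
rewrite (linZ (env_lift_linear hf)) (big_morph _ (env_liftM hf) (env_lift_one hf)).
by congr (_ *: _); apply: eq_bigr => x _; rewrite env_lift_inj.
Qed.

Lemma env_elim (P : env -> Prop) :
  P 1 -> (forall x X, P X -> P (env_inj x * X)) -> P 0 ->
  (forall a X Y, P X -> P Y -> P (a *: X + Y)) -> forall X, P X.
Proof.
move=> P1 PM P0 PD X; rewrite (env_sum_inj X) /env_sum.
elim: (repr X) => [|[c w] s IH]; rewrite ?big_nil // big_cons; apply: PD => //=.
by elim: w => [|x w IHw]; rewrite ?big_nil // big_cons; apply: PM.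
Qed.

End EnvelopingTheory.

(** * Grafting of forests *)

Section Splits.
Variables (T : Type) (V : nmodType).
Implicit Types (s u v : seq T) (F G : seq T -> seq T -> V).

(** Pairs of complementary subsequences, one for each set of positions: the deshuffle coproduct of a
    word in primitive letters. *)
Fixpoint splits s : seq (seq T * seq T) :=
  if s is x :: s' then
    [seq (x :: p.1, p.2) | p <- splits s'] ++ [seq (p.1, x :: p.2) | p <- splits s']
  else [:: ([::], [::])].

(** Sweedler notation for the deshuffle coproduct. The lemmas below are its cocommutativity,
    coassociativity, multiplicativity and counit laws. *)
Definition ssum s F : V := \sum_(p <- splits s) F p.1 p.2.

Lemma eq_ssum s F G : (forall a b, F a b = G a b) -> ssum s F = ssum s G.
Proof. by move=> e; apply: eq_bigr. Qed.

Lemma ssum_nil F : ssum [::] F = F [::] [::].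
Proof. by rewrite /ssum big_seq1. Qed.

Lemma ssum_cons x s F :
  ssum (x :: s) F = ssum s (fun a b => F (x :: a) b) + ssum s (fun a b => F a (x :: b)).
Proof. by rewrite /ssum big_cat !big_map. Qed.

Lemma ssum0 s : ssum s (fun _ _ => 0) = 0.
Proof. exact: big1. Qed.

Lemma ssumD s F G : ssum s (fun a b => F a b + G a b) = ssum s F + ssum s G.
Proof. exact: big_split. Qed.

Lemma ssum_exch (J : Type) (r : seq J) s (F : J -> seq T -> seq T -> V) :
  ssum s (fun a b => \sum_(i <- r) F i a b) = \sum_(i <- r) ssum s (F i).
Proof. exact: exchange_big. Qed.

Lemma ssumC s F : ssum s F = ssum s (fun a b => F b a).
Proof.
elim: s F => [|x s IH] F; first by rewrite !ssum_nil.
by rewrite !ssum_cons addrC; congr (_ + _); exact: IH.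
Qed.

Lemma ssumA s (F : seq T -> seq T -> seq T -> V) :
  ssum s (fun a b => ssum a (fun a1 a2 => F a1 a2 b)) =
  ssum s (fun a b => ssum b (F a)).
Proof.
elim: s F => [|x s IH] F; first by rewrite !ssum_nil.
rewrite !ssum_cons (IH (fun a1 a2 b => F a1 a2 (x :: b))).
transitivity (ssum s (fun a b => ssum a (fun a1 a2 => F (x :: a1) a2 b) +
                        ssum a (fun a1 a2 => F a1 (x :: a2) b)) +
              ssum s (fun a b => ssum b (fun b1 b2 => F a b1 (x :: b2)))).
  by congr (_ + _); apply: eq_ssum => a b; rewrite ssum_cons.
rewrite ssumD -addrA (IH (fun a1 a2 b => F (x :: a1) a2 b)); congr (_ + _).
rewrite (IH (fun a1 a2 b => F a1 (x :: a2) b)) -ssumD.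
by apply: eq_ssum => a b; rewrite ssum_cons.
Qed.

Lemma ssum_cat u v F :
  ssum (u ++ v) F =
  ssum u (fun u1 u2 => ssum v (fun v1 v2 => F (u1 ++ v1) (u2 ++ v2))).
Proof.
elim: u F => [|x u IH] F /=; first by rewrite ssum_nil.
by rewrite !ssum_cons !IH.
Qed.

Lemma ssum_unitl s (F : seq T -> V) :
  ssum s (fun a b => if a is [::] then F b else 0) = F s.
Proof.
elim: s F => [|x s IH] F; first by rewrite ssum_nil.
by rewrite ssum_cons ssum0 add0r (IH (fun b => F (x :: b))).
Qed.

Lemma ssum_unitr s (F : seq T -> V) :
  ssum s (fun a b => if b is [::] then F a else 0) = F s.
Proof. by rewrite ssumC ssum_unitl. Qed.

End Splits.

Lemma ssum_swap (T S : Type) (V : nmodType) s r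
    (F : seq T -> seq T -> seq S -> seq S -> V) :
  ssum s (fun a b => ssum r (F a b)) = ssum r (fun c d => ssum s (fun a b => F a b c d)).
Proof. exact: exchange_big. Qed.

(** Coassociativity makes the two middle factors adjacent, and cocommutativity exchanges them. *)
Lemma ssum_interchange (T : Type) (V : nmodType) (s : seq T)
    (F : seq T -> seq T -> seq T -> seq T -> V) :
  ssum s (fun a b => ssum a (fun a1 a2 => ssum b (fun b1 b2 => F a1 a2 b1 b2))) =
  ssum s (fun a b => ssum a (fun a1 a2 => ssum b (fun b1 b2 => F a1 b1 a2 b2))).
Proof.
rewrite (ssumA s (fun a1 a2 b => ssum b (fun b1 b2 => F a1 a2 b1 b2))).
rewrite (ssumA s (fun a1 a2 b => ssum b (fun b1 b2 => F a1 b1 a2 b2))).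
apply: eq_ssum => a b.
rewrite -(ssumA b (F a)) -(ssumA b (fun x y z => F a y x z)).
by apply: eq_ssum => c d; rewrite ssumC.
Qed.

Section Grafting.
Variable A : Type.
Local Notation tree := (tree A).
Local Notation forest := (seq tree).
Implicit Types (t u : tree) (f g h ts : forest).

Lemma tree_forest_ind (P : tree -> Prop) (Q : forest -> Prop) :
  (forall a ts, Q ts -> P (Node a ts)) -> Q [::] ->
  (forall t ts, P t -> Q ts -> Q (t :: ts)) ->
  (forall t, P t) /\ (forall ts, Q ts).
Proof.
move=> PN Q0 QS; have Pt : forall t, P t.
  by fix IH 1 => -[a ts]; apply: PN; elim: ts => // t ts IHs; apply: QS.
by split=> //; elim=> // t ts IHs; apply: QS.
Qed.

(* Grafting the forest f on the trees of a forest distributes the trees of f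
   over them; gs lists the functions which graft on each of them. *)
Definition graft_all (gs : seq (forest -> seq tree)) : forest -> seq forest :=
  foldr (fun op K f => flatten
          [seq [seq u :: h | u <- op p.1, h <- K p.2] | p <- splits f])
        (fun f => if f is [::] then [:: [::]] else [::]) gs.

(** The first part of a split becomes the new leftmost children of the root, the second is
    distributed over the old children. Since [graft_all] takes grafting functions instead of trees,
    the recursive calls pass the guard condition. *)
Fixpoint grafts t f : seq tree :=
  let: Node a ts := t in
  map (Node a) (flatten
    [seq map (cat p.1) (graft_all (map grafts ts) p.2) | p <- splits f]).

Definition forest_grafts ts : forest -> seq forest := graft_all (map grafts ts).

(* The forests of the Grossman-Larson product of f and ts; the arguments come in
   the opposite order. *)
Definition gl_forests ts f : seq forest :=
  flatten [seq map (cat p.1) (forest_grafts ts p.2) | p <- splits f].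

Lemma graftsE a ts f : grafts (Node a ts) f = map (Node a) (gl_forests ts f).
Proof. by []. Qed.

Section Sums.
Variable V : nmodType.

Lemma sum_grafts a ts f (F : tree -> V) :
  \sum_(u <- grafts (Node a ts) f) F u = \sum_(h <- gl_forests ts f) F (Node a h).
Proof. by rewrite graftsE big_map. Qed.

Lemma sum_gl_forests ts f (F : forest -> V) :
  \sum_(h <- gl_forests ts f) F h =
  ssum f (fun f1 f2 => \sum_(h <- forest_grafts ts f2) F (f1 ++ h)).
Proof.
by rewrite big_flatten big_map; apply: eq_bigr => p _; rewrite big_map.
Qed.

Lemma sum_forest_grafts_nil f (F : forest -> V) :
  \sum_(h <- forest_grafts [::] f) F h = if f is [::] then F [::] else 0.
Proof. by case: f => [|t f]; rewrite ?big_seq1 ?big_nil. Qed.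

Lemma sum_forest_grafts_cons t ts f (F : forest -> V) :
  \sum_(h <- forest_grafts (t :: ts) f) F h =
  ssum f (fun f1 f2 => \sum_(u <- grafts t f1) \sum_(h <- forest_grafts ts f2) F (u :: h)).
Proof.
rewrite big_flatten big_map; apply: eq_bigr => p _.
by rewrite big_allpairs_dep.
Qed.

Lemma sum_forest_grafts1 t f (F : forest -> V) :
  \sum_(h <- forest_grafts [:: t] f) F h = \sum_(u <- grafts t f) F [:: u].
Proof.
rewrite sum_forest_grafts_cons.
rewrite -(ssum_unitr f (fun f => \sum_(u <- grafts t f) F [:: u])).
apply: eq_ssum => f1 [|x f2]; last by rewrite big1 // => u _; rewrite sum_forest_grafts_nil.
by apply: eq_bigr => u _; rewrite sum_forest_grafts_nil.
Qed.

Lemma sum_forest_grafts_cat ts us f (F : forest -> V) :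
  \sum_(h <- forest_grafts (ts ++ us) f) F h =
  ssum f (fun f1 f2 => \sum_(h <- forest_grafts ts f1) \sum_(h' <- forest_grafts us f2) F (h ++ h')).
Proof.
elim: ts f F => [|t ts IH] f F /=.
  rewrite -(ssum_unitl f (fun f => \sum_(h <- forest_grafts us f) F h)).
  by apply: eq_ssum => f1 f2; rewrite sum_forest_grafts_nil.
rewrite sum_forest_grafts_cons.
under eq_ssum => f1 f2.
  under eq_bigr => u _ do rewrite IH.
  rewrite -ssum_exch; over.
rewrite -ssumA; apply: eq_ssum => f1 f2.
rewrite sum_forest_grafts_cons; apply: eq_ssum => g1 g2.
by [].
Qed.

Lemma sum_grafts_nil t (F : tree -> V) : \sum_(u <- grafts t [::]) F u = F t.
Proof.
have [a ts IH G|G|s ts IHt IHs G|H _] := @tree_forest_ind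
  (fun t => forall F : tree -> V, \sum_(u <- grafts t [::]) F u = F t)
  (fun ts => forall F : forest -> V, \sum_(h <- forest_grafts ts [::]) F h = F ts).
- by rewrite sum_grafts sum_gl_forests ssum_nil IH.
- by rewrite sum_forest_grafts_nil.
- by rewrite sum_forest_grafts_cons ssum_nil IHt IHs.
- exact: H.
Qed.

Lemma sum_forest_grafts_nilr ts (F : forest -> V) : \sum_(h <- forest_grafts ts [::]) F h = F ts.
Proof.
elim: ts F => [|t ts IH] F; first by rewrite sum_forest_grafts_nil.
by rewrite sum_forest_grafts_cons ssum_nil sum_grafts_nil IH.
Qed.

Lemma sum_gl_forests_nil f (F : forest -> V) : \sum_(h <- gl_forests [::] f) F h = F f.
Proof.
rewrite sum_gl_forests -[RHS](ssum_unitr f F); apply: eq_ssum => f1 f2.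
by rewrite sum_forest_grafts_nil cats0.
Qed.

(** Grafting is a morphism of coalgebras: the coproduct of f > ts is the sum of the tensors of f1 >
    ts1 and f2 > ts2. *)
Lemma ssum_forest_grafts ts f (F : forest -> forest -> V) :
  \sum_(h <- forest_grafts ts f) ssum h F =
  ssum f (fun f1 f2 => ssum ts (fun ts1 ts2 =>
    \sum_(h1 <- forest_grafts ts1 f1) \sum_(h2 <- forest_grafts ts2 f2) F h1 h2)).
Proof.
elim: ts f F => [|t ts IH] f F.
  rewrite sum_forest_grafts_nil ssum_nil.
  transitivity (ssum f (fun f1 f2 => if f1 is [::] then
                   if f2 is [::] then F [::] [::] else 0 else 0)).
    by rewrite ssum_unitl.
  by apply: eq_ssum => f1 f2; rewrite ssum_nil !sum_forest_grafts_nil; case: f1.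
rewrite sum_forest_grafts_cons.
under [RHS]eq_ssum => f1 f2 do rewrite ssum_cons.
under eq_ssum => f1 f2.
  under eq_bigr => u _.
    under eq_bigr => h _ do rewrite ssum_cons.
    rewrite big_split /= !IH; over.
  rewrite big_split /= -!ssum_exch; over.
rewrite !ssumD; congr (_ + _).
  rewrite -ssumA; apply: eq_ssum => f1 f2.
  under [RHS]eq_ssum => ts1 ts2 do rewrite sum_forest_grafts_cons.
  rewrite ssum_swap; apply: eq_ssum => g1 g2.
  by rewrite -ssum_exch.
(* Here t falls into the second factor, so the trees grafted on it have to pass those grafted on
   [ts1]; this is where cocommutativity enters. *)
transitivity (ssum f (fun f1 f2 => ssum f2 (fun f3 f4 =>
    \sum_(u <- grafts t f3) ssum ts (fun ts1 ts2 =>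
     \sum_(h1 <- forest_grafts ts1 f1) \sum_(h2 <- forest_grafts ts2 f4) F h1 (u :: h2))))).
  rewrite -2!ssumA; apply: eq_ssum => f1 f2.
  by rewrite ssumC.
apply: eq_ssum => f1 f2.
under [RHS]eq_ssum => ts1 ts2.
  under eq_bigr => h1 _ do rewrite sum_forest_grafts_cons.
  rewrite -ssum_exch; over.
rewrite ssum_swap; apply: eq_ssum => g1 g2.
rewrite -ssum_exch; apply: eq_ssum => ts1 ts2.
by rewrite exchange_big.
Qed.

(** The product of forests is a morphism of coalgebras as well; the interchange law sorts the
    ungrafted and the grafted trees of f into both factors. *)
Lemma ssum_gl_forests g f (F : forest -> forest -> V) :
  \sum_(h <- gl_forests g f) ssum h F =
  ssum f (fun f1 f2 => ssum g (fun g1 g2 =>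
    \sum_(h1 <- gl_forests g1 f1) \sum_(h2 <- gl_forests g2 f2) F h1 h2)).
Proof.
rewrite sum_gl_forests.
under eq_ssum => f1 f2.
  under eq_bigr => h _ do rewrite ssum_cat.
  rewrite -ssum_exch.
  under eq_ssum => a b do rewrite ssum_forest_grafts.
  over.
rewrite /= ssum_interchange; apply: eq_ssum => f1 f2.
under [RHS]eq_ssum => g1 g2.
  rewrite sum_gl_forests.
  under eq_ssum => a b.
    under eq_bigr => h _ do rewrite sum_gl_forests.
    rewrite -ssum_exch; over.
  over.
rewrite [RHS]ssum_swap; apply: eq_ssum => a b.
by rewrite [RHS]ssum_swap.
Qed.

(** Multiplicativity of the counit for the product of forests. *)
Lemma sum_gl_forests_forests_if_nil g f (c : V) :
  \sum_(h <- gl_forests g f) (if h is [::] then c else 0) =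
  if g is [::] then (if f is [::] then c else 0) else 0.
Proof.
case: g => [|t g]; first by rewrite sum_gl_forests_nil.
rewrite sum_gl_forests -[RHS](ssum0 _ f); apply: eq_ssum => f1 f2.
rewrite sum_forest_grafts_cons -[RHS](ssum0 _ f2); apply: eq_ssum => f3 f4.
by rewrite big1 // => u _; rewrite big1 // => h _; case: (f1).
Qed.

(** This is f > (g > t) = (f * g) > t, for trees and for forests. The recursion on the right splits
    the product f * g, and the coalgebra property above turns this into splittings of f and of g, to
    which the induction hypotheses apply. *)
Lemma grafting_action :
  (forall t g f (F : tree -> V),
     \sum_(u <- grafts t g) \sum_(u' <- grafts u f) F u' =
     \sum_(m <- gl_forests g f) \sum_(u <- grafts t m) F u) /\
  (forall ts g f (F : forest -> V),
     \sum_(h <- forest_grafts ts g) \sum_(h' <- forest_grafts h f) F h' =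
     \sum_(m <- gl_forests g f) \sum_(h <- forest_grafts ts m) F h).
Proof.
apply: tree_forest_ind => [a ts IH g f F|g f F|t ts IHt IHs g f F].
- rewrite sum_grafts.
  under eq_bigr => h _ do rewrite sum_grafts.
  under [RHS]eq_bigr => h _ do rewrite sum_grafts sum_gl_forests.
  rewrite ssum_gl_forests ssum_swap sum_gl_forests; apply: eq_ssum => g1 g2.
  under eq_bigr => h _.
    rewrite sum_gl_forests.
    under eq_ssum => f1 f2 do rewrite sum_forest_grafts_cat.
    over.
  under [RHS]eq_ssum => f1 f2 do rewrite sum_gl_forests.
  rewrite ssumA -ssum_exch; apply: eq_ssum => f1 f2.
  rewrite -ssum_exch; apply: eq_ssum => f3 f4.
  rewrite exchange_big; apply: eq_bigr => x _ /=.
  rewrite (IH g2 f4 (fun y => F (Node a (f1 ++ x ++ y)))).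
  apply: eq_bigr => m _; apply: eq_bigr => y _.
  by rewrite catA.
- rewrite sum_forest_grafts_nil.
  under [RHS]eq_bigr => m _ do rewrite sum_forest_grafts_nil.
  rewrite sum_gl_forests_forests_if_nil; case: g => //.
  by rewrite sum_forest_grafts_nil.
- rewrite sum_forest_grafts_cons.
  under [RHS]eq_bigr => m _ do rewrite sum_forest_grafts_cons.
  rewrite ssum_gl_forests ssum_swap; apply: eq_ssum => g1 g2.
  under eq_bigr => u _.
    under eq_bigr => h _ do rewrite sum_forest_grafts_cons.
    rewrite -ssum_exch; over.
  rewrite -ssum_exch; apply: eq_ssum => f1 f2.
  transitivity (\sum_(u <- grafts t g1) \sum_(u' <- grafts u f1)
     \sum_(h <- forest_grafts ts g2) \sum_(h' <- forest_grafts h f2) F (u' :: h')).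
    by apply: eq_bigr => u _; rewrite exchange_big.
  rewrite IHt; apply: eq_bigr => m _.
  rewrite [RHS]exchange_big /=; apply: eq_bigr => u _.
  exact: (IHs g2 f2 (fun h => F (u :: h))).
Qed.

End Sums.
End Grafting.

(** * Codes of planar trees *)

Section Vertices.
Variable A : choiceType.
Local Notation tree := (tree A).
Local Notation forest := (seq tree).
Implicit Types (t u : tree) (f g h ts pre : forest).

(** Names the anonymous inner recursion of [vertices]. *)
Fixpoint vertices_from (j : nat) ts : seq (seq nat) :=
  if ts is u :: us then map (cons j) (vertices u) ++ vertices_from j.+1 us
  else [::].

Lemma verticesE a ts : vertices (Node a ts) = [::] :: vertices_from 0 ts.
Proof. by congr cons; elim: ts 0%N => //= t ts IH j; rewrite IH. Qed.

(** Vertices are addresses, so the trees already passed are kept in [pre], whose size is the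
    position of the next one. *)
Lemma map_subtree (R : Type) (F : tree -> R) a pre ts :
  [seq F (subtree (Node a (pre ++ ts)) v) | v <- vertices_from (size pre) ts] =
  flatten [seq [seq F (subtree t v) | v <- vertices t] | t <- ts].
Proof.
elim: ts pre => //= t ts IH pre; rewrite map_cat -map_comp; congr (_ ++ _).
  by apply: eq_map => v; rewrite /= nth_cat ltnn subnn.
by rewrite -(IH (rcons pre t)) size_rcons cat_rcons.
Qed.

Definition fer_words f : seq (A * nat) := flatten (map (@fer_word A) f).

Lemma fer_word_node a ts :
  fer_word (Node a ts) = (a, size ts) :: fer_words ts.
Proof.
rewrite /fer_word verticesE; congr cons.
exact: (map_subtree (fun t => (dec t, size (children t))) a [::] ts).
Qed.

Local Arguments fer_word : simpl never.
Local Arguments fer_words : simpl never.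

Lemma fer_words_cons t f : fer_words (t :: f) = fer_word t ++ fer_words f.
Proof. by []. Qed.

Lemma fer_words_cat f g : fer_words (f ++ g) = fer_words f ++ fer_words g.
Proof. by rewrite /fer_words map_cat flatten_cat. Qed.

(** Unlike in [grafts], the trees of f stay together and all go, in order, to one vertex; on codes
    each result is one word of the product in g(A). *)
Fixpoint insert_at f t : seq tree :=
  let: Node a ts := t in
  Node a (f ++ ts) :: map (Node a)
   ((fix go us := if us is u :: us' then
       [seq v :: us' | v <- insert_at f u] ++ map (cons u) (go us')
     else [::]) ts).

Fixpoint insert_in f ts : seq forest :=
  if ts is u :: us then
    [seq v :: us | v <- insert_at f u] ++ map (cons u) (insert_in f us)
  else [::].

Lemma insert_atE f a ts :
  insert_at f (Node a ts) = Node a (f ++ ts) :: map (Node a) (insert_in f ts).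
Proof. by congr (_ :: map _ _); elim: ts => //= t ts ->. Qed.

Section Sums.
Variable V : nmodType.

Lemma sum_insert_at f a ts (F : tree -> V) :
  \sum_(u <- insert_at f (Node a ts)) F u =
  F (Node a (f ++ ts)) + \sum_(h <- insert_in f ts) F (Node a h).
Proof. by rewrite insert_atE big_cons big_map. Qed.

Lemma sum_insert_in f t ts (F : forest -> V) :
  \sum_(h <- insert_in f (t :: ts)) F h =
  \sum_(u <- insert_at f t) F (u :: ts) + \sum_(h <- insert_in f ts) F (t :: h).
Proof. by rewrite /= big_cat !big_map. Qed.

Lemma ssum1 (T : Type) (x : T) (F : seq T -> seq T -> V) :
  ssum [:: x] F = F [:: x] [::] + F [::] [:: x].
Proof. by rewrite ssum_cons !ssum_nil. Qed.

Lemma sum_graft_tree s t (F : tree -> V) :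
  \sum_(u <- grafts t [:: s]) F u = \sum_(v <- vertices t) F (attach s t v).
Proof.
have [a ts IH G|pre a G|u us IHu IHus pre a G|-> //] := @tree_forest_ind A
  (fun t => forall F : tree -> V,
     \sum_(u <- grafts t [:: s]) F u = \sum_(v <- vertices t) F (attach s t v))
  (fun ts => forall pre a (F : tree -> V),
     \sum_(h <- forest_grafts ts [:: s]) F (Node a (pre ++ h)) =
     \sum_(v <- vertices_from (size pre) ts) F (attach s (Node a (pre ++ ts)) v)).
- rewrite sum_grafts sum_gl_forests ssum1 sum_forest_grafts_nilr verticesE big_cons addrC.
  by rewrite -(IH [::]) addrC.
- by rewrite sum_forest_grafts_nil big_nil.
- rewrite sum_forest_grafts_cons ssum1 /= big_cat big_map; congr (_ + _).
    under eq_bigr => v _ do rewrite sum_forest_grafts_nilr.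
    rewrite IHu; apply: eq_bigr => v _ /=.
    rewrite nth_cat ltnn subnn /= set_nthE size_cat /= addnS ltnS leq_addr.
    rewrite take_size_cat // drop_cat ltnNge leqnSn /= subSn // subnn /= drop0.
    by [].
  rewrite sum_grafts_nil -cat_rcons -(size_rcons pre u) -IHus.
  by apply: eq_bigr => h _; rewrite cat_rcons.
Qed.

End Sums.

(* The words of the product of x and y in g(A), m being the opposite of the
   weight of x. *)
Fixpoint insert_word (m : nat) (x y : seq (A * nat)) : seq (seq (A * nat)) :=
  if y is z :: y' then
    ((z.1, (z.2 + m)%N) :: x ++ y') :: map (cons z) (insert_word m x y') else [::].

Lemma insert_word_cat m x y1 y2 :
  insert_word m x (y1 ++ y2) =
  [seq w ++ y2 | w <- insert_word m x y1] ++ [seq y1 ++ w | w <- insert_word m x y2].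
Proof.
elim: y1 => [|z y1 IH] /=; first by rewrite map_id.
rewrite -catA IH map_cat -!map_comp; congr (_ :: _ ++ _).
Qed.

(** The chosen vertex gains [size f] children, which raises its letter by that amount; as they
    become its leftmost children, their codes follow this letter immediately in the root-subtree
    order. *)
Lemma fer_word_insert f t :
  map (@fer_word A) (insert_at f t) = insert_word (size f) (fer_words f) (fer_word t).
Proof.
have [a ts IH||u us IHu IHus|-> //] := @tree_forest_ind A
  (fun t => map (@fer_word A) (insert_at f t) =
            insert_word (size f) (fer_words f) (fer_word t))
  (fun ts => map fer_words (insert_in f ts) =
             insert_word (size f) (fer_words f) (fer_words ts)).
- rewrite insert_atE map_cons !fer_word_node /= size_cat addnC fer_words_cat.
  congr (_ :: _); rewrite -IH -!map_comp.
  (* Insertion below the root keeps the number of its children, hence its letter. *)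
  have sz : all (fun h => size h == size ts) (insert_in f ts).
    elim: ts {IH} => //= u us IHus; rewrite all_cat !all_map.
    apply/andP; split; first by apply/allP => v _ /=.
    by apply/allP => h /(allP IHus) /= /eqP ->.
  elim: (insert_in f ts) sz => //= h s IHs /andP[/eqP sh /IHs ->].
  by rewrite fer_word_node sh.
- by [].
- rewrite /= map_cat -!map_comp fer_words_cons insert_word_cat -IHu -IHus.
  by rewrite -!map_comp.
Qed.

Lemma fer_words_insert f ts :
  map fer_words (insert_in f ts) = insert_word (size f) (fer_words f) (fer_words ts).
Proof.
elim: ts => //= u us IHus.
rewrite map_cat -!map_comp fer_words_cons insert_word_cat -fer_word_insert -IHus.
by rewrite -!map_comp.
Qed.

End Vertices.

(** * Lukasiewicz words and unique decoding *)

Section Lukasiewicz.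
Variable A : finType.
Local Notation tree := (tree A).
Implicit Types (t u : tree) (f g h ts : seq tree) (w : seq (A * nat)).

Local Arguments fer_word : simpl never.
Local Arguments fer_words : simpl never.

Lemma wt_cons z w : wt (z :: w) = z.2%:Z - 1 + wt w.
Proof. exact: big_cons. Qed.

Lemma wt_cat v w : wt (v ++ w) = wt v + wt w :> int.
Proof. exact: big_cat. Qed.

(* The words coding the forests of n trees, see luka_fer_words and luka_surj. *)
Definition luka (n : nat) w :=
  wt w = - n%:Z /\ forall q, (q < size w)%N -> - n%:Z < wt (take q w).

Lemma luka_cat n m v w : luka n v -> luka m w -> luka (n + m) (v ++ w).
Proof.
move=> [wv pv] [ww pw]; split=> [|q].
  by rewrite wt_cat wv ww PoszD opprD.
rewrite size_cat take_cat; case: (ltnP q (size v)) => lq; first move=> _.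
  by have := pv _ lq; lia.
by rewrite -ltn_subLR // wt_cat wv => /pw; lia.
Qed.

Lemma luka_cons a m w : luka m w -> luka 1 ((a, m) :: w).
Proof.
move=> [ww pw]; split=> [|[|q]] /=.
- by rewrite wt_cons /= ww; lia.
- by move=> _; rewrite /wt big_nil.
- by rewrite ltnS wt_cons /= => /pw; lia.
Qed.

Lemma luka_fer_word t : luka 1 (fer_word t).
Proof.
have [a ts IH||u us IHu IHus|h _] := @tree_forest_ind A
  (fun t => luka 1 (fer_word t)) (fun ts => luka (size ts) (fer_words ts)).
- by rewrite fer_word_node; exact: luka_cons.
- by split=> //; rewrite /wt big_nil.
- by rewrite fer_words_cons -[size _]add1n; exact: luka_cat.
- exact: h.
Qed.

Lemma luka_fer_words f : luka (size f) (fer_words f).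
Proof.
elim: f => [|t f IH]; first by split=> //; rewrite /wt big_nil.
by rewrite fer_words_cons -[size _]add1n; apply: luka_cat (luka_fer_word t) IH.
Qed.

(** Decoding from the right: the tail of the word codes n - 1 + m trees, and the first m of them
    become the children of the vertex given by the first letter. *)
Lemma luka_surj n w : luka n w -> exists f, size f = n /\ fer_words f = w.
Proof.
elim: w n => [|[a m] w IH] n [ww pw].
  by exists [::]; split=> //; move: ww; rewrite /wt big_nil /=; lia.
have n0 : (0 < n)%N by have := pw 0%N isT; rewrite /wt big_nil; lia.
have /IH[f [sf fw]] : luka (n.-1 + m) w.
  split=> [|q lq]; first by move: ww; rewrite wt_cons /=; lia.
  by have := pw q.+1 lq; rewrite /= wt_cons /=; lia.
exists (Node a (take m f) :: drop m f); split.
  by rewrite /= size_drop sf; lia.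
rewrite fer_words_cons fer_word_node /= -fer_words_cat cat_take_drop fw.
by rewrite size_takel // sf; lia.
Qed.

(** For integers, being greater than -1 is being nonnegative; the two ranges of prefixes differ only
    by the empty prefix, of weight 0. *)
Lemma in_VP w : reflect (luka 1 w) (in_V w).
Proof.
apply: (iffP andP) => [[/eqP e /allP h]|[e h]]; split=> //.
- move=> [|q] lq; first by rewrite take0 /wt big_nil.
  have /h : q.+1 \in iota 1 (size w).-1 by rewrite mem_iota; lia.
  by move: (wt (take _ w)) => z; lia.
- by apply/eqP.
- have aux (q : nat) : (0 < q < 1 + (size w).-1)%N -> 0 <= wt (take q w).
    move=> hq; have /h : (q < size w)%N by lia.
    by move: (wt (take _ w)) => z; lia.
  by apply/allP => q; rewrite mem_iota; exact: aux.
Qed.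

Lemma in_V_fer_word t : in_V (fer_word t).
Proof. exact/in_VP/luka_fer_word. Qed.

Lemma in_V_ex w : in_V w -> exists t, fer_word t = w.
Proof.
move/in_VP/luka_surj => [[|t [|u f]] [//= _ <-]].
by exists t; rewrite fer_words_cons cats0.
Qed.

(** The power of the derivation in [tri_word] is thus the number of trees inserted, that is the
    number of children gained. *)
Lemma absz_wt_fer_words f : `|wt (fer_words f)|%N = size f.
Proof. by have [-> _] := luka_fer_words f; rewrite abszN. Qed.

(** After removal of equal first letters the tails code [ts ++ f] and [us ++ g]; the letter also
    records the number of children, so equal concatenations are cut at the same place. As [ts ++ f]
    is not a subterm, the induction bounds the length of the code. *)
Lemma fer_words_inj : injective (@fer_words A).
Proof.
move=> f g; move: {2}(size _) (leqnn (size (fer_words f))) => n.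
elim: n f g => [|n IH] [|[a ts] f] [|[b us] g] //;
  rewrite !fer_words_cons !fer_word_node // => sz [-> ets].
rewrite -!fer_words_cat => /IH e.
have /eqP : ts ++ f = us ++ g by apply: e; rewrite fer_words_cat.
by rewrite eqseq_cat // => /andP[/eqP-> /eqP->].
Qed.

(** A finite list that covers the forests with at most n vertices and contains larger ones too. *)
Fixpoint all_forests (n : nat) : seq (seq tree) :=
  if n is m.+1 then
    [::] :: [seq Node p.1 p.2 :: g |
              p <- [seq (a, f) | a <- enum A, f <- all_forests m],
              g <- all_forests m]
  else [:: [::]].

Lemma mem_all_forests n f : (size (fer_words f) <= n)%N -> f \in all_forests n.
Proof.
elim: n f => [|n IH] [|[a ts] f] //; rewrite fer_words_cons fer_word_node //=.
rewrite size_cat ltnS => sz; rewrite inE; apply/allpairsP.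
exists ((a, ts), f); split=> //=; last by apply: IH; exact: leq_trans (leq_addl _ _) sz.
by apply/allpairsP; exists (a, ts); rewrite mem_enum IH //=; exact: leq_trans (leq_addr _ _) sz.
Qed.

End Lukasiewicz.

Section TriWord.
Variables (k : fieldType) (A : finType).

Lemma tri_wordE (x y : seq (A * nat)) :
  tri_word k x y = \sum_(w <- insert_word `|wt x| x y) word k w.
Proof.
rewrite /tri_word; move: `|wt x|%N => m.
transitivity (\sum_(j < size y) word k (nth [::] (insert_word m x y) j)
  : freeAlg k (letter A)).
  apply: eq_bigr => j _; congr word.
  case: j => j lt_j; rewrite (tnth_nth (tnth (in_tuple y) (Ordinal lt_j))) /=.
  elim: y j lt_j (tnth _ _) => // z y IH [|j] lt_j d /=; first by rewrite drop0.
  rewrite (nth_map [::]) ?IH //; elim: (y) {IH} j lt_j => //= ? ? ? [|?] ?;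
    by rewrite ?ltnS ?size_map; auto.
have <- : size (insert_word m x y) = size y.
  by elim: y => //= z y IH; rewrite size_map IH.
by rewrite [RHS](big_nth [::]) big_mkord.
Qed.

End TriWord.

(** * The free post-Lie algebra *)

Section Specified.
Variables (T : Type) (x0 : T) (P : T -> Prop).

Lemma the_spec : (exists x, P x) -> P (the x0 P).
Proof. by rewrite /the; case: pselect => [e _|//]; exact: svalP (cid e). Qed.

Lemma the_eq x : P x -> (forall y, P y -> y = x) -> the x0 P = x.
Proof. by move=> Px u; apply: u; apply: the_spec; exists x. Qed.

End Specified.

Section EnvelopingUniqueness.
Variables (k : fieldType) (L : lieAlgType k) (U : algType k) (i : L -> U).

(** Stated as an induction principle, so that the uniqueness lemmas apply both to the forest algebra
    and to [env]. *)
Definition generates := forall P : U -> Prop,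
  P 1 -> (forall x X, P X -> P (i x * X)) -> P 0 ->
  (forall a X Y, P X -> P Y -> P (a *: X + Y)) -> forall X, P X.

Hypothesis gen : generates.

Lemma env_comul_unique D D' : env_comul_spec i D -> env_comul_spec i D' -> D =1 D'.
Proof.
move=> [lD D1 DM Di] [lD' D1' DM' Di']; apply: gen => [|x X IH||a X Y IX IY].
- by rewrite D1 D1'.
- by rewrite DM DM' IH Di Di'.
- by rewrite !lin0.
- by rewrite lD lD' IX IY.
Qed.

Lemma env_comulE D : env_comul_spec i D -> env_comul i = D.
Proof.
move=> h; apply: the_eq => // D' h'; apply: funext; exact: env_comul_unique.
Qed.

Lemma env_counitE e : env_counit_spec i e -> env_counit i = e.
Proof.
move=> [le e1 eM ei]; apply: the_eq => // e' [le' e1' eM' ei'].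
apply: funext; apply: gen => [|x X IH||a X Y IX IY].
- by rewrite e1 e1'.
- by rewrite eM eM' IH ei ei'.
- by rewrite !lin0.
- by rewrite le le' IX IY.
Qed.

End EnvelopingUniqueness.

Lemma size_splits (T : eqType) (s : seq T) p : p \in splits s ->
  (size p.1 + size p.2)%N = size s.
Proof.
elim: s p => [|x s IH] p /=; first by rewrite inE => /eqP->.
rewrite mem_cat => /orP[] /mapP[q /IH <- ->] //=.
by rewrite addnS.
Qed.

Lemma comm_cancel (V : zmodType) (p q r s p' s' : V) :
  p + q + (r + s) - (p' + r + (q + s')) = p - p' + (s - s').
Proof.
rewrite [r + s]addrC [q + s']addrC (addrACA p) (addrACA p').
rewrite [r + q]addrC opprD (addrACA (p + s)).
by rewrite subrr addr0 opprD addrACA.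
Qed.

Section Commutators.
Variables (k : fieldType) (U : algType k).

Lemma primitive_comm (D : U -> tens U U) x y : linear D ->
  (forall X Y, D (X * Y) = tens_mul (D X) (D Y)) ->
  D x = pure x 1 + pure 1 x -> D y = pure y 1 + pure 1 y ->
  D (x * y - y * x) = pure (x * y - y * x) 1 + pure 1 (x * y - y * x).
Proof.
move=> lD DM Dx Dy; have hM := tens_mul_bilin U.
rewrite (linB lD) !DM Dx Dy.
rewrite !(linD (hM.1 _)) !(linD (hM.2 _)) !tens_mul_pure !mulr1 !mul1r.
by rewrite (linB (pure_linl _)) (linB (pure_linr _)); exact: comm_cancel.
Qed.

Lemma derivation_comm (d : U -> U) y z : linear d ->
  (forall Y Z, d (Y * Z) = d Y * Z + Y * d Z) ->
  d (y * z - z * y) = (d y * z - z * d y) + (y * d z - d z * y).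
Proof.
move=> ld dM; rewrite (linB ld) !dM.
by rewrite [X in _ - X]addrC opprD addrACA.
Qed.

Lemma character_comm (e : U -> k^o) x y : linear e ->
  (forall X Y, e (X * Y) = e X * e Y) -> e x = 0 -> e (x * y - y * x) = 0.
Proof. by move=> le eM ex; rewrite (linB le) !eM ex mul0r mulr0 subrr. Qed.

End Commutators.

Section TreeAlgebra.
Variables (k : fieldType) (A : finType).
Local Notation tree := (tree A).
Local Notation forest := (seq tree).
Local Notation OF := (freeAlg k tree).
Local Notation PSL := (PSL k A).
Local Notation pvf := (val : PSL -> OF).
Local Notation pv x := (val (x : PSL) : OF).
Local Notation leaf t := (word k [:: t] : OF).
Implicit Types (t u s : tree) (f g h ts : forest).

Lemma PSL_tree_val t : val (PSL_tree k t) = leaf t.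
Proof. by []. Qed.

Lemma val_PSL_lie (x y : PSL) : pv (lie x y) = pv x * pv y - pv y * pv x.
Proof. by []. Qed.

Lemma PSL_ind (P : PSL -> Prop) :
  (forall t, P (PSL_tree k t)) -> P 0 ->
  (forall a x y, P x -> P y -> P (a *: x + y)) ->
  (forall x y, P x -> P y -> P (lie x y)) -> forall x, P x.
Proof.
move=> Pt P0 PD PL; apply: lieGen_ind => // b Sb.
have [t e] := Sb; suff -> : lieGen_of Sb = PSL_tree k t by [].
by apply: val_inj.
Qed.

Lemma tree_word_ind (P : OF -> Prop) :
  P 1 -> (forall t X, P X -> P (leaf t * X)) -> P 0 ->
  (forall a X Y, P X -> P Y -> P (a *: X + Y)) -> forall X, P X.
Proof.
move=> P1 PM P0 PD; apply: freeAlg_ind => //.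
by elim=> [|t f IH]; rewrite ?word_nil // word_cons; exact: PM.
Qed.

Lemma PSL_generates : generates pvf.
Proof.
move=> P P1 PM P0 PD; apply: tree_word_ind => // t X PX.
by rewrite -PSL_tree_val; exact: PM.
Qed.

Definition deshuffle : OF -> tens OF OF :=
  free_ext (fun f => ssum f (fun a b => pure (word k a : OF) (word k b : OF))).

Lemma deshuffle_lin : linear deshuffle. Proof. exact: free_ext_lin. Qed.

Lemma deshuffle_word f :
  deshuffle (word k f) = ssum f (fun a b => pure (word k a : OF) (word k b : OF)).
Proof. exact: free_ext_word. Qed.

Lemma lift_ssum (V : lmodType k) (B : OF -> OF -> V) f : bilin B ->
  tens_lift B (ssum f (fun a b => pure (word k a : OF) (word k b : OF))) =
  ssum f (fun a b => B (word k a) (word k b)).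
Proof.
move=> hB; rewrite /ssum (lin_sum (tens_lift_lin hB)).
by apply: eq_bigr => p _; rewrite tens_lift_pure.
Qed.

Lemma lift_deshuffle (V : lmodType k) (B : OF -> OF -> V) X : bilin B ->
  tens_lift B (deshuffle X) =
  free_ext (fun f => ssum f (fun a b => B (word k a) (word k b))) X.
Proof.
move=> hB; rewrite (@free_extE _ _ _ (fun X => tens_lift B (deshuffle X))).
  by apply: eq_free_ext => f; rewrite deshuffle_word lift_ssum.
exact: lin_comp (tens_lift_lin hB) deshuffle_lin.
Qed.

Lemma deshuffle1 : deshuffle 1 = pure 1 1.
Proof. by rewrite -word_nil deshuffle_word ssum_nil. Qed.

Lemma deshuffle_tree t : deshuffle (leaf t) = pure (leaf t) 1 + pure 1 (leaf t).
Proof. by rewrite deshuffle_word ssum1 word_nil. Qed.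

Lemma deshuffleM X Y : deshuffle (X * Y) = tens_mul (deshuffle X) (deshuffle Y).
Proof.
have hM := tens_mul_bilin OF.
apply: (@free_bilin_eq _ _ _ (fun X Y => deshuffle (X * Y))
  (fun X Y => tens_mul (deshuffle X) (deshuffle Y))).
- exact: lin_bilin deshuffle_lin (mul_bilin OF).
- exact: bilin_comp hM deshuffle_lin deshuffle_lin.
move=> f g; rewrite -word_cat !deshuffle_word ssum_cat.
rewrite /ssum (lin_sum (hM.1 _)); apply: eq_bigr => p _.
rewrite (lin_sum (hM.2 _)); apply: eq_bigr => q _ /=.
by rewrite !word_cat tens_mul_pure.
Qed.

Lemma deshuffle_PSL x : deshuffle (pv x) = pure (pv x) 1 + pure 1 (pv x).
Proof.
elim/PSL_ind: x => [t||a x y hx hy|x y hx hy].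
- exact: deshuffle_tree.
- by rewrite (lin0 deshuffle_lin) (lin0 (pure_linl _)) (lin0 (pure_linr _)) addr0.
- rewrite [val _](lieGen_val_lin) deshuffle_lin hx hy.
  by rewrite (pure_linl _) (pure_linr _) scalerDr addrACA.
- exact: primitive_comm deshuffle_lin deshuffleM hx hy.
Qed.

End TreeAlgebra.

Section TreeGrafting.
Variables (k : fieldType) (A : finType).
Local Notation tree := (tree A).
Local Notation forest := (seq tree).
Local Notation OF := (freeAlg k tree).
Local Notation PSL := (PSL k A).
Local Notation pvf := (val : PSL -> OF).
Local Notation pv x := (val (x : PSL) : OF).
Local Notation leaf t := (word k [:: t] : OF).
Implicit Types (t u s : tree) (f g h ts : forest).

Lemma deshuffle_spec : env_comul_spec pvf (@deshuffle k A).
Proof.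
split; [exact: deshuffle_lin|exact: deshuffle1|exact: deshuffleM|].
exact: deshuffle_PSL.
Qed.

Lemma env_comul_OF : env_comul pvf = @deshuffle k A.
Proof. exact (env_comulE (@PSL_generates k A) deshuffle_spec). Qed.

Lemma ssum_PSL (V : lmodType k) (B : OF -> OF -> V) (x : PSL) : bilin B ->
  free_ext (fun f => ssum f (fun a b => B (word k a) (word k b))) (pv x) =
  B (pv x) 1 + B 1 (pv x).
Proof.
move=> hB; rewrite -lift_deshuffle // deshuffle_PSL.
by rewrite (linD (tens_lift_lin hB)) !tens_lift_pure.
Qed.

Definition graftT : OF -> OF -> OF :=
  free_bilin_ext (fun f g => \sum_(h <- forest_grafts g f) word k h).

Definition graftGL : OF -> OF -> OF :=
  free_bilin_ext (fun f g => \sum_(h <- gl_forests g f) word k h).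

Lemma graftT_bilin : bilin graftT. Proof. exact: free_bilin_ext_bilin. Qed.
Lemma graftGL_bilin : bilin graftGL. Proof. exact: free_bilin_ext_bilin. Qed.

Lemma graftT_word f g :
  graftT (word k f) (word k g) = \sum_(h <- forest_grafts g f) word k h.
Proof. exact: free_bilin_ext_word. Qed.

Lemma graftGL_word f g :
  graftGL (word k f) (word k g) = \sum_(h <- gl_forests g f) word k h.
Proof. exact: free_bilin_ext_word. Qed.

Local Opaque graftT graftGL deshuffle.

Lemma graftT1 X : graftT 1 X = X.
Proof.
apply: (@free_lin_ext _ _ _ (graftT 1) id) => //; first exact: graftT_bilin.2.
by move=> f; rewrite -word_nil graftT_word sum_forest_grafts_nilr.
Qed.

Lemma graftTM X Y Z :
  graftT X (Y * Z) =
  tens_lift (fun X1 X2 => graftT X1 Y * graftT X2 Z) (deshuffle X).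
Proof.
have hB Y' Z' : bilin (fun X1 X2 => graftT X1 Y' * graftT X2 Z').
  exact: bilin_comp (mul_bilin OF) (graftT_bilin.1 _) (graftT_bilin.1 _).
rewrite (lift_deshuffle _ (hB _ _)).
apply: (@free_lin_ext _ _ _ (fun X => graftT X (Y * Z))).
- exact: graftT_bilin.1.
- exact: free_ext_lin.
move=> f; rewrite free_ext_word.
apply: (@free_bilin_eq _ _ _ (fun Y Z => graftT (word k f) (Y * Z))
  (fun Y Z => ssum f (fun a b => graftT (word k a) Y * graftT (word k b) Z))).
- exact: lin_bilin (graftT_bilin.2 _) (mul_bilin OF).
- split=> z; apply: sum_lin => p.
    exact: lin_comp (mulr_lin _) (graftT_bilin.2 _).
  exact: lin_comp (mull_lin _) (graftT_bilin.2 _).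
move=> g h; rewrite -word_cat graftT_word sum_forest_grafts_cat; apply: eq_ssum => a b.
rewrite !graftT_word mulr_suml; apply: eq_bigr => u _.
by rewrite mulr_sumr; apply: eq_bigr => v _; rewrite word_cat.
Qed.

Lemma graftGL_E X Y :
  graftGL X Y = tens_lift (fun X1 X2 => X1 * graftT X2 Y) (deshuffle X).
Proof.
have hB Y' : bilin (fun X1 X2 => X1 * graftT X2 Y').
  exact: bilin_comp (mul_bilin OF) (@id_lin _ _) (graftT_bilin.1 _).
rewrite (lift_deshuffle _ (hB _)).
apply: (@free_bilin_eq _ _ _ graftGL
  (fun X Y => free_ext
    (fun f => ssum f (fun a b => word k a * graftT (word k b) Y)) X)).
- exact: graftGL_bilin.
- split=> [Y'|X']; first exact: free_ext_lin.
  apply: (@free_ext_lin2 _ _ _ _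
    (fun f Y => ssum f (fun a b => word k a * graftT (word k b) Y))).
  move=> f; apply: sum_lin => p.
  exact: lin_comp (mull_lin _) (graftT_bilin.2 _).
move=> f g; rewrite graftGL_word free_ext_word sum_gl_forests; apply: eq_ssum => a b.
by rewrite graftT_word mulr_sumr; apply: eq_bigr => h _; rewrite word_cat.
Qed.

Lemma graftT_action X Y Z : graftT X (graftT Y Z) = graftT (graftGL X Y) Z.
Proof.
have lT := graftT_bilin; have lG := graftGL_bilin.
move: Z; apply: free_lin_ext => [||h].
- exact: lin_comp (lT.2 _) (lT.2 _).
- exact: lT.2.
apply: (@free_bilin_eq _ _ _ (fun X Y => graftT X (graftT Y (word k h)))
  (fun X Y => graftT (graftGL X Y) (word k h))).
- exact: bilin_comp lT (@id_lin _ _) (lT.1 _).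
- exact: lin_bilin (lT.1 _) lG.
move=> f g; rewrite graftGL_word graftT_word (lin_sum (lT.2 _)) (lin_sum (lT.1 _)).
under eq_bigr => u _ do rewrite graftT_word.
under [RHS]eq_bigr => u _ do rewrite graftT_word.
exact: (grafting_action A _).2.
Qed.

Lemma graftGL_PSL (x : PSL) Y : graftGL (pv x) Y = pv x * Y + graftT (pv x) Y.
Proof.
rewrite graftGL_E deshuffle_PSL.
have hB : bilin (fun X1 X2 => X1 * graftT X2 Y).
  exact: bilin_comp (mul_bilin OF) (@id_lin _ _) (graftT_bilin.1 _).
by rewrite (linD (tens_lift_lin hB)) !(tens_lift_pure hB) graftT1 mul1r.
Qed.

Lemma graftT_PSL_M (x : PSL) Y Z :
  graftT (pv x) (Y * Z) = graftT (pv x) Y * Z + Y * graftT (pv x) Z.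
Proof.
rewrite graftTM deshuffle_PSL.
have hB : bilin (fun X1 X2 => graftT X1 Y * graftT X2 Z).
  exact: bilin_comp (mul_bilin OF) (graftT_bilin.1 _) (graftT_bilin.1 _).
by rewrite (linD (tens_lift_lin hB)) !(tens_lift_pure hB) !graftT1.
Qed.

(** Insert x * X = xX + x > X, valid for primitive x, into the action identity. Antisymmetrised,
    this is the post-Lie axiom for [x, y] > z. *)
Lemma graftT_PSL_l (x : PSL) X Z :
  graftT (pv x * X) Z = graftT (pv x) (graftT X Z) - graftT (graftT (pv x) X) Z.
Proof.
by rewrite graftT_action graftGL_PSL (linD (graftT_bilin.1 _)) addrK.
Qed.

(* Elements of bracket length n are combinations of brackets of n + 1 trees.
   Since x > y has the bracket length of y, the axiom for [t, y] > z determines a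
   post-Lie product by induction on the bracket length of its left argument. *)
Inductive bracket_length : nat -> PSL -> Prop :=
| BLtree t : bracket_length 0 (PSL_tree k t)
| BLlie n t y : bracket_length n y -> bracket_length n.+1 (lie (PSL_tree k t) y)
| BL0 n : bracket_length n 0
| BLD n a x y : bracket_length n x -> bracket_length n y ->
    bracket_length n (a *: x + y).

(** Grafting on one tree produces single trees again. *)
Lemma graftT_tree X t : exists2 z, bracket_length 0 z & pv z = graftT X (leaf t).
Proof.
elim/freeAlg_ind: X => [|a X Y [x bx ex] [y by_ ey]|f].
- by exists 0; [exact: BL0|rewrite (lin0 (graftT_bilin.1 _))].
- exists (a *: x + y); first exact: BLD.
  by rewrite lieGen_val_lin ex ey (graftT_bilin.1 _).
rewrite graftT_word sum_forest_grafts1; elim: (grafts t f) => [|u s [z bz ez]].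
  by exists 0; [exact: BL0|rewrite big_nil].
exists (1 *: PSL_tree k u + z); first by apply: BLD => //; exact: BLtree.
by rewrite lieGen_val_lin big_cons ez scale1r.
Qed.

(** A primitive element acts by a derivation, so stability under brackets reduces to the case of one
    tree. *)
Lemma graftT_PSL (x y : PSL) : graftT (pv x) (pv y) \in lie_hull (@is_tree k A).
Proof.
elim/PSL_ind: y => [t||a y z hy hz|y z hy hz].
- by have [z _ <-] := graftT_tree (pv x) t; exact: valP.
- by rewrite (lin0 (graftT_bilin.2 _)); exact: (valP (0 : PSL)).
- rewrite lieGen_val_lin (graftT_bilin.2 _).
  exact: (valP (a *: (LieGen hy : PSL) + LieGen hz)).
rewrite val_PSL_lie (derivation_comm _ _ (graftT_bilin.2 _) (graftT_PSL_M x)).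
exact: (valP (lie (LieGen hy : PSL) z + lie y (LieGen hz : PSL))).
Qed.

Definition graft_tri (x y : PSL) : PSL := LieGen (graftT_PSL x y).

Lemma graft_triE x y : pv (graft_tri x y) = graftT (pv x) (pv y).
Proof. by []. Qed.

Lemma graft_tri_post_lie : post_lie graft_tri.
Proof.
have lT := graftT_bilin; have lv := @lieGen_val_lin _ _ (@is_tree k A).
split.
- by split=> z a x y; apply: val_inj; rewrite lv !graft_triE lv ?lT.1 ?lT.2.
- move=> x y z; apply: val_inj; rewrite (linD lv).
  exact: derivation_comm (lT.2 _) (graftT_PSL_M x).
- move=> x y z; apply: val_inj; rewrite !(linB lv).
  rewrite graft_triE val_PSL_lie (linB (lT.1 _)).
  by congr (_ - _); exact: graftT_PSL_l.
Qed.

Lemma graft_tri_tree s t :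
  graft_tri (PSL_tree k s) (PSL_tree k t) = graft k s t.
Proof.
apply: val_inj; rewrite graft_triE graftT_word sum_forest_grafts1 sum_graft_tree.
by rewrite /graft (lin_sum (@lieGen_val_lin _ _ _)).
Qed.

End TreeGrafting.

Global Opaque graftT graftGL deshuffle.

Local Opaque word.

(** * Uniqueness of the grafting product and of its extension to forests *)

Section TreeUniqueness.
Variables (k : fieldType) (A : finType).
Local Notation tree := (tree A).
Local Notation forest := (seq tree).
Local Notation OF := (freeAlg k tree).
Local Notation PSL := (PSL k A).
Local Notation pvf := (val : PSL -> OF).
Local Notation pv x := (val (x : PSL) : OF).
Local Notation leaf t := (word k [:: t] : OF).
Local Notation bl := (@bracket_length k A).
Local Notation tri0 := (@graft_tri k A).
Implicit Types (t u s : tree) (f g h ts : forest).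

Lemma lie_anti (L : lieAlgType k) (x y : L) : lie x y = - lie y x.
Proof.
have := liexx (x + y); rewrite (linD (lie_bilin.1 _)) !(linD (lie_bilin.2 _)).
by rewrite !liexx add0r addr0 => /eqP; rewrite addr_eq0 => /eqP.
Qed.

Lemma lie_bracketl (L : lieAlgType k) (x y z : L) :
  lie (lie x y) z = lie x (lie y z) - lie y (lie x z).
Proof.
rewrite [LHS]lie_anti [lie x z]lie_anti (linN (lie_bilin.2 _)) opprK.
by apply/eqP; rewrite eq_sym -addr_eq0 lie_jacobi.
Qed.

(** The Jacobi identity makes a left-nested bracket right-nested, and both of its terms have the
    same number of trees. *)
Lemma bracket_length_lie n m x y : bl n x -> bl m y -> bl (n + m).+1 (lie x y).
Proof.
move=> bx; elim: bx m y => {n x} [t|n t x _ IH|n|n a x x' _ IH _ IH'] m y by_.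
- exact: BLlie.
- rewrite lie_bracketl addrC -scaleN1r; apply: BLD.
    by rewrite addSnnS; apply: IH; exact: BLlie.
  by apply: BLlie; exact: IH.
- by rewrite (lin0 (lie_bilin.1 _)); exact: BL0.
- by rewrite (lie_bilin.1 _); apply: BLD; [exact: IH|exact: IH'].
Qed.

(** The sum of the spaces of elements of given bracket length, encoded impredicatively. *)
Definition bracket_span (x : PSL) := forall P : PSL -> Prop,
  (forall n y, bl n y -> P y) -> P 0 ->
  (forall a y z, P y -> P z -> P (a *: y + z)) -> P x.

Lemma bracket_spanT x : bracket_span x.
Proof.
have sD a y z : bracket_span y -> bracket_span z -> bracket_span (a *: y + z).
  by move=> hy hz P Pb P0 PD; apply: (PD); [exact: (hy P)|exact: (hz P)].
have s0 : bracket_span 0 by move=> P _ P0 _.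
elim/PSL_ind: x => [t P Pb _ _||a y z hy hz|y z hy hz]; [|exact: s0|exact: sD|].
  by apply: Pb; exact: BLtree.
apply: (hy (fun y => bracket_span (lie y z))) => [n v bly||a v v' hv hv'].
  apply: (hz (fun z => bracket_span (lie v z))) => [m w bz||a w w' hw hw'].
- by move=> P Pb _ _; apply: Pb; exact: bracket_length_lie bly bz.
- by rewrite (lin0 (lie_bilin.2 v)).
- by rewrite (lie_bilin.2 v); exact: sD.
- by rewrite (lin0 (lie_bilin.1 _)).
- by rewrite (lie_bilin.1 _); exact: sD.
Qed.

Lemma graft_tri_lenl x t : bl 0 (tri0 x (PSL_tree k t)).
Proof.
have [z bz e] := graftT_tree (pv x) t; suff -> : tri0 x (PSL_tree k t) = z by [].
by apply: val_inj; rewrite graft_triE.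
Qed.

Lemma graft_tri_len x n y : bl n y -> bl n (tri0 x y).
Proof.
have [hB hD _] := @graft_tri_post_lie k A.
elim=> {n y} [t|n t y bly IH|n|n a y y' _ IH _ IH'].
- exact: graft_tri_lenl.
- rewrite hD -[lie (tri0 _ _) _]scale1r; apply: BLD; last exact: BLlie.
  by rewrite -[n]add0n; apply: bracket_length_lie => //; exact: graft_tri_lenl.
- by rewrite (lin0 (hB.2 _)); exact: BL0.
- by rewrite (hB.2 _); exact: BLD.
Qed.

Lemma derivation_eq (d d' : PSL -> PSL) : linear d -> linear d' ->
  (forall y z, d (lie y z) = lie (d y) z + lie y (d z)) ->
  (forall y z, d' (lie y z) = lie (d' y) z + lie y (d' z)) ->
  (forall t, d (PSL_tree k t) = d' (PSL_tree k t)) -> d =1 d'.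
Proof.
move=> ld ld' dL dL' dt; elim/PSL_ind => [//||a x y hx hy|x y hx hy].
- by rewrite !lin0.
- by rewrite ld ld' hx hy.
- by rewrite dL dL' hx hy.
Qed.

Lemma graft_tri_unique (tri : PSL -> PSL -> PSL) : post_lie tri ->
  (forall s t, tri (PSL_tree k s) (PSL_tree k t) = graft k s t) ->
  forall x y, tri x y = tri0 x y.
Proof.
move=> [hB hD hA] ht; have [hB0 hD0 hA0] := @graft_tri_post_lie k A.
have e_tree s y : tri (PSL_tree k s) y = tri0 (PSL_tree k s) y.
  move: y; apply: derivation_eq => //; [exact: hB.2|exact: hB0.2|].
  by move=> t; rewrite ht graft_tri_tree.
(* The induction on the bound N encloses the one on [bracket_length]: linear combinations keep n,
   while a bracket appeals to other elements of smaller length. *)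
have e_len N : forall n x, (n <= N)%N -> bl n x -> forall w, tri x w = tri0 x w.
  elim: N => [|N IH] n x nN bx; elim: bx nN => {n x} //;
    try (by move=> *; rewrite (lin0 (hB.1 _)) (lin0 (hB0.1 _)));
    try (by move=> n a x y _ Hx _ Hy nN w; rewrite (hB.1 _) (hB0.1 _) Hx ?Hy).
  move=> n t y bly _ nN w.
  (* The left arguments produced by the axiom are t, y and t > y, the last two of length n, and y >
     t of length 0. *)
  rewrite hA hA0 !e_tree (IH n y) // (IH n y) //.
  rewrite (IH n (tri0 (PSL_tree k t) y)) //; last exact: graft_tri_len.
  rewrite (IH n y nN bly (PSL_tree k t)).
  by rewrite (IH 0%N (tri0 y (PSL_tree k t))) //; exact: graft_tri_lenl.
move=> x; apply: (bracket_spanT x (P := fun x => forall w, tri x w = tri0 x w))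
  => [n y bly||a y z hy hz] w.
- exact: (e_len n n).
- by rewrite (lin0 (hB.1 _)) (lin0 (hB0.1 _)).
- by rewrite (hB.1 _) (hB0.1 _) hy hz.
Qed.

Lemma PSL_triE : @PSL_tri k A = tri0.
Proof.
apply: the_eq => [|tri [hp ht]].
  by split; [exact: graft_tri_post_lie|exact: graft_tri_tree].
by apply: funext => x; apply: funext => y; exact: graft_tri_unique.
Qed.

Lemma graftT_spec : env_tri_spec tri0 pvf (@graftT k A).
Proof.
split; [exact: graftT_bilin|by []|exact: graftT1| |].
- by move=> x X y; rewrite graftT_PSL_l.
- by move=> X Y Z; rewrite env_comul_OF graftTM.
Qed.

Lemma ssum_proper (V : nmodType) f (F : forest -> forest -> V) : f != [::] ->
  (forall a b, (size a < size f)%N -> a != [::] -> F a b = 0) ->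
  ssum f F = F f [::] + F [::] f.
Proof.
move=> nf h; rewrite addrC.
rewrite -(ssum_unitl f (F [::])) -(ssum_unitr f (F^~ [::])) -ssumD.
rewrite /ssum !big_seq; apply: eq_bigr => -[a b] /size_splits /= sz.
case: a b sz => [|x a] [|y b] //= sz; rewrite ?add0r ?addr0 //.
- by move: nf; rewrite -size_eq0 -sz.
- by rewrite h //= -sz; lia.
Qed.

Section EnvTri.
Variable T : OF -> OF -> OF.
Hypothesis hT : env_tri_spec tri0 pvf T.

Let T_bilin : bilin T. Proof. by case: hT. Qed.

Lemma env_tri_OF_M f Y Z : T (word k f) (Y * Z) =
  ssum f (fun a b => T (word k a) Y * T (word k b) Z).
Proof.
have [_ _ _ _ ->] := hT; rewrite env_comul_OF lift_deshuffle ?free_ext_word //.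
exact: bilin_comp (mul_bilin OF) (T_bilin.1 _) (T_bilin.1 _).
Qed.

(** The specification does not give T X 1 directly. Writing 1 as 1 * 1, the proper splits vanish by
    induction and T f 1 = T f 1 + T f 1 remains. *)
Lemma env_tri_OF_1 f : f != [::] -> T (word k f) 1 = 0.
Proof.
have [_ _ T1 _ _] := hT.
have [n] := ubnP (size f); elim: n f => // n IH f lt_f nf.
have := env_tri_OF_M f 1 1; rewrite mulr1 ssum_proper //.
  rewrite word_nil T1 mul1r mulr1 => /eqP.
  by rewrite -subr_eq subrr eq_sym => /eqP.
by move=> a b la na; rewrite IH ?mul0r //; exact: leq_trans la _.
Qed.

Lemma env_tri_OF_tree s X : T (leaf s) X = graftT (leaf s) X.
Proof.
have [_ Tt T1 _ _] := hT; elim/tree_word_ind: X => [|t X IH||a X Y IX IY].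
- by rewrite env_tri_OF_1 // -word_nil graftT_word sum_forest_grafts_nil.
- rewrite env_tri_OF_M ssum1 word_nil !T1 IH.
  have -> : T (leaf s) (leaf t) = graftT (leaf s) (leaf t).
    exact: Tt (PSL_tree k s) (PSL_tree k t).
  exact: esym (graftT_PSL_M (PSL_tree k s) (leaf t) X).
- by rewrite (lin0 (T_bilin.2 _)) (lin0 ((@graftT_bilin _ _).2 _)).
- by rewrite (T_bilin.2 _) ((@graftT_bilin _ _).2 _) IX IY.
Qed.

Lemma size_forest_grafts ts f h : h \in forest_grafts ts f -> size h = size ts.
Proof.
elim: ts f h => [|t ts IH] f h; first by case: f => [|? ?] //; rewrite inE => /eqP->.
by case/flattenP => s /mapP[p _ ->] /allpairsP[q [_ /IH e ->]] /=; rewrite e.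
Qed.

(** The relation for [s :: f] involves the forests of s > f, which have as many trees as f without
    being subterms; hence the induction on the number of trees. *)
Lemma env_tri_OF_wtree f t : T (word k f) (leaf t) = graftT (word k f) (leaf t).
Proof.
have [_ _ T1 Tr _] := hT; have [_ _ T1' Tr' _] := graftT_spec.
have lT := @graftT_bilin k A.
move: {2}(size f) (erefl (size f)) => n; elim: n f t => [|n IH] f t.
  by move/eqP; rewrite size_eq0 => /eqP ->; rewrite word_nil T1 T1'.
case: f => [//|s f] /eq_add_S sz.
have -> : T (word k (s :: f)) (leaf t) =
    T (leaf s) (T (word k f) (leaf t)) - T (T (leaf s) (word k f)) (leaf t).
  by rewrite word_cons; exact: Tr (PSL_tree k s) (word k f) (PSL_tree k t).
have -> : graftT (word k (s :: f)) (leaf t) =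
    graftT (leaf s) (graftT (word k f) (leaf t)) -
    graftT (graftT (leaf s) (word k f)) (leaf t).
  by rewrite word_cons; exact: Tr' (PSL_tree k s) (word k f) (PSL_tree k t).
rewrite (IH f t sz) (env_tri_OF_tree s (word k f)) (env_tri_OF_tree s (graftT _ _)).
congr (_ - _).
rewrite graftT_word (lin_sum (T_bilin.1 _)) (lin_sum (lT.1 _)) !big_seq.
by apply: eq_bigr => h /size_forest_grafts sh; apply: IH; rewrite sh; exact: sz.
Qed.

Lemma env_tri_OF_word f g : T (word k f) (word k g) = graftT (word k f) (word k g).
Proof.
elim: g f => [|t g IH] f.
  rewrite word_nil -{2}word_nil graftT_word sum_forest_grafts_nil.
  case: f => [|s f]; last exact: env_tri_OF_1.
  by have [_ _ T1 _ _] := hT; rewrite word_nil T1.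
rewrite word_cons env_tri_OF_M graftTM deshuffle_word lift_ssum; last first.
  have lT := @graftT_bilin k A.
  exact: bilin_comp (mul_bilin OF) (lT.1 _) (lT.1 _).
by apply: eq_ssum => a b; rewrite env_tri_OF_wtree IH.
Qed.

Lemma env_tri_OF_unique X Y : T X Y = graftT X Y.
Proof.
apply: free_bilin_eq => //; first exact: graftT_bilin.
exact: env_tri_OF_word.
Qed.

End EnvTri.

Lemma env_tri_OF : env_tri (@PSL_tri k A) pvf = @graftT k A.
Proof.
rewrite PSL_triE; apply: the_eq; first exact: graftT_spec.
by move=> T hT; apply: funext => X; apply: funext => Y; exact: env_tri_OF_unique.
Qed.

Lemma grossman_larson_OF X Y : grossman_larson (@PSL_tri k A) pvf X Y = graftGL X Y.
Proof. by rewrite /grossman_larson env_tri_OF env_comul_OF graftGL_E. Qed.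

Definition tree_counit (X : OF) : k^o := X@_(FMonom [::]).

Lemma tree_counit_spec : env_counit_spec pvf tree_counit.
Proof.
have lc : linear tree_counit := @coeff_lin k _ [::].
have c1 : tree_counit 1 = 1 by rewrite -word_nil /tree_counit coeff_word.
have cM X Y : tree_counit (X * Y) = tree_counit X * tree_counit Y.
  move: X Y; apply: free_bilin_eq.
  - exact: lin_bilin lc (mul_bilin OF).
  - exact: (bilin_comp (mul_bilin k^o) lc lc).
  - move=> f g; rewrite -word_cat /tree_counit !coeff_word.
    by case: f g => [|? ?] [|? ?]; rewrite ?mulr0 ?mul0r ?mulr1.
split=> //; elim/PSL_ind => [t||a x y hx hy|x y hx hy].
- by rewrite /tree_counit coeff_word.
- by rewrite (lin0 lc).
- by rewrite lieGen_val_lin lc hx hy scaler0 addr0.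
- exact: character_comm lc cM hx.
Qed.

Lemma env_counit_OF : env_counit pvf = tree_counit.
Proof. exact (env_counitE (@PSL_generates k A) tree_counit_spec). Qed.

End TreeUniqueness.

(** * The fertility isomorphism *)

Local Opaque word.

(** * Transport of the Guin-Oudom structure along an isomorphism *)

Section Transport.
Variables (k : fieldType) (L L' : lieAlgType k) (U U' : algType k).
Variables (i : L -> U) (i' : L' -> U') (F : U -> U') (G : U' -> U).
Variables (phi : L -> L') (psi : L' -> L).
Hypotheses (lF : linear F) (F1 : F 1 = 1) (FM : {morph F : x y / x * y}).
Hypotheses (FK : cancel F G) (GK : cancel G F) (psiK : cancel psi phi).
Hypothesis Fi : forall x, F (i x) = i' (phi x).

Lemma inverse_lin : linear G.
Proof. by move=> a x y; apply: (can_inj FK); rewrite lF !GK. Qed.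

Lemma inverseM : {morph G : x y / x * y}.
Proof. by move=> x y; apply: (can_inj FK); rewrite FM !GK. Qed.

Lemma inverse1 : G 1 = 1. Proof. by rewrite -F1 FK. Qed.

Lemma inverse_inj y : G (i' y) = i (psi y).
Proof. by rewrite -[y in LHS]psiK -Fi FK. Qed.

Lemma tens_map_mul s t :
  tens_map F F (tens_mul s t) = tens_mul (tens_map F F s) (tens_map F F t).
Proof.
have lFF := tens_map_lin lF lF.
have hM := tens_mul_bilin U; have hM' := tens_mul_bilin U'.
elim/tens_ind: s => [|s s' IH IH'|a b].
- by rewrite (lin0 (hM.1 _)) !(lin0 lFF) (lin0 (hM'.1 _)).
- by rewrite (linD (hM.1 _)) !(linD lFF) (linD (hM'.1 _)) IH IH'.
elim/tens_ind: t => [|t t' IH IH'|c d].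
- by rewrite (lin0 (hM.2 _)) !(lin0 lFF) (lin0 (hM'.2 _)).
- by rewrite (linD (hM.2 _)) !(linD lFF) (linD (hM'.2 _)) IH IH'.
by rewrite tens_mul_pure !tens_map_pure // tens_mul_pure !FM.
Qed.

Lemma transport_comul D : env_comul_spec i D ->
  env_comul_spec i' (fun Y => tens_map F F (D (G Y))).
Proof.
move=> [lD D1 DM Di]; have lFF := tens_map_lin lF lF; split.
- exact: lin_comp (lin_comp lFF lD) inverse_lin.
- by rewrite inverse1 D1 tens_map_pure // F1.
- by move=> X Y; rewrite inverseM DM tens_map_mul.
- by move=> x; rewrite inverse_inj Di (linD lFF) !tens_map_pure // F1 Fi psiK.
Qed.

Lemma transport_counit e : env_counit_spec i e ->
  env_counit_spec i' (fun Y => e (G Y)).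
Proof.
move=> [le e1 eM ei]; split.
- exact: lin_comp le inverse_lin.
- by rewrite inverse1.
- by move=> X Y; rewrite inverseM eM.
- by move=> x; rewrite inverse_inj ei.
Qed.

Variables (tri : L -> L -> L) (tri' : L' -> L' -> L').
Hypothesis phi_tri : forall x y, phi (tri x y) = tri' (phi x) (phi y).

(** The specification of the product mentions the coproduct, whose transport is therefore an
    assumption here. *)
Lemma transport_tri T :
  (forall Y, env_comul i' Y = tens_map F F (env_comul i (G Y))) ->
  env_tri_spec tri i T ->
  env_tri_spec tri' i' (fun X Y => F (T (G X) (G Y))).
Proof.
move=> hD [hB Ti T1 Tl TM]; have lG := inverse_lin.
have hB' : bilin (fun X Y => F (T (G X) (G Y))).
  exact: lin_bilin lF (bilin_comp hB lG lG).
split=> //.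
- by move=> x y; rewrite !inverse_inj Ti Fi phi_tri !psiK.
- by move=> X; rewrite inverse1 T1 GK.
- by move=> x X y; rewrite !FK inverseM !inverse_inj Tl (linB lF).
move=> X Y Z; rewrite inverseM TM hD tens_lift_map //; last first.
  exact: bilin_comp (mul_bilin U') (hB'.1 _) (hB'.1 _).
rewrite (lin_tens_lift _ _ lF); apply: eq_tens_lift => a b.
by rewrite FM !FK.
Qed.

Lemma transport_grossman_larson X Y :
  bilin (env_tri tri i) ->
  (forall Y, env_comul i' Y = tens_map F F (env_comul i (G Y))) ->
  (forall X Y, env_tri tri' i' X Y = F (env_tri tri i (G X) (G Y))) ->
  grossman_larson tri' i' (F X) (F Y) = F (grossman_larson tri i X Y).
Proof.
move=> hB hD hT; have lG := inverse_lin.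
rewrite /grossman_larson hD FK tens_lift_map //; last first.
  apply: (bilin_comp (mul_bilin U') (@id_lin _ _)) => a x y.
  by rewrite !hT lG hB.1 lF.
rewrite (lin_tens_lift _ _ lF); apply: eq_tens_lift => a b.
by rewrite hT !FK FM.
Qed.

End Transport.

(** * The isomorphism from PSL(A) to g(A) and its extension *)

Section Fertility.
Variables (k : fieldType) (A : finType).
Local Notation tree := (tree A).
Local Notation forest := (seq tree).
Local Notation OF := (freeAlg k tree).
Local Notation PSL := (PSL k A).
Local Notation gP := (gPLOT k A).
Local Notation LA := (freeAlg k (letter A)).
Local Notation pv x := (val (x : PSL) : OF).
Local Notation leaf t := (word k [:: t] : OF).
Local Notation tri0 := (@graft_tri k A).
Implicit Types (t u s : tree) (f g h ts : forest).

Definition fertW : OF -> LA := alg_ext (fun t => word k (fer_word t)).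

Lemma fertW_lin : linear fertW. Proof. exact: alg_ext_lin. Qed.
Lemma fertWM : {morph fertW : x y / x * y}. Proof. exact: alg_extM. Qed.

Lemma fertW_word f : fertW (word k f) = word k (fer_words f).
Proof.
rewrite /fertW alg_ext_word; elim: f => [|t f IH]; first by rewrite big_nil word_nil.
by rewrite big_cons IH -word_cat.
Qed.

(** Distinct forests have distinct codes, so coordinates are preserved. Besides injectivity this
    later compares the gradings. *)
Lemma coeff_fertW X f : (fertW X)@_(FMonom (fer_words f)) = X@_(FMonom f).
Proof.
move: X; apply: (@free_lin_ext _ _ k^o
  (fun X => (fertW X)@_(FMonom (fer_words f))) (fun X => X@_(FMonom f))).
- exact: lin_comp (@coeff_lin _ _ _) fertW_lin.
- exact: coeff_lin.
by move=> g; rewrite fertW_word !coeff_word (inj_eq (@fer_words_inj A)).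
Qed.

Lemma fertW_inj : injective fertW.
Proof.
by move=> X Y e; apply: freeAlg_eq => f; rewrite -!coeff_fertW e.
Qed.

Lemma fertW_tree_V t : V_span (word k (fer_word t) : LA).
Proof.
by move=> m; rewrite msuppU1 inE => /eqP ->; exact: in_V_fer_word.
Qed.

Lemma fertW_PSL (x : PSL) : fertW (pv x) \in lie_hull (@V_span k A).
Proof.
elim/PSL_ind: x => [t||a x y hx hy|x y hx hy].
- rewrite fertW_word /fer_words /= cats0; apply: lie_hull_gen.
  exact: fertW_tree_V.
- by rewrite (lin0 fertW_lin); exact: (valP (0 : gP)).
- rewrite lieGen_val_lin fertW_lin.
  exact: (valP (a *: (LieGen hx : gP) + LieGen hy)).
rewrite val_PSL_lie (linB fertW_lin).
rewrite [X in X - _](fertWM (pv x) (pv y)) [X in _ - X](fertWM (pv y) (pv x)).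
exact: lie_hull_comm hx hy.
Qed.

Definition fert (x : PSL) : gP := LieGen (fertW_PSL x).

Lemma fertE x : val (fert x) = fertW (pv x). Proof. by []. Qed.

Lemma fert_lie : lie_morphism fert.
Proof.
split=> [a x y|x y]; apply: val_inj.
  by rewrite lieGen_val_lin !fertE lieGen_val_lin fertW_lin.
rewrite fertE val_PSL_lie (linB fertW_lin).
by congr (_ - _); exact: fertWM.
Qed.

Lemma fer_tree_val t : val (fer_tree k t) = word k (fer_word t).
Proof. by rewrite /fer_tree insubdK //; apply: lie_hull_gen; exact: fertW_tree_V. Qed.

Lemma fert_tree t : fert (PSL_tree k t) = fer_tree k t.
Proof.
by apply: val_inj; rewrite fer_tree_val fertE fertW_word /fer_words /= cats0.
Qed.

Lemma fer_lieE : @fer_lie k A = fert.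
Proof.
apply: the_eq => [|f [[lf fL] ft]]; first by split; [exact: fert_lie|exact: fert_tree].
have [lg gL] := fert_lie; apply: funext; elim/PSL_ind => [t||a x y hx hy|x y hx hy].
- by rewrite ft fert_tree.
- by rewrite !lin0.
- by rewrite lf lg hx hy.
- by rewrite fL gL hx hy.
Qed.

Lemma fert_inj : injective fert.
Proof. by move=> x y /(congr1 val); rewrite !fertE => /fertW_inj /val_inj. Qed.

Lemma fert_surj y : exists x, fert x = y.
Proof.
have [lg gL] := fert_lie.
elim/lieGen_ind: y => [b Vb||a _ _ [x <-] [y <-]|_ _ [x <-] [y <-]].
- suff [x ex] : exists x, fertW (pv x) = \sum_(w <- msupp b) b@_w *: word k w.
    by exists x; apply: val_inj; rewrite fertE ex -freeAlgE.
  (* Only words of the support are known to lie in V(A), so the induction runs over a list contained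
     in it. *)
  have : {subset (msupp b : seq _) <= msupp b} by [].
  elim: {1 2}(msupp b : seq _) => [_|w s IH ss].
    by exists 0; rewrite big_nil (lin0 fertW_lin).
  have [m ms|x ex] := IH; first by apply: ss; rewrite inE ms orbT.
  have /in_V_ex[t et] : in_V w by apply: Vb; apply: ss; rewrite inE eqxx.
  exists (b@_w *: PSL_tree k t + x).
  have ew : fertW (pv (PSL_tree k t)) = word k w.
    by rewrite -et -[fer_word t]cats0; exact: fertW_word [:: t].
  by rewrite lieGen_val_lin fertW_lin ex big_cons ew.
- by exists 0; rewrite (lin0 lg).
- by exists (a *: x + y); exact: lg.
- by exists (lie x y); exact: gL.
Qed.

Definition fert_inv (y : gP) : PSL := sval (cid (fert_surj y)).

Lemma fert_invK : cancel fert_inv fert.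
Proof. by move=> y; exact: svalP (cid (fert_surj y)). Qed.

Lemma fertK : cancel fert fert_inv.
Proof. by move=> x; apply: fert_inj; rewrite fert_invK. Qed.

Lemma fert_inv_lie : lie_morphism fert_inv.
Proof.
have [lg gL] := fert_lie.
by split=> [a x y|x y]; apply: fert_inj; rewrite ?lg ?gL !fert_invK.
Qed.

Definition insertS : OF -> OF -> OF :=
  free_bilin_ext (fun f g => \sum_(h <- insert_in f g) word k h).

Lemma insertS_bilin : bilin insertS. Proof. exact: free_bilin_ext_bilin. Qed.

Lemma tri_word_fert X Y :
  free_bilin_ext (@tri_word k A) (fertW X) (fertW Y) = fertW (insertS X Y).
Proof.
move: X Y; apply: free_bilin_eq.
- exact: bilin_comp (free_bilin_ext_bilin _) fertW_lin fertW_lin.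
- exact: lin_bilin fertW_lin insertS_bilin.
move=> f g; rewrite !fertW_word free_bilin_ext_word /insertS free_bilin_ext_word.
rewrite tri_wordE absz_wt_fer_words -fer_words_insert big_map (lin_sum fertW_lin).
by apply: eq_bigr => h _; rewrite fertW_word.
Qed.

Section Primitive.
Variables (V : lmodType k) (x : PSL).

(** Primitivity of x, made applicable to an arbitrary function of two forests by extending it
    bilinearly. *)
Lemma free_ext_primitive (G : forest -> forest -> V) :
  free_ext (fun f => ssum f G) (pv x) =
  free_ext (G^~ [::]) (pv x) + free_ext (G [::]) (pv x).
Proof.
have hB := free_bilin_ext_bilin G.
transitivity (free_ext (fun f => ssum f (fun a b =>
    free_bilin_ext G (word k a : OF) (word k b : OF))) (pv x)).
  by apply: eq_free_ext => f; apply: eq_ssum => a b; rewrite free_bilin_ext_word.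
rewrite (ssum_PSL _ hB) -word_nil /free_bilin_ext free_ext_word; congr (_ + _).
by apply: eq_free_ext => f; rewrite free_ext_word.
Qed.

Lemma free_ext_counit (c : V) :
  free_ext (fun f => if f is [::] then c else 0) (pv x) = 0.
Proof.
have [lc _ _ cx] := @tree_counit_spec k A.
transitivity (tree_counit (pv x) *: c); last first.
  by rewrite [tree_counit _]cx scale0r.
move: (pv x); apply: free_lin_ext.
- exact: free_ext_lin.
- exact: (scale_lin c lc).
by move=> [|t f]; rewrite free_ext_word /tree_counit coeff_word /= ?scale1r ?scale0r.
Qed.

Lemma free_extD (F G : forest -> V) X :
  free_ext (fun f => F f + G f) X = free_ext F X + free_ext G X :> V.
Proof.
by rewrite /free_ext -big_split; apply: eq_bigr => w _; rewrite scalerDr.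
Qed.
End Primitive.

(* On a primitive x the trees of each forest stay together, so that grafting
   reduces to one insertion. *)
Lemma graft_insert (x : PSL) (V : lmodType k) :
  (forall t (F : tree -> V),
     free_ext (fun f => \sum_(u <- grafts t f) F u) (pv x) =
     free_ext (fun f => \sum_(u <- insert_at f t) F u) (pv x)) /\
  (forall ts (F : forest -> V),
     free_ext (fun f => \sum_(h <- forest_grafts ts f) F h) (pv x) =
     free_ext (fun f => \sum_(h <- insert_in f ts) F h) (pv x)).
Proof.
apply: tree_forest_ind => [a ts IH F|F|t ts IHt IHs F].
- transitivity (free_ext (fun f => F (Node a (f ++ ts)) +
     \sum_(h <- insert_in f ts) F (Node a h)) (pv x)); last first.
    by apply: eq_free_ext => f; rewrite sum_insert_at.
  rewrite free_extD -(IH (fun h => F (Node a h))).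
  transitivity (free_ext (fun f => ssum f (fun f1 f2 =>
      \sum_(h <- forest_grafts ts f2) F (Node a (f1 ++ h)))) (pv x)).
    by apply: eq_free_ext => f; rewrite sum_grafts sum_gl_forests.
  rewrite free_ext_primitive; congr (_ + _).
  by apply: eq_free_ext => f; rewrite sum_forest_grafts_nilr.
- transitivity (free_ext (fun f : forest => if f is [::] then F [::] else 0) (pv x)).
    by apply: eq_free_ext => f; rewrite sum_forest_grafts_nil.
  rewrite free_ext_counit; transitivity (free_ext (fun f : forest => 0 : V) (pv x)).
    by rewrite /free_ext big1 // => w _; rewrite scaler0.
  by apply: eq_free_ext => f; rewrite big_nil.
- transitivity (free_ext (fun f => \sum_(u <- insert_at f t) F (u :: ts) +
     \sum_(h <- insert_in f ts) F (t :: h)) (pv x)); last first.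
    by apply: eq_free_ext => f; rewrite sum_insert_in.
  rewrite free_extD -(IHt (fun u => F (u :: ts))) -(IHs (fun h => F (t :: h))).
  transitivity (free_ext (fun f => ssum f (fun f1 f2 =>
      \sum_(u <- grafts t f1) \sum_(h <- forest_grafts ts f2) F (u :: h))) (pv x)).
    by apply: eq_free_ext => f; rewrite sum_forest_grafts_cons.
  rewrite free_ext_primitive; congr (_ + _); apply: eq_free_ext => f.
    by apply: eq_bigr => u _; rewrite sum_forest_grafts_nilr.
  by rewrite sum_grafts_nil.
Qed.

Lemma graftT_insertS (x : PSL) Y : graftT (pv x) Y = insertS (pv x) Y.
Proof.
move: Y; apply: free_lin_ext.
- exact: (@graftT_bilin k A).2.
- exact: insertS_bilin.2.
move=> g; rewrite (free_extE (pv x) ((@graftT_bilin k A).1 (word k g))).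
rewrite [RHS](free_extE (pv x) (insertS_bilin.1 (word k g))).
transitivity (free_ext (fun f => \sum_(h <- forest_grafts g f) (word k h : OF)) (pv x)).
  by apply: eq_free_ext => f; exact: graftT_word.
rewrite (graft_insert x _).2; apply: eq_free_ext => f.
by rewrite /insertS free_bilin_ext_word.
Qed.

(** The default of [insubd] in [gPLOT_tri] never occurs: the product of words is the image under
    [fertW] of an element of PSL(A). *)
Lemma fert_tri x y : fert (tri0 x y) = gPLOT_tri (fert x) (fert y).
Proof.
apply: val_inj; rewrite /gPLOT_tri !fertE tri_word_fert -graftT_insertS.
by rewrite insubdK //; exact: (fertW_PSL (tri0 x y)).
Qed.

Definition ferU : OF -> env gP := alg_ext (fun t => env_inj (fer_tree k t)).

Lemma ferU_lin : linear ferU. Proof. exact: alg_ext_lin. Qed.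
Lemma ferUM : {morph ferU : x y / x * y}. Proof. exact: alg_extM. Qed.
Lemma ferU1 : ferU 1 = 1. Proof. exact: alg_ext1. Qed.

Lemma ferU_leaf t : ferU (leaf t) = env_inj (fer_tree k t).
Proof. exact: alg_ext_letter. Qed.

Lemma ferU_PSL x : ferU (pv x) = env_inj (fert x).
Proof.
have [li iL] := @env_inj_lie k gP; have [lg gL] := fert_lie.
elim/PSL_ind: x => [t||a x y hx hy|x y hx hy].
- by rewrite fert_tree; exact: ferU_leaf.
- by rewrite (lin0 lg) (lin0 li) (lin0 ferU_lin).
- by rewrite lieGen_val_lin ferU_lin lg li hx hy.
rewrite val_PSL_lie (linB ferU_lin) gL iL -hx -hy.
by congr (_ - _); exact: ferUM.
Qed.

(** The Lie inverse, viewed as a map into the associative algebra of forests, lifts to U(g(A)) by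
    its universal property. *)
Definition ferG : env gP -> OF := env_lift (fun y => pv (fert_inv y)).

Lemma fert_inv_assoc : lie_to_assoc (fun y => pv (fert_inv y)).
Proof.
have [lg gL] := fert_inv_lie; split=> [a x y|x y].
  by rewrite lg lieGen_val_lin.
by rewrite gL val_PSL_lie.
Qed.

Lemma ferG_lin : linear ferG. Proof. exact: env_lift_linear fert_inv_assoc. Qed.
Lemma ferGM : {morph ferG : x y / x * y}. Proof. exact: env_liftM fert_inv_assoc. Qed.
Lemma ferG1 : ferG 1 = 1. Proof. exact: env_lift_one fert_inv_assoc. Qed.
Lemma ferG_inj y : ferG (env_inj y) = pv (fert_inv y).
Proof. exact: env_lift_inj fert_inv_assoc _. Qed.

Lemma ferUK : cancel ferU ferG.
Proof.
elim/tree_word_ind => [|t X IH||a X Y IX IY].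
- by rewrite ferU1 ferG1.
- rewrite ferUM ferGM IH ferU_leaf ferG_inj -fert_tree fertK.
  by [].
- by rewrite (lin0 ferU_lin) (lin0 ferG_lin).
- by rewrite ferU_lin ferG_lin IX IY.
Qed.

Lemma ferGK : cancel ferG ferU.
Proof.
elim/env_elim => [|x X IH||a X Y IX IY].
- by rewrite ferG1 ferU1.
- by rewrite ferGM ferUM IH ferG_inj ferU_PSL fert_invK.
- by rewrite (lin0 ferG_lin) (lin0 ferU_lin).
- by rewrite ferG_lin ferU_lin IX IY.
Qed.

Lemma ferE : @fer k A = ferU.
Proof.
apply: the_eq => [|f [lf f1 fM fi]].
  split; [exact: ferU_lin|exact: ferU1|exact: ferUM|].
  by move=> x; rewrite fer_lieE ferU_PSL.
apply: funext; elim/tree_word_ind => [|t X IH||a X Y IX IY].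
- by rewrite f1 ferU1.
- rewrite fM ferUM IH; congr (_ * _).
  by rewrite ferU_leaf -fert_tree -fer_lieE; exact: fi (PSL_tree k t).
- by rewrite (lin0 ferU_lin) (lin0 lf).
- by rewrite lf ferU_lin IX IY.
Qed.

End Fertility.

Local Opaque word ferU ferG.

Lemma tens_mapK (k : fieldType) (U V U' V' : lmodType k)
    (f : U -> U') (g : V -> V') (f' : U' -> U) (g' : V' -> V) :
  linear f -> linear g -> linear f' -> linear g' ->
  cancel f f' -> cancel g g' -> cancel (tens_map f g) (tens_map f' g').
Proof.
move=> lf lg lf' lg' fK gK; apply: tens_lin_ext => [||u v].
- exact: lin_comp (tens_map_lin lf' lg') (tens_map_lin lf lg).
- exact: id_lin.
- by rewrite !tens_map_pure // fK gK.
Qed.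

(** * The Hopf structure of U(g(A)) read on forests *)

Section FertilityHopf.
Variables (k : fieldType) (A : finType).
Local Notation tree := (tree A).
Local Notation OF := (freeAlg k tree).
Local Notation PSL := (PSL k A).
Local Notation gP := (gPLOT k A).
Local Notation pvf := (val : PSL -> OF).
Local Notation iP := (@env_inj k gP).
Local Notation ferU := (@ferU k A).
Local Notation ferG := (@ferG k A).

Lemma env_comul_ferU :
  env_comul iP = (fun Y => tens_map ferU ferU (deshuffle (ferG Y))).
Proof.
apply: (env_comulE (@env_elim k gP)).
exact (transport_comul (@ferU_lin k A) (@ferU1 k A) (@ferUM k A) (@ferUK k A)
        (@ferGK k A) (@fert_invK k A) (@ferU_PSL k A) (@deshuffle_spec k A)).
Qed.

Lemma env_counit_ferU : env_counit iP = (fun Y => tree_counit (ferG Y)).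
Proof.
apply: (env_counitE (@env_elim k gP)).
exact (transport_counit (@ferU_lin k A) (@ferU1 k A) (@ferUM k A) (@ferUK k A)
        (@ferGK k A) (@fert_invK k A) (@ferU_PSL k A) (@tree_counit_spec k A)).
Qed.

Lemma fert_inv_tri (x y : gP) :
  fert_inv (gPLOT_tri x y) = graft_tri (fert_inv x) (fert_inv y).
Proof. by apply: fert_inj; rewrite fert_tri !fert_invK. Qed.

(** Existence is transported from forests. For uniqueness a solution is transported back by the
    inverse isomorphism, where [env_tri_OF_unique] identifies it. *)
Lemma env_tri_ferU :
  env_tri (@gPLOT_tri k A) iP = (fun X Y => ferU (graftT (ferG X) (ferG Y))).
Proof.
apply: the_eq => [|T hT].
  apply: (transport_tri (@ferU_lin k A) (@ferU1 k A) (@ferUM k A) (@ferUK k A)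
        (@ferGK k A) (@fert_invK k A) (@ferU_PSL k A) (@fert_tri k A) _
        (@graftT_spec k A)) => Y.
  by rewrite env_comul_ferU env_comul_OF.
have hD Y : env_comul pvf Y = tens_map ferG ferG (env_comul iP (ferU Y)).
  rewrite env_comul_ferU env_comul_OF /= ferUK tens_mapK //;
    by [exact: ferU_lin|exact: ferG_lin|exact: ferUK].
have hT2 := transport_tri (@ferG_lin k A) (@ferG1 k A) (@ferGM k A) (@ferGK k A)
        (@ferUK k A) (@fertK k A) (@ferG_inj k A) fert_inv_tri hD hT.
apply: funext => X; apply: funext => Y.
by rewrite -(env_tri_OF_unique hT2) !ferGK.
Qed.

Lemma grossman_larson_ferU X Y :
  grossman_larson (@gPLOT_tri k A) iP (ferU X) (ferU Y) =
  ferU (grossman_larson (@PSL_tri k A) pvf X Y).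
Proof.
apply: (transport_grossman_larson (@ferU_lin k A) (@ferUM k A) (@ferUK k A)
  (@ferGK k A)) => [|Z|Z Z'].
- by rewrite env_tri_OF; exact: graftT_bilin.
- by rewrite env_comul_ferU env_comul_OF.
- by rewrite env_tri_ferU env_tri_OF.
Qed.

Lemma fer_hopf_morphism : hopf_morphism (@fer k A).
Proof.
rewrite ferE; split.
- exact: ferU_lin.
- by move=> X Y; exact: esym (grossman_larson_ferU X Y).
- exact: ferU1.
- move=> X; rewrite /= env_comul_ferU /= ferUK; congr (tens_map _ _ _).
  by rewrite env_comul_OF.
- move=> X; rewrite /= env_counit_ferU /= ferUK.
  by rewrite env_counit_OF.
Qed.

End FertilityHopf.

(** * Left admissible cuts *)

Section Admissible.
Variable A : choiceType.
Local Notation tree := (tree A).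
Local Notation forest := (seq tree).
Implicit Types (t u d : tree) (ts us : forest) (v e l : seq nat).
Implicit Types (c : seq nat -> bool).

Lemma mem_vertices_from d j i v ts :
  (i :: v \in vertices_from j ts) =
  (j <= i < j + size ts)%N && (v \in vertices (nth d ts (i - j))).
Proof.
elim: ts j => [|u us IH] j /=; first by rewrite addn0 ltnNge; case: (j <= i)%N.
rewrite mem_cat IH addnS.
have [->|ne] := eqVneq i j.
  rewrite subnn leqnn ltnn /= orbF ltnS leq_addr /=.
  by apply/mapP/idP => [[w hw [->]] //|hv]; exists v.
have -> : (i :: v \in [seq j :: w | w <- vertices u]) = false.
  by apply/negP => /mapP[w _ [e _]]; rewrite e eqxx in ne.
rewrite ltn_neqAle eq_sym ne /= addSn; case: (leqP j i) => //= le_ji.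
by rewrite subnS -[(i - j)%N in RHS]prednK // subn_gt0 ltn_neqAle eq_sym ne.
Qed.

Lemma nil_vertices_from j ts : [::] \in vertices_from j ts = false.
Proof.
by elim: ts j => //= u us IH j; rewrite mem_cat IH orbF; apply/negP => /mapP[].
Qed.

Lemma edgesE a ts : edges (Node a ts) = vertices_from 0 ts.
Proof. by rewrite /edges verticesE. Qed.

Lemma mem_vertices t v : (v \in vertices t) = (v == [::]) || (v \in edges t).
Proof. by case: t => a ts; rewrite edgesE verticesE inE. Qed.

Lemma nil_edges t : ([::] \in edges t) = false.
Proof. by case: t => a ts; rewrite edgesE nil_vertices_from. Qed.

Lemma mem_edges_cons d a ts i v :
  (i :: v \in edges (Node a ts)) = (i < size ts)%N && (v \in vertices (nth d ts i)).
Proof. by rewrite edgesE (mem_vertices_from d) subn0. Qed.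

Lemma mem_vertices_cons d a ts i v :
  (i :: v \in vertices (Node a ts)) = (i < size ts)%N && (v \in vertices (nth d ts i)).
Proof. by rewrite mem_vertices /= (mem_edges_cons d). Qed.

Definition prefixes l := [seq take n l | n <- iota 1 (size l)].

Lemma prefixes_cons i l : prefixes (i :: l) = [:: i] :: map (cons i) (prefixes l).
Proof.
rewrite /prefixes /= take0 -map_comp; congr (_ :: _).
by rewrite (iotaDl 1 1) -map_comp.
Qed.

Lemma count_prefixes_cons c i l :
  count c (prefixes (i :: l)) = (c [:: i] + count (fun v => c (i :: v)) (prefixes l))%N.
Proof. by rewrite prefixes_cons /= count_map. Qed.

Lemma mem_prefixes v w : v != [::] -> v \in prefixes (v ++ w).
Proof.
move=> nv; apply/mapP; exists (size v); last by rewrite take_size_cat.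
by rewrite mem_iota size_cat; case: v nv => //= *; lia.
Qed.

Lemma nil_prefixes l : [::] \in prefixes l = false.
Proof. by case: l => // i l; rewrite prefixes_cons inE /=; apply/negP => /mapP[]. Qed.

(** With Boolean functions in place of finite sets, restricting a cut to the i-th child is
    composition with [cons i]. *)
Definition cut_admissible t c := [/\ (forall e, c e -> e \in edges t),
  (forall l, l \in vertices t -> children (subtree t l) = [::] ->
     count c (prefixes l) <= 1)%N &
  (forall v, v \in vertices t ->
   forall j, (j < size (children (subtree t v)))%N -> c (rcons v j) ->
   forall j', (j' < j)%N -> c (rcons v j'))].

Lemma left_admissibleP t (c : {fset seq nat}) :
  reflect (cut_admissible t (fun e => e \in c))
    ((c `<=` [fset e in edges t])%fset && left_admissible t c).
Proof.
apply: (iffP andP) => [[/fsubsetP hs /andP[/allP hp /allP hl]]|[hs hp hl]].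
  split=> [e /hs|l lt lc|v /hl/allP hv j lj cj j' lj'].
  - by rewrite in_fset.
  - by apply: hp; rewrite mem_filter lc.
  - have /hv : j \in iota 0 (size (children (subtree t v))) by rewrite mem_iota.
    by rewrite cj => /allP; apply; rewrite mem_iota.
split; first by apply/fsubsetP => e /hs; rewrite in_fset.
apply/andP; split; apply/allP.
  by move=> l; rewrite mem_filter => /andP[/nilP lc lt]; exact: hp.
move=> v vt; apply/allP => j; rewrite mem_iota /= => lj; apply/implyP => cj.
by apply/allP => j'; rewrite mem_iota /= => lj'; exact: hl cj _ lj'.
Qed.

(** The path condition is stated at leaves only; prolonging a vertex to a leaf makes it available at
    every vertex. *)
Lemma ex_leaf t v : v \in vertices t ->
  exists w, v ++ w \in vertices t /\ children (subtree t (v ++ w)) = [::].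
Proof.
have [a ts IH||u us IHu IHus|h _] := @tree_forest_ind A
  (fun t => forall v, v \in vertices t ->
     exists w, v ++ w \in vertices t /\ children (subtree t (v ++ w)) = [::])
  (fun ts => forall d i v, (i < size ts)%N -> v \in vertices (nth d ts i) ->
     exists w, v ++ w \in vertices (nth d ts i) /\
       children (subtree (nth d ts i) (v ++ w)) = [::]).
- move=> [_|i {}v]; last first.
    rewrite (mem_vertices_cons (Node a ts)) => /andP[li /(IH _ _ _ li)[w [vw cw]]].
    by exists w; rewrite cat_cons (mem_vertices_cons (Node a ts)) li.
  case: ts IH => [|u us] IH; first by exists [::].
  have [|w [vw cw]] := IH (Node a (u :: us)) 0%N [::] isT.
    by rewrite mem_vertices.
  by exists (0%N :: w); rewrite (mem_vertices_cons (Node a (u :: us))).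
- by [].
- by move=> d [|i] {}v //=; [move=> _; exact: IHu | rewrite ltnS; exact: IHus].
- exact: h.
Qed.

Definition prefix_cut m n (ok : nat -> (seq nat -> bool) -> Prop) c :=
  [/\ c [::] = false,
      (forall i, (i < m)%N -> forall v, c (i :: v) = (v == [::])),
      (forall i, (m <= i < n)%N -> ok i (fun v => c (i :: v))) &
      (forall i, (n <= i)%N -> forall v, c (i :: v) = false)].

Lemma cut_admissible_nil t c : cut_admissible t c -> c [::] = false.
Proof. by move=> [hs _ _]; apply/negP => /hs; rewrite nil_edges. Qed.

(** Left admissibility makes the cut root edges an initial segment, of length m, and the path
    condition forbids cuts below them. On the other children both conditions are those of the
    child. *)
Lemma cut_admissible_node a ts c :
  cut_admissible (Node a ts) c <->
  exists2 m, (m <= size ts)%N & prefix_cut m (size ts)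
    (fun i => cut_admissible (nth (Node a ts) ts i)) c.
Proof.
set d := Node a ts; split=> [h|[m lm [c0 hm hi hn]]].
  have c0 := cut_admissible_nil h; have [hs hp hl] := h.
  have hn i v : (size ts <= i)%N -> c (i :: v) = false.
    move=> li; apply/negP => /hs; rewrite (mem_edges_cons d) ltnNge li.
    by [].
  (* The first child whose edge is not cut, or [size ts] when all are cut. *)
  pose m := find (fun i => ~~ c [:: i]) (iota 0 (size ts)).
  have lm : (m <= size ts)%N by rewrite -[X in (_ <= X)%N](size_iota 0) find_size.
  have cm i : (i < m)%N -> c [:: i].
    move=> im; have := before_find 0%N im; rewrite nth_iota ?add0n.
      by move/negbFE.
    exact: leq_trans im lm.
  have cm' i : (m <= i)%N -> c [:: i] = false.
    move=> mi; case: (ltnP i (size ts)) => [li|/hn -> //].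
    have hm : has (fun i => ~~ c [:: i]) (iota 0 (size ts)).
      by rewrite has_find size_iota; exact: leq_ltn_trans mi li.
    have := nth_find 0%N hm; rewrite -/m nth_iota ?add0n; last exact: leq_ltn_trans mi li.
    move=> ncm; have [->|ne] := eqVneq i m; first exact/negbTE.
    apply/negP => ci; move/negP: ncm; apply.
    by apply: (hl [::] _ i) => //; rewrite ltn_neqAle eq_sym ne.
  exists m => //; split=> // [i im [|x v]|i /andP[mi li]|i li v]; last exact: hn.
  - exact: cm.
  (* A cut edge below a cut root edge would put two of them on the path to some leaf. *)
  - apply/negP => civ.
    have /andP[li /ex_leaf[w [lw cw]]] :
        (i < size ts)%N && (x :: v \in vertices (nth d ts i)).
      by rewrite -(mem_edges_cons d a); exact: hs.
    have := hp (i :: (x :: v) ++ w); rewrite (mem_vertices_cons d) li lw => /(_ isT cw).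
    rewrite count_prefixes_cons (cm _ im) ltnS leqn0 => /eqP e0.
    suff : has (fun e => c (i :: e)) (prefixes ((x :: v) ++ w)) by rewrite has_count e0.
    by apply/hasP; exists (x :: v) => //; exact: mem_prefixes.
  - split=> [e ce|l lt lc|v vt j lj cj j' lj'].
    + have := hs _ ce; rewrite (mem_edges_cons d) li mem_vertices /=.
      by have [e0|//] := eqVneq e [::]; rewrite e0 cm' in ce.
    + have := hp (i :: l); rewrite (mem_vertices_cons d) li lt => /(_ isT lc).
      by rewrite count_prefixes_cons (cm' _ mi).
    + by apply: (hl (i :: v) _ j) => //; rewrite (mem_vertices_cons d) li.
have c1 i : (m <= i)%N -> c [:: i] = false.
  move=> mi; case: (ltnP i (size ts)) => [li|/hn -> //].
  have h : cut_admissible (nth d ts i) (fun v => c (i :: v)) by apply: hi; rewrite mi.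
  exact: cut_admissible_nil h.
split=> [[|i v]|[|i l]|[|i v] vt].
- by rewrite c0.
- rewrite (mem_edges_cons d); case: (ltnP i m) => im.
    by rewrite hm // (leq_trans im lm) => /eqP->; rewrite mem_vertices.
  case: (ltnP i (size ts)) => li; last by rewrite hn.
  have [|hs _ _] := hi i; first by rewrite im.
  by move=> /hs; rewrite mem_vertices => ->; rewrite orbT.
- by [].
- rewrite (mem_vertices_cons d) => /andP[li lt] lc.
  rewrite count_prefixes_cons; case: (ltnP i m) => im.
    rewrite hm // eqxx [X in (_ + X)%N](_ : _ = 0%N) //.
    apply/eqP; rewrite -leqn0 leqNgt -has_count; apply/hasPn => e.
    by rewrite hm //; apply: contraTneq => ->; rewrite nil_prefixes.
  by rewrite c1 // add0n; have [|_ hp _] := hi i; [rewrite im|exact: hp].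
- move=> j lj cj j' lj'; rewrite /= in lj cj *.
  have jm : (j < m)%N by case: (ltnP j m) => // /c1; rewrite cj.
  by rewrite hm ?eqxx //; exact: ltn_trans lj' jm.
- move: vt; rewrite (mem_vertices_cons d) => /andP[li vt] j lj cj j' lj' /=.
  case: (ltnP i m) => im; first by move: cj; rewrite /= hm //; case: (v).
  by have [|_ _ hl] := hi i; [rewrite im|exact: (hl v vt j)].
Qed.

End Admissible.

Lemma uniq_flatten_map (S T : eqType) (F : S -> seq T) (s : seq S) :
  uniq s -> (forall x, x \in s -> uniq (F x)) ->
  (forall x y z, x \in s -> y \in s -> z \in F x -> z \in F y -> x = y) ->
  uniq (flatten [seq F x | x <- s]).
Proof.
elim: s => //= x s IH /andP[xs us] uF inj.
rewrite cat_uniq uF ?inE ?eqxx //= IH //.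
- rewrite andbT; apply/hasPn => z /flattenP[_ /mapP[y ys ->] zy].
  apply: contra xs => zx.
  by rewrite (inj x y z) ?inE ?eqxx ?ys ?orbT.
- by move=> y ys; apply: uF; rewrite inE ys orbT.
- by move=> y z w ys zs; apply: inj; rewrite inE ?ys ?zs orbT.
Qed.

(** * Recursive enumeration of the left admissible cuts *)

Section CutLists.
Local Open Scope fset_scope.
Implicit Types (c d x : {fset seq nat}) (v e : seq nat).

Definition cons_cut j c : {fset seq nat} := [fset (j :: e) | e in c].
Definition uncons_cut j c : {fset seq nat} :=
  [fset behead e | e in c & ohead e == Some j].
Definition prefix_edges m : {fset seq nat} := [fset [:: i] | i in iota 0 m].

Lemma in_cons_cut j c i v : (i :: v \in cons_cut j c) = (i == j) && (v \in c).
Proof.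
apply/imfsetP/andP => [[e /= ec [-> ->]]|[/eqP -> vc]]; first by rewrite eqxx.
by exists v.
Qed.

Lemma nil_cons_cut j c : ([::] \in cons_cut j c) = false.
Proof. by apply/negP => /imfsetP[]. Qed.

Lemma in_uncons_cut j c v : (v \in uncons_cut j c) = (j :: v \in c).
Proof.
apply/imfsetP/idP => [[e /=]|jv]; last by exists (j :: v); rewrite ?inE /= ?jv /=.
by rewrite inE /= => /andP[]; case: e => //= i w ic /eqP[<-] ->.
Qed.

Lemma in_prefix_edges m v :
  (v \in prefix_edges m) = if v is [:: i] then (i < m)%N else false.
Proof.
apply/imfsetP/idP => [[i /=]|]; first by rewrite mem_iota => im ->.
by case: v => // i [|] // im; exists i; rewrite //= mem_iota.
Qed.

(** Independent choices for consecutive children, the first of which has position j; prefixing the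
    position makes the unions disjoint. *)
Fixpoint product_cuts j (Cs : seq (seq {fset seq nat})) : seq {fset seq nat} :=
  if Cs is C :: Cs' then
    [seq cons_cut j c `|` d | c <- C, d <- product_cuts j.+1 Cs']
  else [:: fset0].

Lemma product_cutsP j Cs d : d \in product_cuts j Cs <->
  [/\ [::] \notin d, (forall i v, (i < j)%N -> i :: v \notin d),
      (forall i v, (j + size Cs <= i)%N -> i :: v \notin d) &
      forall i, (i < size Cs)%N -> uncons_cut (j + i)%N d \in nth [::] Cs i].
Proof.
elim: Cs j d => [|C Cs IH] j d /=.
  rewrite inE; split=> [/eqP ->|[d0 dlt dge _]]; first by split.
  apply/eqP/fsetP => -[|i v]; first by rewrite inE (negbTE d0).
  rewrite inE; apply/negbTE; case: (ltnP i j) => ij; first exact: dlt.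
  by apply: dge; rewrite addn0.
split=> [/allpairsP[[c d'] /= [cC /IH[d0 dlt dge dok] ->]]|[d0 dlt dge dok]].
  split=> [|i v ij|i v ij|[|i] li].
  - by rewrite inE nil_cons_cut.
  - by rewrite inE in_cons_cut (ltn_eqF ij) dlt //; exact: ltnW.
  - have ji : (j < i)%N by apply: leq_trans ij; rewrite addnS ltnS leq_addr.
    by rewrite inE in_cons_cut (gtn_eqF ji) dge // addSnnS.
  - rewrite addn0 /= (_ : uncons_cut j _ = c) //; apply/fsetP => v.
    by rewrite in_uncons_cut inE in_cons_cut eqxx /= (negbTE (dlt _ _ _)) ?orbF.
  - rewrite -addSnnS /= (_ : uncons_cut _ _ = uncons_cut (j.+1 + i)%N d').
      exact: dok.
    apply/fsetP => v; rewrite !in_uncons_cut inE in_cons_cut.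
    by rewrite gtn_eqF //; lia.
apply/allpairsP; exists (uncons_cut j d, [fset e in d | ohead e != Some j]).
split=> /=; first by have := dok 0%N isT; rewrite addn0.
- apply/IH; split=> [|i v|i v ij|i li].
  + by rewrite !inE (negbTE d0).
  + rewrite ltnS leq_eqVlt !inE => /orP[/eqP ->|/dlt/negbTE -> //].
    by rewrite /= eqxx andbF.
  + by rewrite !inE (negbTE (dge _ _ _)) // -addSnnS.
  + rewrite (_ : uncons_cut _ _ = uncons_cut (j + i.+1)%N d); first exact: dok.
    apply/fsetP => v; rewrite !in_uncons_cut !inE /= addSnnS.
    rewrite (_ : _ == _ = false) ?andbT //.
    by apply/negbTE; apply/eqP => -[]; lia.
- apply/fsetP => -[|i v]; first by rewrite !inE (negbTE d0) nil_cons_cut.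
  rewrite !inE in_cons_cut in_uncons_cut /=.
  rewrite (_ : (Some i == Some j) = (i == j)) //.
  by have [->|] := eqVneq i j; rewrite ?andbT ?andbF ?orbF.
Qed.

Lemma uniq_product_cuts j Cs : all uniq Cs -> uniq (product_cuts j Cs).
Proof.
elim: Cs j => //= C Cs IH j /andP[uC uCs].
apply: allpairs_uniq => //; first exact: IH.
move=> _ _ /allpairsP[[c d] /= [_ hd ->]] /allpairsP[[c' d'] /= [_ hd' ->]] /= e.
move: hd hd' => /product_cutsP[d0 dlt _ _] /product_cutsP[d0' dlt' _ _].
have mem_e v : (v \in cons_cut j c `|` d) = (v \in cons_cut j c' `|` d') by rewrite e.
congr (_, _); apply/fsetP => v.
  have := mem_e (j :: v); rewrite !inE !in_cons_cut eqxx /=.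
  by rewrite (negbTE (dlt _ _ _)) // (negbTE (dlt' _ _ _)) // !orbF.
case: v => [|i v]; first by rewrite (negbTE d0) (negbTE d0').
have [->|ne] := eqVneq i j.
  by rewrite (negbTE (dlt _ _ _)) // (negbTE (dlt' _ _ _)).
by have := mem_e (i :: v); rewrite !inE !in_cons_cut (negbTE ne).
Qed.

Variable A : choiceType.
Local Notation tree := (tree A).
Local Notation forest := (seq tree).
Implicit Types (t u : tree) (ts us : forest).

(* The children of the root cut off are the first m ones; the cuts of the
   other children are independent. *)
Fixpoint rec_cuts t : seq {fset seq nat} :=
  let: Node a ts := t in
  flatten [seq [seq prefix_edges m `|` d |
                 d <- product_cuts m (drop m (map rec_cuts ts))]
          | m <- iota 0 (size ts).+1].

Lemma cut_admissible_fset t (c : {fset seq nat}) p :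
  (forall v, (v \in c) = p v) ->
  cut_admissible t (fun v => v \in c) <-> cut_admissible t p.
Proof. by move=> e; have -> : p = (fun v => v \in c) by apply: funext => v. Qed.

Lemma rec_cuts_node a ts x :
  x \in rec_cuts (Node a ts) <->
  exists2 m, (m <= size ts)%N & exists2 d,
    d \in product_cuts m (drop m (map rec_cuts ts)) & x = prefix_edges m `|` d.
Proof.
split=> [/flattenP[_ /mapP[m hm ->] /mapP[d hd ->]]|[m lm [d hd ->]]].
  by exists m; [move: hm; rewrite mem_iota|exists d].
apply/flattenP; exists [seq prefix_edges m `|` d |
    d <- product_cuts m (drop m (map rec_cuts ts))]; last exact: map_f.
by apply/mapP; exists m => //; rewrite mem_iota.
Qed.

Lemma rec_cutsP t c : c \in rec_cuts t <-> cut_admissible t (fun v => v \in c).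
Proof.
have [a ts IH {}c|i d'|u us IHu IHus i d|h _] := @tree_forest_ind A
  (fun t => forall c, c \in rec_cuts t <-> cut_admissible t (fun v => v \in c))
  (fun ts => forall i (d : tree), (i < size ts)%N -> forall c,
     c \in nth [::] (map rec_cuts ts) i <->
     cut_admissible (nth d ts i) (fun v => v \in c)); last exact: h.
- rewrite rec_cuts_node cut_admissible_node; split.
    move=> [m lm [d /product_cutsP[d0 dlt dge dok] ->]]; exists m => //.
    rewrite size_drop size_map subnKC // in dge dok.
    split=> [|i im v|i /andP[mi li]|i li v].
    + by rewrite inE in_prefix_edges (negbTE d0).
    + by rewrite inE in_prefix_edges (negbTE (dlt _ _ im)) orbF; case: v.
    + have /dok : (i - m < size ts - m)%N by lia.
      rewrite nth_drop subnKC // => /(IH _ (Node a ts) li) h.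
      apply: (proj1 (cut_admissible_fset (nth (Node a ts) ts i) _) h) => v.
      rewrite in_uncons_cut inE in_prefix_edges.
      by case: v => //=; rewrite ltnNge mi.
    + rewrite inE in_prefix_edges (negbTE (dge _ _ li)) orbF.
      by case: v => //=; apply/negbTE; rewrite -leqNgt; exact: leq_trans lm li.
  move=> [m lm [c0 hlt hok hge]]; exists m => //.
  (* What is left after the m cut root edges are removed; the default of [head] is harmless since c
     does not contain [[::]]. *)
  exists [fset e in c | (m <= head 0%N e)%N].
    apply/product_cutsP; rewrite size_drop size_map subnKC //.
    split=> [|i v im|i v li|i li].
    + by rewrite !inE c0.
    + by rewrite !inE /= leqNgt im andbF.
    + by rewrite !inE hge.
    + have mi : (m <= m + i < size ts)%N by lia.
      have /andP[_ li'] := mi.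
      rewrite nth_drop; apply/(IH _ (Node a ts) li').
      apply: (proj2 (cut_admissible_fset (nth (Node a ts) ts _) _) (hok _ mi)) => v.
      by rewrite in_uncons_cut !inE /= leq_addr andbT.
  apply/fsetP => -[|i v]; first by rewrite !inE in_prefix_edges c0.
  rewrite !inE in_prefix_edges /=; case: (ltnP i m) => im.
    by rewrite hlt // andbF orbF; case: (v).
  by rewrite andbT; case: (v).
- by [].
- by case: i => [|i] li c' /=; [exact: IHu|exact: IHus].
Qed.

Lemma nil_rec_cuts t c : c \in rec_cuts t -> [::] \notin c.
Proof. by move/rec_cutsP/cut_admissible_nil => /= ->. Qed.

(** A cut of a child never contains the root of that child. Hence m can be read off the whole cut,
    and these children stay in the trunk. *)
Lemma root_edge_product m ts d i : (m <= size ts)%N -> (m <= i)%N ->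
  d \in product_cuts m (drop m (map rec_cuts ts)) -> [:: i] \notin d.
Proof.
move=> lm mi /product_cutsP[_ _ dge dok].
rewrite size_drop size_map subnKC // in dge dok.
case: (ltnP i (size ts)) => li; last exact: dge.
have /dok : (i - m < size ts - m)%N by lia.
rewrite nth_drop subnKC //.
have /mapP[t _ ->] : nth [::] (map rec_cuts ts) i \in map rec_cuts ts.
  by apply: mem_nth; rewrite size_map.
by move=> /nil_rec_cuts; rewrite in_uncons_cut.
Qed.

Lemma uniq_rec_cuts t : uniq (rec_cuts t).
Proof.
have [a ts IH||u us IHu IHus|h _] := @tree_forest_ind A
  (fun t => uniq (rec_cuts t)) (fun ts => all uniq (map rec_cuts ts)); last exact: h.
- apply: uniq_flatten_map; first exact: iota_uniq.
  + move=> m; rewrite mem_iota /= add0n ltnS => lm.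
    rewrite map_inj_in_uniq.
      apply: uniq_product_cuts; apply/allP => C /mem_drop; exact: (allP IH).
    move=> d d' hd hd' /fsetP e; apply/fsetP => v; have := e v; rewrite !inE.
    have ndd : v \in prefix_edges m -> v \notin d /\ v \notin d'.
      rewrite in_prefix_edges; case: v {e} => // i [|] // im.
      move: hd hd' => /product_cutsP[_ dlt _ _] /product_cutsP[_ dlt' _ _].
      by split; [exact: dlt|exact: dlt'].
    by case: (v \in prefix_edges m) ndd => // /(_ isT)[/negbTE -> /negbTE ->].
  + move=> m m' x; rewrite !mem_iota /= !add0n !ltnS => lm lm'.
    move=> /mapP[d hd ->] /mapP[d' hd' /fsetP e].
    apply/eqP; rewrite eqn_leq; apply/andP; split; rewrite leqNgt; apply/negP => lt.
      have := e [:: m']; rewrite !inE !in_prefix_edges lt ltnn /=.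
      by rewrite (negbTE (root_edge_product lm' _ hd')).
    have := e [:: m]; rewrite !inE !in_prefix_edges lt ltnn /=.
    by rewrite (negbTE (root_edge_product lm _ hd)).
- by [].
- by rewrite /= IHu.
Qed.

Lemma left_cuts_perm t : perm_eq (left_cuts t) (rec_cuts t).
Proof.
apply: uniq_perm; [exact/filter_uniq/fset_uniq|exact: uniq_rec_cuts|move=> c].
rewrite mem_filter fpowersetE andbC; apply/left_admissibleP/idP => /rec_cutsP //.
Qed.

End CutLists.

(** * Duality of cuts and grafting *)

Local Opaque word.

Section Shuffle.
Variables (k : fieldType) (A : finType).
Local Notation tree := (tree A).
Local Notation forest := (seq tree).
Local Notation OF := (freeAlg k tree).
Local Notation shuffle := (@shuffle k A).
Local Notation wordF f := (word k f : OF).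
Implicit Types (f g h : forest).

(** Duality of shuffle and deshuffle, by counting: the first tree of h comes either from f or from
    g. *)
Lemma sum_shuffles f g h :
  \sum_(s <- shuffles f g) (s == h)%:R =
  ssum h (fun a b => (f == a)%:R * (g == b)%:R) :> k.
Proof.
elim: h f g => [|z h IH] f g.
  rewrite ssum_nil; case: f g => [|x f] [|y g];
    rewrite /= ?big_cat ?big_map ?big_seq1 ?mulr0 ?mul0r ?mulr1 ?addr0 //=.
  by rewrite !big1 ?addr0.
case: f => [|x f].
  rewrite [shuffles _ _]/= big_seq1 -(ssum_unitl (z :: h) (fun b => (g == b)%:R)).
  by apply: eq_ssum => -[|? a] b; rewrite ?mul1r ?mul0r.
case: g => [|y g].
  rewrite [shuffles _ _]/= big_seq1.
  rewrite -(ssum_unitr (z :: h) (fun a => (x :: f == a)%:R)).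
  by apply: eq_ssum => a [|? b]; rewrite ?mulr1 ?mulr0.
rewrite ssum_cons.
have -> : shuffles (x :: f) (y :: g) =
    map (cons x) (shuffles f (y :: g)) ++ map (cons y) (shuffles (x :: f) g) by [].
rewrite big_cat !big_map; congr (_ + _).
  transitivity ((x == z)%:R * \sum_(s <- shuffles f (y :: g)) (s == h)%:R : k).
    by rewrite mulr_sumr; apply: eq_bigr => s _; rewrite eqseq_cons -natrM mulnb.
  rewrite IH /ssum mulr_sumr; apply: eq_bigr => p _.
  by rewrite mulrA; congr (_ * _); rewrite eqseq_cons -natrM mulnb.
transitivity ((y == z)%:R * \sum_(s <- shuffles (x :: f) g) (s == h)%:R : k).
  by rewrite mulr_sumr; apply: eq_bigr => s _; rewrite eqseq_cons -natrM mulnb.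
rewrite IH /ssum mulr_sumr; apply: eq_bigr => p _.
by rewrite mulrCA; congr (_ * _); rewrite eqseq_cons -natrM mulnb.
Qed.

Lemma coeff_shuffle (X Y : OF) h :
  (shuffle X Y)@_(FMonom h) =
  ssum h (fun a b => X@_(FMonom a) * Y@_(FMonom b)).
Proof.
have lc (f : forest) : linear (fun X : OF => X@_(FMonom f) : k^o) by exact: coeff_lin.
apply: (@free_bilin_eq _ _ k^o (fun X Y : OF => (shuffle X Y)@_(FMonom h))
   (fun X Y => ssum h (fun a b => X@_(FMonom a) * Y@_(FMonom b)))).
- exact: lin_bilin (lc h) (free_bilin_ext_bilin _).
- split=> z; apply: sum_lin => p.
    exact: lin_comp (mulr_lin (B := k^o) _) (lc p.1).
  exact: lin_comp (mull_lin (B := k^o) _) (lc p.2).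
move=> f g; rewrite /Defs.shuffle free_bilin_ext_word raddf_sum /=.
transitivity (\sum_(s <- shuffles f g) (s == h)%:R : k).
  by apply: eq_bigr => s _; rewrite coeff_word.
by rewrite sum_shuffles; apply: eq_ssum => a b; rewrite !coeff_word.
Qed.

Local Opaque Defs.shuffle mcoeff.

Lemma forest_coeff_eq (X Y : OF) :
  (forall h, X@_(FMonom h) = Y@_(FMonom h)) -> X = Y.
Proof. exact: freeAlg_eq. Qed.

Lemma coeff1 f : (1 : OF)@_(FMonom f) = (f == [::])%:R.
Proof. by rewrite -word_nil coeff_word eq_sym. Qed.

(** Dual to coassociativity of the splittings. The resulting monoid law allows the iterated shuffle
    over the vertices to be regrouped. *)
Lemma shuffleA : associative shuffle.
Proof.
move=> X Y Z.
apply: forest_coeff_eq.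
move=> h.
apply: (etrans (coeff_shuffle X (shuffle Y Z) h)).
apply: (etrans _ (esym (coeff_shuffle (shuffle X Y) Z h))).
transitivity (ssum h (fun a b => ssum b (fun b1 b2 =>
    X@_(FMonom a) * (Y@_(FMonom b1) * Z@_(FMonom b2))))).
  by apply: eq_ssum => a b; rewrite coeff_shuffle /ssum mulr_sumr.
rewrite -(ssumA h (fun a b1 b2 => X@_(FMonom a) * (Y@_(FMonom b1) * Z@_(FMonom b2)))).
apply: eq_ssum => a b; rewrite coeff_shuffle /ssum mulr_suml.
by apply: eq_bigr => p _; rewrite mulrA.
Qed.

Lemma shuffle1l : left_id 1 shuffle.
Proof.
move=> X; apply: forest_coeff_eq => h; rewrite coeff_shuffle.
rewrite -[RHS](ssum_unitl h (fun b => X@_(FMonom b))).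
by apply: eq_ssum => -[|x a] b; rewrite coeff1 /= ?mul1r ?mul0r.
Qed.

Lemma shuffle1r : right_id 1 shuffle.
Proof.
move=> X; apply: forest_coeff_eq => h; rewrite coeff_shuffle.
rewrite -[RHS](ssum_unitr h (fun b => X@_(FMonom b))).
by apply: eq_ssum => a [|x b]; rewrite coeff1 /= ?mulr1 ?mulr0.
Qed.

HB.instance Definition _ := Monoid.isLaw.Build OF 1 shuffle shuffleA shuffle1l shuffle1r.

End Shuffle.

(** * Counting cuts by counting graftings *)

Section CutSums.
Local Opaque Defs.shuffle mcoeff.
Variables (k : fieldType) (A : finType).
Local Notation tree := (tree A).
Local Notation forest := (seq tree).
Local Notation OF := (freeAlg k tree).
Local Notation shuffle := (@shuffle k A).
Local Notation wordF f := (word k f : OF).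
Implicit Types (t u r : tree) (f g h ts us rs pre : forest) (c : seq nat -> bool).

Definition pruned c t : OF :=
  \big[shuffle/1]_(v <- vertices t)
    word k [seq nth t (children (subtree t v)) j
           | j <- iota 0 (size (children (subtree t v))) & c (rcons v j)].

Fixpoint pruned_forest j ts c : OF :=
  if ts is t :: us then
    shuffle (pruned (fun v => c (j :: v)) t) (pruned_forest j.+1 us c)
  else 1.

(** A form of [trunk] that restricts the cut to each subtree instead of carrying the address of the
    subtree. *)
Fixpoint root_part c t : tree :=
  let: Node a ts := t in
  Node a ((fix go j us := if us is u :: us' then
             if c [:: j] then go j.+1 us'
             else root_part (fun v => c (j :: v)) u :: go j.+1 us'
           else [::]) 0%N ts).

Fixpoint root_parts j ts c : forest :=
  if ts is t :: us then
    if c [:: j] then root_parts j.+1 us c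
    else root_part (fun v => c (j :: v)) t :: root_parts j.+1 us c
  else [::].

Lemma root_partE c a ts : root_part c (Node a ts) = Node a (root_parts 0 ts c).
Proof.
congr Node; elim: ts {2 3}0%N => //= t ts IH j.
by rewrite -(IH j.+1).
Qed.

Lemma trunkE (x : {fset seq nat}) p t :
  trunk x p t = root_part (fun v => p ++ v \in x) t.
Proof.
have [a ts IH {}p||u us IHu IHus {}p j|h _] := @tree_forest_ind A
  (fun t => forall p, trunk x p t = root_part (fun v => p ++ v \in x) t)
  (fun ts => forall p j,
    (fix go j ts := if ts is u :: us then
             if rcons p j \in x then go j.+1 us
             else trunk x (rcons p j) u :: go j.+1 us
           else [::]) j ts = root_parts j ts (fun v => p ++ v \in x));
  last exact: h.
- by rewrite root_partE /= IH.
- by [].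
- rewrite /= -cats1 IHus IHu; congr (if _ then _ else _ :: _).
  by congr root_part; apply: funext => v; rewrite -catA.
Qed.

Lemma pruned_at_big (x : {fset seq nat}) t :
  \big[shuffle/1]_(v <- vertices t) word k (pruned_at t x v) =
  pruned (fun v => v \in x) t.
Proof. by []. Qed.

Lemma pruned_from a pre ts c :
  \big[shuffle/1]_(v <- vertices_from (size pre) ts)
    word k [seq nth (Node a (pre ++ ts)) (children (subtree (Node a (pre ++ ts)) v)) j
           | j <- iota 0 (size (children (subtree (Node a (pre ++ ts)) v)))
             & c (rcons v j)] =
  pruned_forest (size pre) ts c.
Proof.
elim: ts pre => [|t ts IH] pre; first by rewrite big_nil.
rewrite [vertices_from _ _]/= big_cat big_map /=; congr (shuffle _ _).
  apply: eq_bigr => v _; rewrite nth_cat ltnn subnn /=; congr word.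
  (* The two sides use different defaults for [nth], but the position is in range. *)
  apply/eq_in_map => j; rewrite mem_filter mem_iota /= add0n => /andP[_ lj].
  exact: set_nth_default.
by have := IH (rcons pre t); rewrite cat_rcons size_rcons.
Qed.

Lemma pruned_node a ts c :
  pruned c (Node a ts) =
  shuffle (word k [seq nth (Node a ts) ts j | j <- iota 0 (size ts) & c [:: j]])
    (pruned_forest 0 ts c).
Proof.
rewrite /pruned verticesE big_cons; congr (shuffle _ _).
exact: (pruned_from a [::] ts c).
Qed.

Lemma pruned_root t : pruned (fun v => v == [::]) t = 1.
Proof.
rewrite /pruned big1 // => v _.
rewrite (eq_filter (a2 := pred0)) ?filter_pred0 ?word_nil // => j.
by case: v.
Qed.

Lemma pruned_forest_cons j t ts c :
  pruned_forest j (t :: ts) c =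
  shuffle (pruned (fun v => c (j :: v)) t) (pruned_forest j.+1 ts c).
Proof. by []. Qed.

Lemma root_parts_cons j t ts c :
  root_parts j (t :: ts) c =
  if c [:: j] then root_parts j.+1 ts c
  else root_part (fun v => c (j :: v)) t :: root_parts j.+1 ts c.
Proof. by []. Qed.

Lemma eq_pruned_forest j ts c c' :
  (forall i v, (j <= i)%N -> c (i :: v) = c' (i :: v)) ->
  pruned_forest j ts c = pruned_forest j ts c'.
Proof.
elim: ts j => [|t ts IH] j e; first by [].
rewrite !pruned_forest_cons (IH j.+1); last by move=> i v /ltnW; exact: e.
have -> : (fun v => c (j :: v)) = (fun v => c' (j :: v)); last by [].
by apply: funext => v; exact: e.
Qed.

Lemma eq_root_parts j ts c c' :
  (forall i v, (j <= i)%N -> c (i :: v) = c' (i :: v)) ->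
  root_parts j ts c = root_parts j ts c'.
Proof.
elim: ts j => [|t ts IH] j e; first by [].
rewrite !root_parts_cons (IH j.+1); last by move=> i v /ltnW; exact: e.
rewrite e //; congr (if _ then _ else root_part _ _ :: _).
by apply: funext => v; exact: e.
Qed.

Lemma pruned_forest_drop j m ts c : (m <= size ts)%N ->
  (forall i v, (j <= i < j + m)%N -> c (i :: v) = (v == [::])) ->
  pruned_forest j ts c = pruned_forest (j + m) (drop m ts) c /\
  root_parts j ts c = root_parts (j + m) (drop m ts) c.
Proof.
elim: m j ts => [|m IH] j ts lm hc; first by rewrite addn0 drop0.
case: ts lm => // t ts lm; rewrite pruned_forest_cons root_parts_cons [drop _ _]/=.
have hj v : c (j :: v) = (v == [::]) by apply: hc; rewrite leqnn addnS ltnS leq_addr.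
have [|i v /andP[ji ij]|-> ->] := IH j.+1 ts; first exact: lm.
  by apply: hc; rewrite (ltnW ji) addnS -addSn.
rewrite hj eqxx addnS addSn; split=> //.
rewrite (_ : (fun v => _) = (fun v => v == [::])); last exact/funext/hj.
by rewrite pruned_root shuffle1l.
Qed.

Lemma cut_node_sum a ts m (d : {fset seq nat}) : (m <= size ts)%N ->
  d \in product_cuts m (drop m (map (@rec_cuts A) ts)) ->
  pruned (fun v => v \in (prefix_edges m `|` d)%fset) (Node a ts) =
    shuffle (word k (take m ts)) (pruned_forest m (drop m ts) (fun v => v \in d)) /\
  root_part (fun v => v \in (prefix_edges m `|` d)%fset) (Node a ts) =
    Node a (root_parts m (drop m ts) (fun v => v \in d)).
Proof.
move=> lm hd; have /product_cutsP[d0 dlt _ _] := hd.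
set c := fun v => _.
have cge i v : (m <= i)%N -> c (i :: v) = (i :: v \in d).
  by move=> mi; rewrite /c inE in_prefix_edges; case: v => //=; rewrite ltnNge mi.
have clt i v : (i < m)%N -> c (i :: v) = (v == [::]).
  move=> im; rewrite /c inE in_prefix_edges (negbTE (dlt _ _ im)) orbF.
  by case: v.
rewrite pruned_node root_partE.
have [||-> ->] := @pruned_forest_drop 0 m ts c; first exact: lm.
  by move=> i v /andP[_ im]; exact: clt.
rewrite add0n (eq_pruned_forest (drop m ts) (c' := fun v => v \in d) cge).
rewrite (eq_root_parts (drop m ts) (c' := fun v => v \in d) cge).
suff -> : [seq nth (Node a ts) ts j | j <- iota 0 (size ts) & c [:: j]] = take m ts.
  by split.
rewrite -[size ts](subnKC lm) iotaD filter_cat add0n.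
rewrite (eq_in_filter (a2 := predT)); last first.
  by move=> i; rewrite mem_iota /= => im; rewrite clt.
rewrite filter_predT (eq_in_filter (a2 := pred0) (s := iota m _)); last first.
  move=> i; rewrite mem_iota => /andP[mi _]; rewrite cge //.
  exact/negbTE/(root_edge_product lm mi hd).
by rewrite filter_pred0 cats0 map_nth_iota0.
Qed.

(** Only m = [size f1] contributes: the number of children cut off at the root is the number of
    trees grafted there. *)
Lemma sum_delta_cat f1 h ts : \sum_(m <- iota 0 (size ts).+1)
    (take m ts == f1)%:R * (h == drop m ts)%:R = (f1 ++ h == ts)%:R :> k.
Proof.
have [<-|ne] := eqVneq (f1 ++ h) ts; last first.
  rewrite big1 // => m _; case: eqP => [e1|_]; last by rewrite mul0r.
  case: eqP => [e|_]; last by rewrite mulr0.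
  by move: ne; rewrite -e1 e cat_take_drop eqxx.
have us := iota_uniq 0 (size (f1 ++ h)).+1.
have ms : size f1 \in iota 0 (size (f1 ++ h)).+1.
  by rewrite mem_iota size_cat ltnS leq_addr.
have ls m : m \in iota 0 (size (f1 ++ h)).+1 -> (m <= size (f1 ++ h))%N.
  by rewrite mem_iota.
move: (iota _ _) us ms ls => s us ms ls.
rewrite (bigD1_seq _ ms us) /= take_size_cat // drop_size_cat // !eqxx mul1r.
rewrite big_seq_cond big1 ?addr0 // => m /andP[/ls lm ne].
case: eqP => [e|_]; last by rewrite mul0r.
by move: ne; rewrite -e size_takel // eqxx.
Qed.

(* The cuts of t are dual to grafting: both sides count the ways to obtain t by
   grafting f on r. *)
Lemma cut_sums :
  (forall t f r,
    \sum_(c <- rec_cuts t) (pruned (fun v => v \in c) t)@_(FMonom f) *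
       (root_part (fun v => v \in c) t == r)%:R =
    \sum_(u <- grafts r f) (u == t)%:R :> k) /\
  (forall ts m j rs f,
    \sum_(d <- product_cuts j (map (@rec_cuts A) (drop m ts)))
       (pruned_forest j (drop m ts) (fun v => v \in d))@_(FMonom f) *
       (root_parts j (drop m ts) (fun v => v \in d) == rs)%:R =
    \sum_(h <- forest_grafts rs f) (h == drop m ts)%:R :> k).
Proof.
(* The claim for forests ranges over all tails [drop m ts], since the root may lose any number m of
   children, and over j, since the others keep their positions. *)
apply: tree_forest_ind => [a ts IH f [b rs]|m j rs f|t ts IHt IHs [|m] j rs f].
- rewrite big_flatten big_map sum_grafts sum_gl_forests.
  transitivity ((a == b)%:R * \sum_(m <- iota 0 (size ts).+1)
     ssum f (fun f1 f2 => (take m ts == f1)%:R *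
        \sum_(h <- forest_grafts rs f2) (h == drop m ts)%:R) : k).
    rewrite mulr_sumr !big_seq; apply: eq_bigr => m.
    rewrite mem_iota add0n ltnS => /andP[_ lm]; rewrite big_map.
    transitivity (\sum_(d <- product_cuts m (drop m (map (@rec_cuts A) ts)))
       ssum f (fun f1 f2 => (a == b)%:R * ((take m ts == f1)%:R *
         ((pruned_forest m (drop m ts) (fun v => v \in d))@_(FMonom f2) *
          (root_parts m (drop m ts) (fun v => v \in d) == rs)%:R))) : k).
      rewrite !big_seq; apply: eq_bigr => d hd.
      have [-> ->] := cut_node_sum a lm hd.
      rewrite coeff_shuffle /ssum mulr_suml; apply: eq_bigr => p _.
      have -> : (Node a (root_parts m (drop m ts) (fun v => v \in d)) == Node b rs) =
         (a == b) && (root_parts m (drop m ts) (fun v => v \in d) == rs).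
        by apply/eqP/andP => [[-> ->]|[/eqP -> /eqP ->]].
      by rewrite coeff_word -mulnb natrM -mulrA !(mulrCA _ (a == b)%:R).
    rewrite -ssum_exch /ssum mulr_sumr; apply: eq_bigr => p _.
    by rewrite -!mulr_sumr -map_drop IH.
  rewrite -ssum_exch /ssum mulr_sumr; apply: eq_bigr => p _.
  under eq_bigr => m _ do rewrite mulr_sumr.
  rewrite exchange_big /= mulr_sumr; apply: eq_bigr => h _.
  have -> : (Node b (p.1 ++ h) == Node a ts) = (a == b) && (p.1 ++ h == ts).
    by apply/eqP/andP => [[-> ->]|[/eqP -> /eqP ->]].
  by rewrite sum_delta_cat -natrM mulnb.
- rewrite /= big_seq1 /= coeff1.
  case: rs => [|r rs].
    rewrite sum_forest_grafts_nil; case: f => [|u f]; by rewrite ?mulr1 ?mul0r.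
  rewrite mulr0 sum_forest_grafts_cons; transitivity (ssum f (fun _ _ => 0 : k)).
    by rewrite ssum0.
  by apply: eq_ssum => f1 f2; rewrite big1 // => u _; rewrite big1.
- rewrite drop0 [map _ _]/= [product_cuts _ _]/= big_allpairs_dep.
  transitivity (\sum_(c <- rec_cuts t) \sum_(d <- product_cuts j.+1 (map (@rec_cuts A) ts))
     (shuffle (pruned (fun v => v \in c) t)
        (pruned_forest j.+1 ts (fun v => v \in d)))@_(FMonom f) *
     (root_part (fun v => v \in c) t ::
        root_parts j.+1 ts (fun v => v \in d) == rs)%:R).
    rewrite !big_seq; apply: eq_bigr => c hc; rewrite !big_seq; apply: eq_bigr => d hd.
    have /product_cutsP[d0 dlt _ _] := hd.
    set x := (cons_cut j c `|` d)%fset.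
    have xj : (fun v => j :: v \in x) = (fun v => v \in c).
      apply: funext => v; rewrite inE in_cons_cut eqxx.
      by rewrite (negbTE (dlt _ _ _)) ?orbF.
    have xi i v : (j < i)%N -> (i :: v \in x) = (i :: v \in d).
      by move=> ji; rewrite inE in_cons_cut gtn_eqF.
    have nx : ([:: j] \in x) = false.
      by have /= -> := congr1 (@^~ [::]) xj; exact/negbTE/(nil_rec_cuts hc).
    rewrite pruned_forest_cons root_parts_cons nx xj.
    rewrite (eq_pruned_forest _ (c' := fun v => v \in d)) //.
    by rewrite (eq_root_parts _ (c' := fun v => v \in d)).
  case: rs => [|r rs].
    rewrite sum_forest_grafts_nil big1 => [|c _]; first by case: f.
    by rewrite big1 // => d _; rewrite mulr0.
  rewrite sum_forest_grafts_cons.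
  transitivity (ssum f (fun f1 f2 =>
     (\sum_(c <- rec_cuts t) (pruned (fun v => v \in c) t)@_(FMonom f1) *
       (root_part (fun v => v \in c) t == r)%:R) *
     (\sum_(d <- product_cuts j.+1 (map (@rec_cuts A) ts))
       (pruned_forest j.+1 ts (fun v => v \in d))@_(FMonom f2) *
       (root_parts j.+1 ts (fun v => v \in d) == rs)%:R))).
    under [RHS]eq_ssum => f1 f2.
      rewrite mulr_suml; under eq_bigr => c _ do rewrite mulr_sumr.
      over.
    rewrite ssum_exch; apply: eq_bigr => c _; rewrite ssum_exch; apply: eq_bigr => d _.
    rewrite coeff_shuffle /ssum mulr_suml; apply: eq_bigr => p _.
    by rewrite eqseq_cons -mulnb natrM mulrACA.
  apply: eq_ssum => f1 f2; rewrite IHt.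
  have := IHs 0%N j.+1 rs f2; rewrite drop0 => ->.
  rewrite mulr_suml; apply: eq_bigr => u _; rewrite mulr_sumr; apply: eq_bigr => h _.
  by rewrite eqseq_cons -mulnb natrM.
- exact: IHs.
Qed.

End CutSums.

Local Opaque word ferU ferG Defs.shuffle.

(** * Coordinates on a tensor square *)

Section TensorCoefficients.
Variables (k : fieldType) (I : choiceType).
Local Notation FA := (freeAlg k I).

Lemma coeff2_bilin (u v : seq I) :
  bilin (fun x y : FA => x@_(FMonom u) * y@_(FMonom v) : k^o).
Proof.
have lc (w : seq I) : linear (fun X : FA => X@_(FMonom w) : k^o) by exact: coeff_lin.
split=> z; first exact: lin_comp (mulr_lin (B := k^o) _) (lc u).
exact: lin_comp (mull_lin (B := k^o) _) (lc v).
Qed.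

Definition coeff2 (u v : seq I) : tens FA FA -> k^o :=
  tens_lift (fun x y : FA => x@_(FMonom u) * y@_(FMonom v) : k^o).

Lemma coeff2_lin u v : linear (coeff2 u v).
Proof. exact: tens_lift_lin (coeff2_bilin u v). Qed.

Lemma coeff2_pure u v (x y : FA) :
  coeff2 u v (pure x y) = x@_(FMonom u) * y@_(FMonom v).
Proof. exact: tens_lift_pure (coeff2_bilin u v) _ _. Qed.

Lemma ex_common_support (s : seq (FA * FA)) : exists d : {fset {fmonom I}},
  forall p, p \in s -> (msupp p.1 `<=` d)%fset /\ (msupp p.2 `<=` d)%fset.
Proof.
elim: s => [|p s [d hd]]; first by exists fset0.
exists (msupp p.1 `|` msupp p.2 `|` d)%fset => q; rewrite inE => /orP[/eqP->|/hd[h1 h2]].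
  split; first by rewrite -fsetUA fsubsetUl.
  by rewrite -fsetUA; apply: fsubsetU; rewrite fsubsetUl orbT.
by split; apply: fsubsetU; rewrite ?h1 ?h2 orbT.
Qed.

Lemma free_support (d : {fset {fmonom I}}) (x : FA) : (msupp x `<=` d)%fset ->
  x = \sum_(w <- d) x@_w *: word k w.
Proof.
move=> le; rewrite {1}(freeAlgE x) (big_fset_incl _ le) //= => w _ /mcoeff_outdom ->.
by rewrite scale0r.
Qed.

(** The tensor product is a quotient without a given basis. Expanding a representative over a finite
    set of words containing all supports shows that coordinates determine a tensor. *)
Lemma coeff2_eq0 (z : tens FA FA) : (forall u v, coeff2 u v z = 0) -> z = 0.
Proof.
move=> h; have [d hd] := ex_common_support (repr z).
rewrite (tens_sum_pure z).
transitivity (\sum_(p <- repr z) \sum_(u <- d) \sum_(v <- d)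
   (p.1@_u * p.2@_v) *: pure (word k u : FA) (word k v : FA)).
  rewrite !big_seq; apply: eq_bigr => p /hd[h1 h2].
  rewrite {1}(free_support h1) (lin_sum (pure_linl _)); apply: eq_bigr => u _.
  rewrite {1}(free_support h2) (lin_sum (pure_linr _)); apply: eq_bigr => v _.
  by rewrite (linZ (pure_linl _)) (linZ (pure_linr _)) scalerA.
rewrite exchange_big big1 // => -[u] _; rewrite exchange_big big1 // => -[v] _ /=.
rewrite -scaler_suml (_ : \sum_(p <- repr z) _ = 0) ?scale0r //.
rewrite -[RHS](h u v) [in RHS](tens_sum_pure z) (lin_sum (coeff2_lin u v)).
by apply: eq_bigr => p _; rewrite coeff2_pure.
Qed.

Lemma coeff2_eq (z z' : tens FA FA) : (forall u v, coeff2 u v z = coeff2 u v z') -> z = z'.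
Proof.
move=> h; apply/eqP; rewrite -subr_eq0; apply/eqP/coeff2_eq0 => u v.
by rewrite (linB (coeff2_lin u v)) h subrr.
Qed.

End TensorCoefficients.

Section Duality.
Variables (k : fieldType) (A : finType).
Local Notation tree := (tree A).
Local Notation forest := (seq tree).
Local Notation OF := (freeAlg k tree).
Local Notation wordF f := (word k f : OF).
Implicit Types (t u r : tree) (f g h ts : forest).

Definition cut_tens t : tens OF OF :=
  \sum_(c <- rec_cuts t) pure (pruned k (fun v => v \in c) t)
     (word k [:: root_part (fun v => v \in c) t] : OF).

Lemma MKW_treeE t : MKW_tree k t = pure (word k [:: t] : OF) 1 + cut_tens t.
Proof.
have -> : cut_tens t = \sum_(c <- left_cuts t)
    pure (\big[@Defs.shuffle k A/1]_(v <- vertices t) word k (pruned_at t c v) : OF)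
         (word k [:: trunk c [::] t] : OF).
  rewrite (perm_big _ (left_cuts_perm t)); apply: eq_bigr => c _.
  by rewrite trunkE pruned_at_big.
by [].
Qed.

Lemma MKW_forest1 t :
  MKW_forest k [:: t] = pure (word k [:: t] : OF) 1 + cut_tens t.
Proof. by rewrite -MKW_treeE; case: t. Qed.

(** Subtracting the total cut of B_a(f) leaves the sum over its left admissible cuts. *)
Lemma MKW_forest_tree a f : (1 < size f)%N -> a = dec (head (Node a [::]) f) ->
  MKW_forest k f = tens_map id (@Bminus k A) (cut_tens (Node a f)).
Proof.
case: f => [//|[b ts] [//|u f]] _ /= ->.
by rewrite MKW_treeE [X in tens_map _ _ X]addrC addKr.
Qed.

(** For a single tree the total cut accounts for empty g and the other cuts for g with one tree,
    while a longer g gives nothing. For a longer h, the equation f > B_a(g) = B_a(f * g) reduces the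
    claim to grafting on one tree. *)
Lemma MKW_dual h f g :
  coeff2 f g (MKW_forest k h) = \sum_(u <- gl_forests g f) (u == h)%:R.
Proof.
have [hc _] := cut_sums k A.
have lc := @coeff2_lin k _ f g.
case: h => [|t [|t' h]].
- rewrite /MKW_forest coeff2_pure -word_nil !coeff_word.
  transitivity (\sum_(u <- gl_forests g f) (if u is [::] then 1 else 0) : k); last first.
    by apply: eq_bigr => -[|u s].
  by rewrite sum_gl_forests_forests_if_nil; case: (g) (f) => [|? ?] [|? ?]; rewrite ?mulr0 ?mul0r ?mulr1.
- rewrite MKW_forest1 (linD lc) coeff2_pure -word_nil !coeff_word.
  rewrite /cut_tens (lin_sum lc).
  under eq_bigr => c _ do rewrite coeff2_pure coeff_word.
  rewrite sum_gl_forests; clear lc; case: g => [|r [|r' g]].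
  + rewrite eqxx mulr1 big1 => [|c _]; last by rewrite mulr0.
    rewrite addr0 eq_sym -(ssum_unitr f (fun f => (f == [:: t])%:R)).
    by apply: eq_ssum => f1 f2; rewrite sum_forest_grafts_nil cats0.
  + rewrite mulr0 add0r.
    transitivity (\sum_(u <- grafts r f) (u == t)%:R : k).
      rewrite -hc; apply: eq_bigr => c _.
      by congr (_ * (nat_of_bool _)%:R); rewrite eqseq_cons andbT.
    rewrite -(ssum_unitl f (fun f => \sum_(u <- grafts r f) (u == t)%:R)).
    apply: eq_ssum => f1 f2; rewrite sum_forest_grafts1; case: f1 => [|x f1].
      by apply: eq_bigr => u _; rewrite /= eqseq_cons andbT.
    by rewrite big1 // => u _; rewrite eqseq_cons; case: f1 => [|? ?]; rewrite /= andbF.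
  + rewrite mulr0 add0r big1 => [|c _]; last by rewrite eqseq_cons andbF mulr0.
    transitivity (ssum f (fun _ _ => 0 : k)); first by rewrite ssum0.
    apply: eq_ssum => f1 f2; rewrite big_seq big1 // => u /size_forest_grafts su.
    rewrite (_ : (_ == _) = false) //; apply/negbTE/eqP => /(congr1 size).
    by rewrite size_cat su /= => e; lia.
- pose a := dec t; rewrite (@MKW_forest_tree a) //.
  have lB : linear (@Bminus k A) by exact: free_ext_lin.
  rewrite /coeff2 (tens_lift_map (@id_lin _ _) lB _ (coeff2_bilin _ _ _)).
  have hB : bilin (fun x y : OF => x@_(FMonom f) * (Bminus y)@_(FMonom g) : k^o).
    exact: bilin_comp (coeff2_bilin k f g) (@id_lin _ _) lB.
  rewrite /cut_tens (lin_sum (tens_lift_lin hB)).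
  transitivity (\sum_(u <- grafts (Node a g) f) (u == Node a [:: t, t' & h])%:R : k).
    rewrite -hc; apply: eq_bigr => c _; rewrite (tens_lift_pure hB).
    rewrite /Bminus free_ext_word root_partE coeff_word; congr (_ * (nat_of_bool _)%:R).
    by apply/eqP/eqP => [->|[]].
  rewrite sum_grafts; apply: eq_bigr => u _; congr (nat_of_bool _)%:R.
  by apply/eqP/eqP => [[]|->].
Qed.

Lemma coeff2_MKW (X : OF) f g :
  coeff2 f g (free_ext (@MKW_forest k A) X) = \sum_(u <- gl_forests g f) X@_(FMonom u).
Proof.
move: X; apply: free_lin_ext.
- exact: lin_comp (coeff2_lin f g) (free_ext_lin _).
- by apply: (@sum_lin _ _ k^o) => u; exact: coeff_lin.
move=> h; rewrite free_ext_word MKW_dual; apply: eq_bigr => u _.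
by rewrite coeff_word eq_sym.
Qed.

Definition pairing (x y : OF) : k^o := \sum_(f <- msupp x) x@_f * y@_f.

Lemma pairing_word x f : pairing x (wordF f) = x@_(FMonom f).
Proof.
rewrite /pairing; have [nf|fx] := boolP (FMonom f \in msupp x); last first.
  rewrite mcoeff_outdom // big_seq big1 // => -[g] gx; rewrite coeff_word.
  by case: eqP => [e|_]; [rewrite e gx in fx|rewrite mulr0].
rewrite (bigD1_seq _ nf (fset_uniq _)) /= coeff_word eqxx mulr1 big1 ?addr0 // => -[g].
by rewrite fmP /= coeff_word eq_sym => /negbTE ->; rewrite mulr0.
Qed.

Lemma pairing_linr x : linear (pairing x).
Proof.
move=> a y z; rewrite /pairing scaler_sumr -big_split; apply: eq_bigr => f _ /=.
by rewrite mcoeffD mcoeffZ mulrDr mulrCA.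
Qed.

Lemma pairingE x (F : OF -> k^o) : linear F ->
  (forall f, x@_(FMonom f) = F (wordF f)) -> pairing x =1 F.
Proof.
move=> lF e; apply: free_lin_ext => // [|f]; first exact: pairing_linr.
by rewrite pairing_word e.
Qed.

Lemma pairing_linl y : linear (fun x => pairing x y).
Proof.
move=> a x x'.
apply: (@pairingE _ (fun y => a *: pairing x y + pairing x' y)) => [b z z'|f].
  by rewrite !pairing_linr !scalerDr !scalerA [b * a]mulrC addrACA.
by rewrite !pairing_word mcoeffD mcoeffZ.
Qed.

End Duality.

(** * The transpose of the fertility map *)

Local Opaque word ferU ferG Defs.shuffle.

Lemma coeff_sum_words (k : fieldType) (I : choiceType) (c : seq I -> k)
    (s : seq (seq I)) w : uniq s ->
  (\sum_(v <- s) c v *: word k v : freeAlg k I)@_(FMonom w) =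
  if w \in s then c w else 0.
Proof.
elim: s => [|v s IH] /= => [_|/andP[vs us]]; first by rewrite big_nil mcoeff0.
rewrite big_cons mcoeffD mcoeffZ coeff_word IH // inE eq_sym.
have [->|_] := eqVneq w v; last by rewrite mulr0 add0r.
by rewrite (negbTE vs) mulr1 addr0.
Qed.

Section GradedDual.
Variables (k : fieldType) (A : finType).
Local Notation tree := (tree A).
Local Notation forest := (seq tree).
Local Notation OF := (freeAlg k tree).
Local Notation gP := (gPLOT k A).
Local Notation iP := (@env_inj k gP).
Local Notation U := (env gP).
Local Notation ferU := (@ferU k A).
Local Notation ferG := (@ferG k A).
Local Notation homog := (env_homog iP (@gPLOT_homog k A)).
Local Notation GD := (@gdual k (UgPLOT k A) homog).
Local Notation ev phi X := (@gdual_eval k (UgPLOT k A) homog phi X).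
Local Notation deg f := (size (fer_words f)).
Local Notation wordF f := (word k f : OF).
Implicit Types (t u : tree) (f g h : forest) (phi psi : GD).

Lemma homog_word f : homog (deg f) (ferU (wordF f)).
Proof.
elim: f => [|t f IH]; first by rewrite word_nil ferU1; exact: EnvHomog1.
rewrite word_cons ferUM ferU_leaf fer_words_cons size_cat.
apply: EnvHomogM IH => w; rewrite fer_tree_val msuppU1 inE => /eqP->.
by [].
Qed.

(** The inductive grading of U(g(A)) is only needed in this form: an element of degree n pulls back
    to forests with n vertices. For factors in g(A) this is [coeff_fertW]. *)
Lemma homog_coeff n X f : homog n X -> deg f != n -> (ferG X)@_(FMonom f) = 0.
Proof.
move=> hX; elim: hX f => {n X} [|n m x X hx _ IH|n|n a X Y _ IX _ IY] f ne.
- rewrite ferG1 coeff1 (_ : (f == [::]) = false) //; apply: contraNF ne.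
  by move/eqP->.
- rewrite ferGM ferG_inj mcoeffMl big1 // => -[u] _; rewrite big1 // => -[v] _.
  have [e|_] := eqVneq (mmul (FMonom u) (FMonom v)) (FMonom f); last by rewrite mulr0n.
  have ef : f = u ++ v.
    by have /(congr1 (@fmonom_val _)) := e; rewrite [LHS]fmM.
  have [du|nu] := eqVneq (deg u) n; last first.
    suff -> : (val (fert_inv x) : OF)@_(FMonom u) = 0 by rewrite mul0r mul0rn.
    rewrite -coeff_fertW -fertE fert_invK; apply: mcoeff_outdom.
    by apply: contraNN nu => /hx /eqP.
  rewrite IH ?mulr0 ?mul0rn //; apply: contraNN ne => /eqP dv.
  by rewrite ef fer_words_cat size_cat du dv.
- by rewrite (lin0 (@ferG_lin k A)) mcoeff0.
- by rewrite (@ferG_lin k A) mcoeffD mcoeffZ IX // IY // mulr0 addr0.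
Qed.

Lemma gdual_lin phi : linear (gdual_val phi).
Proof. by have /asboolP[] := valP phi. Qed.

Lemma gdual_fer_lin phi : linear (fun X : OF => ev phi (ferU X) : k^o).
Proof. exact: lin_comp (gdual_lin phi) (@ferU_lin k A). Qed.

Lemma gdual_bound phi :
  exists N, forall f, (N <= deg f)%N -> ev phi (ferU (wordF f)) = 0.
Proof.
have /asboolP[_ [N hN]] := valP phi; exists N => f Nf.
exact: hN Nf (homog_word f).
Qed.

(** The form vanishes on forests with at least N vertices, and [all_forests] lists the remaining
    ones. *)
Lemma ex_coefficients phi :
  exists x : OF, forall f, x@_(FMonom f) = ev phi (ferU (wordF f)).
Proof.
have [N hN] := gdual_bound phi.
exists (\sum_(f <- undup (all_forests A N)) (ev phi (ferU (wordF f))) *: wordF f).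
move=> f; rewrite (coeff_sum_words (fun f => ev phi (ferU (wordF f)))) ?undup_uniq //.
rewrite mem_undup; case: ifPn => // nf; rewrite hN //.
by apply: ltnW; rewrite ltnNge; apply: contraNN nf; exact: mem_all_forests.
Qed.

Definition transpose phi : OF := sval (cid (ex_coefficients phi)).

Lemma coeff_transpose phi f :
  (transpose phi)@_(FMonom f) = ev phi (ferU (wordF f)).
Proof. exact: svalP (cid (ex_coefficients phi)) f. Qed.

Lemma pairing_transpose phi X : pairing (transpose phi) X = ev phi (ferU X).
Proof.
move: X; apply: pairingE (gdual_fer_lin phi) _ => f; exact: coeff_transpose.
Qed.

Lemma transpose_lin : linear transpose.
Proof.
move=> a phi psi; apply: forest_coeff_eq => f.
by rewrite mcoeffD mcoeffZ !coeff_transpose.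
Qed.

Lemma pairing_gdual (x : OF) :
  (fun Y : U => pairing x (ferG Y)) \in gdual_pred (homog : nat -> UgPLOT k A -> Prop).
Proof.
apply/asboolP; split; first exact: lin_comp (pairing_linr x) (@ferG_lin k A).
(* Strictly above every degree occurring in the support of x. *)
exists (\max_(f <- msupp x) (deg f).+1)%N => n X lN hX.
rewrite /pairing big_seq big1 // => -[f] fx; rewrite (homog_coeff hX) ?mulr0 //.
apply: contraTneq lN => <-; rewrite -ltnNge.
exact: (@leq_bigmax_seq _ _ _ (fun f : {fmonom tree} => (deg f).+1) (FMonom f) fx).
Qed.

Definition transpose_inv (x : OF) : GD := Gdual (pairing_gdual x).

Lemma transpose_invE x Y : ev (transpose_inv x) Y = pairing x (ferG Y).
Proof. by []. Qed.

Lemma transposeK : cancel transpose transpose_inv.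
Proof.
move=> phi; apply: val_inj; apply: funext => Y.
by rewrite -[LHS]/(pairing (transpose phi) (ferG Y)) pairing_transpose ferGK.
Qed.

Lemma transpose_invK : cancel transpose_inv transpose.
Proof.
move=> x; apply: forest_coeff_eq => f.
by rewrite coeff_transpose transpose_invE ferUK pairing_word.
Qed.

Lemma transpose_inv_lin : linear transpose_inv.
Proof.
move=> a x y; apply: (can_inj transposeK).
by rewrite transpose_lin !transpose_invK.
Qed.

Section Product.
Variables phi psi : GD.

Definition gdual_prod (X : U) : k^o :=
  free_ext (fun f => ssum f (fun a b =>
    ev phi (ferU (wordF a)) * ev psi (ferU (wordF b)) : k^o)) (ferG X).

Lemma gdual_prod_lin : linear gdual_prod.
Proof. exact: lin_comp (free_ext_lin _) (@ferG_lin k A). Qed.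

Lemma deg_splits f p : p \in splits f -> (deg p.1 + deg p.2)%N = deg f.
Proof.
elim: f p => [|t f IH] p /=; first by rewrite inE => /eqP->.
rewrite mem_cat => /orP[] /mapP[q /IH e ->] /=.
  by rewrite !fer_words_cons !size_cat -addnA e.
by rewrite !fer_words_cons !size_cat addnCA e.
Qed.

Lemma gdual_mul_val :
  (fun X : UgPLOT k A => tens_lift
    (fun X1 X2 : UgPLOT k A => ev phi X1 * ev psi X2 : k^o) (hcomul X)) = gdual_prod.
Proof.
apply: funext => X; rewrite [hcomul X]/= env_comul_ferU.
have hB : bilin (fun X1 X2 : U => ev phi X1 * ev psi X2 : k^o).
  exact: (bilin_comp (mul_bilin k^o) (gdual_lin phi) (gdual_lin psi)).
have lF := @ferU_lin k A.
transitivity (tens_lift (fun a b => ev phi (ferU a) * ev psi (ferU b) : k^o)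
   (deshuffle (ferG X))).
  exact (tens_lift_map lF lF (deshuffle (ferG X)) hB).
exact: lift_deshuffle (bilin_comp hB lF lF).
Qed.

Lemma gdual_prod_gdual : gdual_prod \in gdual_pred (homog : nat -> UgPLOT k A -> Prop).
Proof.
apply/asboolP; split; first exact: gdual_prod_lin.
have [N hN] := gdual_bound phi; have [M hM] := gdual_bound psi.
(* In a split of a forest with at least N + M vertices, one part reaches the bound of its form. *)
exists (N + M)%N => n X le hX; rewrite /gdual_prod /free_ext big1 // => -[f] _.
have [df|nf] := eqVneq (deg f) n; last by rewrite (homog_coeff hX) ?scale0r.
rewrite /ssum big_seq big1 ?scaler0 // => p /deg_splits e.
have [lN|lN] := leqP N (deg p.1); first by rewrite hN ?mul0r.
rewrite [X in _ * X]hM ?mulr0 // -(leq_add2l N); apply: leq_trans le _.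
by rewrite -df -e leq_add2r ltnW.
Qed.

Lemma coeff_gdual_mul f :
  (transpose (gdual_mul phi psi))@_(FMonom f) =
  ssum f (fun a b => (transpose phi)@_(FMonom a) * (transpose psi)@_(FMonom b)).
Proof.
rewrite coeff_transpose /gdual_mul gdual_mul_val /gdual_eval insubdK; last first.
  exact: gdual_prod_gdual.
rewrite /gdual_prod ferUK free_ext_word; apply: eq_ssum => a b.
by rewrite !coeff_transpose.
Qed.

End Product.

Lemma coeff_gdual_one f :
  (transpose (gdual_one _))@_(FMonom f) = (f == [::])%:R.
Proof.
rewrite coeff_transpose /gdual_one.
have -> : @hcounit k (UgPLOT k A) = (fun Y => tree_counit (ferG Y)).
  exact: env_counit_ferU.
have [le _ _ _] := @tree_counit_spec k A.
rewrite /gdual_eval insubdK ?ferUK ?/tree_counit ?coeff_word //.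
apply/asboolP; split; first exact: lin_comp le (@ferG_lin k A).
exists 1%N => n X n0 hX; rewrite /tree_counit (homog_coeff hX) //.
by case: n n0 {hX}.
Qed.

Definition MKW_comul : OF -> tens OF OF := free_ext (@MKW_forest k A).

Lemma MKW_comul_dual phi X Y :
  tens_lift (fun x y => pairing x X * pairing y Y : k^o) (MKW_comul (transpose phi)) =
  ev phi (ferU (graftGL X Y)).
Proof.
have lG := @graftGL_bilin k A; have lphi := gdual_fer_lin phi.
have hB X' Y' : bilin (fun x y => pairing x X' * pairing y Y' : k^o).
  exact: (bilin_comp (mul_bilin k^o) (pairing_linl X') (pairing_linl Y')).
move: X Y; apply: free_bilin_eq.
- split=> z; apply: tens_lift_lin2 => x y.
    exact: lin_comp (mulr_lin (B := k^o) _) (pairing_linr x).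
  exact: lin_comp (mull_lin (B := k^o) _) (pairing_linr y).
- exact: lin_bilin lphi lG.
move=> f g; rewrite graftGL_word (lin_sum lphi).
transitivity (coeff2 f g (MKW_comul (transpose phi))).
  by apply: eq_tens_lift => x y; rewrite !pairing_word.
by rewrite coeff2_MKW; apply: eq_bigr => u _; rewrite coeff_transpose.
Qed.

Lemma hmul_ferU X Y : @hmul k (UgPLOT k A) (ferU X) (ferU Y) = ferU (graftGL X Y).
Proof. by rewrite -grossman_larson_OF; exact: grossman_larson_ferU. Qed.

(** The tensor is produced on the forest side, where the coproduct is explicit, and brought back by
    the inverse of the transpose. *)
Lemma gdual_comul_ex phi : exists z, @gdual_comul_spec k (UgPLOT k A) homog phi z.
Proof.
have lK := transpose_inv_lin.
exists (tens_map transpose_inv transpose_inv (MKW_comul (transpose phi))) => X Y.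
rewrite -(ferGK X) -(ferGK Y) hmul_ferU -MKW_comul_dual.
have hB : bilin (fun p q : GD => ev p (ferU (ferG X)) * ev q (ferU (ferG Y)) : k^o).
  have lin_ev Z : linear (fun p : GD => ev p Z : k^o) by [].
  exact: (bilin_comp (mul_bilin k^o) (lin_ev _) (lin_ev _)).
transitivity (tens_lift (fun x y => ev (transpose_inv x) (ferU (ferG X)) *
     ev (transpose_inv y) (ferU (ferG Y)) : k^o) (MKW_comul (transpose phi))).
  exact (tens_lift_map lK lK _ hB).
by apply: eq_tens_lift => x y; rewrite !transpose_invE !ferUK.
Qed.

(** The specification forces the coordinates of the image on every pair of forests, and [coeff2_eq]
    concludes on the forest side. *)
Lemma transpose_comul phi :
  MKW_comul (transpose phi) = tens_map transpose transpose (gdual_comul phi).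
Proof.
have lJ := transpose_lin.
have ht : gdual_comul_spec phi (gdual_comul phi) by apply: the_spec; exact: gdual_comul_ex.
apply: coeff2_eq => f g.
transitivity (ev phi (ferU (graftGL (wordF f) (wordF g)))).
  rewrite -MKW_comul_dual; apply: eq_tens_lift => x y.
  by rewrite !pairing_word.
rewrite -hmul_ferU -ht /coeff2 (tens_lift_map lJ lJ _ (coeff2_bilin k f g)).
by apply: eq_tens_lift => p q; rewrite !coeff_transpose.
Qed.

Lemma transpose_hopf : @hopf_isomorphism k (H_PLOT k A) (H_MKW k A) transpose.
Proof.
split; last by exists transpose_inv; [exact: transposeK|exact: transpose_invK].
split.
- exact: transpose_lin.
- move=> phi psi; apply: forest_coeff_eq => f.
  rewrite [LHS]coeff_gdual_mul; exact: esym (coeff_shuffle _ _ f).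
- apply: forest_coeff_eq => f; rewrite [LHS]coeff_gdual_one.
  exact: esym (coeff1 k f).
- exact: transpose_comul.
- move=> phi; rewrite [LHS]coeff_transpose word_nil ferU1.
  by [].
Qed.

End GradedDual.

Theorem mainTheorem4 (k : fieldType) (k_char0 : [pchar k] =i pred0)
    (A : finType) :
  hopf_morphism (@fer k A) /\
  exists J : H_PLOT k A -> H_MKW k A,
    (forall phi y, forest_pairing (J phi) y = gdual_eval phi (fer y)) /\
    hopf_isomorphism J.
Proof.
split; first exact: fer_hopf_morphism.
exists (@transpose k A); split; last exact: transpose_hopf.
by move=> phi y; rewrite ferE; exact: pairing_transpose.
Qed.
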